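(* Let $(\mathcal{A}, G, \alpha)$ be a $C^*$-dynamical system, with $\mathcal{A}$ unital. If $|G| < \infty$, then the following are equivalent: (i) $C_r^*(G) \subseteq \mathcal{A} \rtimes_{\alpha,r} G$ has the pure extension property (PEP); (ii) $C_r^*(G) \subseteq \mathcal{A} \rtimes_{\alpha,r} G$ has the almost extension property (AEP); (iii) $C_r^*(G) \subseteq \mathcal{A} \rtimes_{\alpha,r} G$ is aperiodic; (iv) $C_r^*(G) \subseteq \mathcal{A} \rtimes_{\alpha,r} G$ has a unique pseudo-expectation; (v) $C_r^*(G) \subseteq \mathcal{A} \rtimes_{\alpha,r} G$ has a unique conditional expectation; (vi) $|S_{C_G(g)}(\mathcal{A})| = 1$ for all $g \in G$ (i.e., the restricted action $\alpha: C_G(g) \curvearrowright \mathcal{A}$ is uniquely ergodic for all $g \in G$); (vii) $C_r^*(G)' \cap (\mathcal{A} \rtimes_{\alpha,r} G) = Z(C_r^*(G))$; (viii) $\mathcal{A}^{C_G(g)} = \mathbb{C}\mathbf{1}$ for all $g \in G$. In particular, if $\dim(\mathcal{A}) = \infty$, then all of these conditions are false.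
   Context: A $C^*$-dynamical system $(\mathcal{A}, G, \alpha)$ consists of a $C^*$-algebra $\mathcal{A}$, a discrete group $G$ and a homomorphism $\alpha: G \to \operatorname{Aut}(\mathcal{A})$, $g \mapsto \alpha_g$. $\mathcal{A} \rtimes_{\alpha,r} G$ is the reduced crossed product, generated by $\mathcal{A}$ and unitaries $\lambda_g$ ($g \in G$) with $\lambda_g a \lambda_g^* = \alpha_g(a)$; $C_r^*(G) \subseteq \mathcal{A} \rtimes_{\alpha,r} G$ is the $C^*$-subalgebra generated by $\{\lambda_g : g \in G\}$. $C_G(g) = \{h \in G : hg = gh\}$ is the centralizer of $g$. For a subgroup $H \subseteq G$, $\mathcal{A}^H = \{a \in \mathcal{A} : \alpha_h(a) = a \ \forall h \in H\}$ and $S_H(\mathcal{A})$ is the set of $H$-invariant states on $\mathcal{A}$. $Z(\cdot)$ denotes the center. For an inclusion $\mathcal{C} \subseteq \mathcal{B}$ of unital $C^*$-algebras with common unit, $PS(\cdot)$ denotes pure states and $I(\mathcal{C})$ denotes the (Hamana) injective envelope of $\mathcal{C}$ (the unique minimal injective operator system containing $\mathcal{C}$; it is a $C^*$-algebra containing $\mathcal{C}$ as a $C^*$-subalgebra). ''ucp'' means unital completely positive. The inclusion $\mathcal{C} \subseteq \mathcal{B}$: - has the PEP if every $\phi \in PS(\mathcal{C})$ extends uniquely to a pure state of $\mathcal{B}$; - has the AEP if the set of pure states of $\mathcal{C}$ which extend uniquely to pure states of $\mathcal{B}$ is weak* dense in $PS(\mathcal{C})$; - is aperiodic if for every $b \in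 \mathcal{B}$, every non-zero hereditary $C^*$-subalgebra $\mathcal{D}$ of $\mathcal{C}$, and every $\varepsilon > 0$, there exist a positive $d \in \mathcal{D}$ with $\|d\| = 1$ and $c \in \mathcal{C}$ such that $\|dbd - c\| < \varepsilon$; - has a unique pseudo-expectation if there is exactly one ucp map $\Psi: \mathcal{B} \to I(\mathcal{C})$ with $\Psi(c) = c$ for all $c \in \mathcal{C}$; - has a unique conditional expectation if there is exactly one ucp map $E: \mathcal{B} \to \mathcal{C}$ with $E(c) = c$ for all $c \in \mathcal{C}$. *)

(* Defs.v *)
From HB Require Import structures.
From mathcomp Require Import all_boot all_order all_algebra all_fingroup.
From mathcomp Require Import complex.
From mathcomp Require Import all_classical all_reals all_analysis.

Set Implicit Arguments.
Unset Strict Implicit.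
Unset Printing Implicit Defensive.

Import Order.TTheory GRing.Theory Num.Theory.
Import numFieldNormedType.Exports.

Local Open Scope classical_set_scope.
Local Open Scope complex_scope.
Local Open Scope ring_scope.

(* Unital C*-algebras. The norm is real-valued and is not the norm of a
   normedModType: a structure inheriting from both GRing.NzRing and
   Num.NormedZmodule cannot be added to the hierarchy outside numDomainType.
   The structure is nontrivial (1 != 0) because algType is. *)
HB.mixin Record isCStarAlgebra (R : realType) A of GRing.Algebra R[i] A := {
  star : A -> A;
  cnorm : A -> R;
  starK : involutive star;
  starD : {morph star : x y / x + y};
  starZ : forall (a : R[i]) (x : A), star (a *: x) = (a^*)%R *: star x;
  starM : forall x y : A, star (x * y) = star y * star x;
  cnorm0_eq0 : forall x : A, cnorm x = 0 -> x = 0;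
  ler_cnormD : forall x y : A, cnorm (x + y) <= cnorm x + cnorm y;
  cnormZ : forall (a : R[i]) (x : A),
    (cnorm (a *: x))%:C = `|a| * (cnorm x)%:C;
  ler_cnormM : forall x y : A, cnorm (x * y) <= cnorm x * cnorm y;
  cnorm_starM : forall x : A, cnorm (star x * x) = cnorm x ^+ 2;
  cnorm_complete : forall u : nat -> A,
    (forall e : R, 0 < e -> \forall m & n \near \oo, cnorm (u m - u n) < e) ->
    exists l : A, cnorm (u n - l) @[n --> \oo] --> (0 : R)
}.

#[short(type="cstarAlgType")]
HB.structure Definition CStarAlgebra (R : realType) :=
  {A of isCStarAlgebra R A & GRing.Algebra R[i] A}.

Lemma cnormN (R : realType) (B : cstarAlgType R) (x : B) : cnorm (- x) = cnorm x.
Proof.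
have := cnormZ (-1) x; rewrite scaleN1r normrN1 mul1r.
by move/complexI.
Qed.

Lemma cnorm_ge0 (R : realType) (B : cstarAlgType R) (x : B) : 0 <= cnorm x.
Proof.
have n0 : cnorm (0 : B) = 0.
  by have := cnormZ 0 (0 : B); rewrite scale0r normr0 mul0r => /complexI.
by have := ler_cnormD x (- x); rewrite subrr n0 cnormN -mulr2n pmulrn_lge0.
Qed.

Definition cnorm_closed (R : realType) (A : cstarAlgType R) (S : set A) :=
  forall x : A,
    (forall e : R, 0 < e -> exists2 y, S y & cnorm (x - y) < e) -> S x.

Definition star_hom (R : realType) (A B : cstarAlgType R) (f : A -> B) :=
  [/\ linear f, monoid_morphism f & {morph f : x / star x}].

Definition is_pos (R : realType) (A : cstarAlgType R) (a : A) :=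
  exists x : A, a = star x * x.

Record cstarSub (R : realType) (A : cstarAlgType R) := CStarSub {
  cs_set :> set A;
  cs1 : cs_set 1;
  csP : forall (a : R[i]) (x y : A),
    cs_set x -> cs_set y -> cs_set (a *: x + y);
  csM : forall x y : A, cs_set x -> cs_set y -> cs_set (x * y);
  csV : forall x : A, cs_set x -> cs_set (star x);
  cs_closed : cnorm_closed cs_set
}.

Section SubAlgebraType.
Variables (R : realType) (A : cstarAlgType R) (S : cstarSub A).

Definition cs_pred : {pred A} := fun x => x \in cs_set S.

Lemma cs_predP x : reflect (cs_set S x) (x \in cs_pred).
Proof. by rewrite unfold_in; apply: (iffP idP) => [/set_mem|/mem_set]. Qed.

Lemma cs_pred_subalg : subalg_closed cs_pred.
Proof.
split.
- by apply/cs_predP; exact: cs1.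
- by move=> a x y /cs_predP Sx /cs_predP Sy; apply/cs_predP; exact: csP.
- by move=> x y /cs_predP Sx /cs_predP Sy; apply/cs_predP; exact: csM.
Qed.

HB.instance Definition _ :=
  GRing.isSubalgClosed.Build R[i] A cs_pred cs_pred_subalg.

Record subalg := SubAlg { subalg_val : A; _ : subalg_val \in cs_pred }.

HB.instance Definition _ := [isSub for subalg_val].
HB.instance Definition _ := [Choice of subalg by <:].
HB.instance Definition _ := [SubChoice_isSubAlgebra of subalg by <:].

Lemma subalgP (x : subalg) : cs_set S (subalg_val x).
Proof. exact/cs_predP/(valP x). Qed.

Definition subalg_of x (Sx : cs_set S x) : subalg :=
  SubAlg (introT (cs_predP x) Sx).

Definition sub_star (x : subalg) : subalg := subalg_of (csV (subalgP x)).

Let svD (x y : subalg) :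
  subalg_val (x + y) = subalg_val x + subalg_val y.
Proof. exact: (raddfD (val : subalg -> A)). Qed.
Let svB (x y : subalg) :
  subalg_val (x - y) = subalg_val x - subalg_val y.
Proof. exact: (raddfB (val : subalg -> A)). Qed.
Let svM (x y : subalg) :
  subalg_val (x * y) = subalg_val x * subalg_val y.
Proof. exact: (rmorphM (val : subalg -> A)). Qed.
Let svZ (a : R[i]) (x : subalg) : subalg_val (a *: x) = a *: subalg_val x.
Proof. exact: (@linearZZ _ _ _ (val : {linear subalg -> A})). Qed.

Lemma sub_starK : involutive sub_star.
Proof. by move=> x; apply: val_inj; rewrite /= starK. Qed.
Lemma sub_starD : {morph sub_star : x y / x + y}.
Proof.
by move=> x y; apply: val_inj; rewrite [RHS]svD -starD -svD; exact: erefl.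
Qed.
Lemma sub_starZ (a : R[i]) x : sub_star (a *: x) = (a^*)%R *: sub_star x.
Proof. by apply: val_inj; rewrite [RHS]svZ -starZ -svZ; exact: erefl. Qed.
Lemma sub_starM x y : sub_star (x * y) = sub_star y * sub_star x.
Proof. by apply: val_inj; rewrite [RHS]svM -starM -svM; exact: erefl. Qed.
Lemma sub_cnorm0 (x : subalg) : cnorm (subalg_val x) = 0 -> x = 0.
Proof.
move=> /cnorm0_eq0 x0; apply: val_inj; rewrite [LHS]x0.
exact/esym/(raddf0 (val : subalg -> A)).
Qed.
Lemma sub_cnormD (x y : subalg) :
  cnorm (subalg_val (x + y)) <= cnorm (subalg_val x) + cnorm (subalg_val y).
Proof. by rewrite svD ler_cnormD. Qed.
Lemma sub_cnormZ (a : R[i]) (x : subalg) :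
  (cnorm (subalg_val (a *: x)))%:C = `|a| * (cnorm (subalg_val x))%:C.
Proof. by rewrite svZ cnormZ. Qed.
Lemma sub_cnormM (x y : subalg) :
  cnorm (subalg_val (x * y)) <= cnorm (subalg_val x) * cnorm (subalg_val y).
Proof. by rewrite svM ler_cnormM. Qed.
Lemma sub_cnorm_starM (x : subalg) :
  cnorm (subalg_val (sub_star x * x)) = cnorm (subalg_val x) ^+ 2.
Proof. by rewrite svM cnorm_starM. Qed.

Lemma sub_cnorm_complete (u : nat -> subalg) :
  (forall e : R, 0 < e ->
     \forall m & n \near \oo, cnorm (subalg_val (u m - u n)) < e) ->
  exists l : subalg, cnorm (subalg_val (u n - l)) @[n --> \oo] --> (0 : R).
Proof.
move=> uC.
have [l ul] : exists l : A,
    cnorm (subalg_val (u n) - l) @[n --> \oo] --> (0 : R).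
  apply: cnorm_complete => e /uC; apply: filterS => -[m n].
  by rewrite -svB.
suff Sl : cs_set S l.
  by exists (subalg_of Sl); under eq_fun do rewrite svB /=.
apply: cs_closed => e e0.
have /cvgrPdist_lt /(_ e e0) [N _ /(_ N (leqnn N))] := ul.
rewrite sub0r normrN ger0_norm ?cnorm_ge0// => uNe.
by exists (subalg_val (u N)); [exact: subalgP | rewrite -cnormN opprB].
Qed.

HB.instance Definition _ := isCStarAlgebra.Build R subalg
  sub_starK sub_starD sub_starZ sub_starM sub_cnorm0 sub_cnormD sub_cnormZ
  sub_cnormM sub_cnorm_starM sub_cnorm_complete.

End SubAlgebraType.

Section Generated.
Variables (R : realType) (A : cstarAlgType R) (X : set A).

Definition cstar_gen_set : set A :=
  [set x | forall S : cstarSub A, X `<=` S -> cs_set S x].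

Lemma cstar_gen1 : cstar_gen_set 1.
Proof. by move=> S _; exact: cs1. Qed.
Lemma cstar_genP (a : R[i]) x y :
  cstar_gen_set x -> cstar_gen_set y -> cstar_gen_set (a *: x + y).
Proof. by move=> gx gy S XS; apply: csP; [exact: gx|exact: gy]. Qed.
Lemma cstar_genM x y :
  cstar_gen_set x -> cstar_gen_set y -> cstar_gen_set (x * y).
Proof. by move=> gx gy S XS; apply: csM; [exact: gx|exact: gy]. Qed.
Lemma cstar_genV x : cstar_gen_set x -> cstar_gen_set (star x).
Proof. by move=> gx S XS; apply: csV; exact: gx. Qed.
Lemma cstar_gen_closed : cnorm_closed cstar_gen_set.
Proof.
move=> x gx S XS; apply: cs_closed => e /gx[y gy xy].
by exists y => //; exact: gy.
Qed.

Definition cstar_gen : cstarSub A :=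
  CStarSub cstar_gen1 cstar_genP cstar_genM cstar_genV cstar_gen_closed.

End Generated.

Section States.
Variables (R : realType) (A : cstarAlgType R).

(* In R[i], 0 <= z means that z is real and nonnegative. *)
Definition state (phi : A -> R[i]) :=
  [/\ scalar phi, forall a, is_pos a -> 0 <= phi a & phi 1 = 1].

Definition pure_state (phi : A -> R[i]) :=
  state phi /\
  forall (f g : A -> R[i]) (t : R), state f -> state g -> 0 < t < 1 ->
    (forall a, phi a = t%:C * f a + (1 - t)%:C * g a) -> f = phi /\ g = phi.

Definition mx_pos n (X : 'M[A]_n) :=
  exists Y : 'M[A]_n, X = (map_mx star Y)^T *m Y.

Definition operator_system (E : set A) :=
  [/\ E 1, forall (a : R[i]) x y, E x -> E y -> E (a *: x + y)
    & forall x, E x -> E (star x)].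

(* Hereditary C*-subalgebras need not contain the unit. *)
Definition hereditary (D : set A) :=
  [/\ D 0, forall (a : R[i]) x y, D x -> D y -> D (a *: x + y),
      forall x y, D x -> D y -> D (x * y),
      forall x, D x -> D (star x)
    & cnorm_closed D] /\
  forall a b, is_pos a -> is_pos (b - a) -> D b -> D a.

End States.

Section Ucp.
Variable R : realType.

(* A map between operator systems is the restriction to E of a function on the
   ambient algebra of E, whose values off E are irrelevant. *)
Definition ucp_on (A B : cstarAlgType R) (E : set A) (F : set B)
    (phi : A -> B) :=
  [/\ forall x, E x -> F (phi x),
      phi 1 = 1,
      forall (a : R[i]) x y, E x -> E y ->
        phi (a *: x + y) = a *: phi x + phi y
    & forall n (X : 'M[A]_n), (forall i j, E (X i j)) ->
        mx_pos X -> mx_pos (map_mx phi X)].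

Definition ucp (A B : cstarAlgType R) (phi : A -> B) := ucp_on setT setT phi.

Definition injective_system (I : cstarAlgType R) (S : set I) :=
  operator_system S /\
  forall (D : cstarAlgType R) (E F : set D),
    operator_system E -> operator_system F -> E `<=` F ->
  forall phi : D -> I, ucp_on E S phi ->
  exists2 psi : D -> I, ucp_on F S psi & forall x, E x -> psi x = phi x.

Definition injective_envelope (C I : cstarAlgType R) (kappa : C -> I) :=
  [/\ star_hom kappa, injective kappa, injective_system [set: I]
    & forall S : set I, range kappa `<=` S -> injective_system S ->
        S = [set: I]].

End Ucp.

Section Inclusions.
Variables (R : realType) (B : cstarAlgType R) (C : cstarSub B).

Definition unique_pure_extension (phi : subalg C -> R[i]) :=
  exists! psi : B -> R[i], pure_state psi /\ psi \o @subalg_val R B C = phi.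

Definition PEP :=
  forall phi, pure_state phi -> unique_pure_extension phi.

(* {ptws _ -> _} carries the topology of pointwise convergence, which on states
   is the weak* topology. *)
Definition AEP :=
  [set phi | pure_state phi] `<=`
  closure ([set phi | pure_state phi /\ unique_pure_extension phi]
           : set {ptws subalg C -> (R[i]^o : topologicalType)}).

Definition aperiodic :=
  forall (b : B) (D : set (subalg C)) (e : R),
    hereditary D -> (exists2 d, D d & d != 0) -> 0 < e ->
  exists d c : subalg C,
    [/\ D d, is_pos d, cnorm d = 1
      & cnorm (subalg_val d * b * subalg_val d - subalg_val c) < e].

Definition unique_pseudo_expectation :=
  exists (I : cstarAlgType R) (kappa : subalg C -> I),
    injective_envelope kappa /\
    exists! Psi : B -> I, ucp Psi /\ forall c, Psi (subalg_val c) = kappa c.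

Definition unique_conditional_expectation :=
  exists! E : B -> subalg C, ucp E /\ forall c, E (subalg_val c) = c.

Definition relative_commutant : set B :=
  [set b | forall c, cs_set C c -> b * c = c * b].

Definition sub_center : set B := [set b | cs_set C b /\ relative_commutant b].

End Inclusions.

Section DynamicalSystems.
Variables (R : realType) (A : cstarAlgType R) (G : finGroupType).

Record cstar_action := CStarAction {
  cact :> G -> A -> A;
  cact_hom : forall g, star_hom (cact g);
  cact1 : cact 1%g =1 id;
  cactM : forall g h, cact (g * h)%g =1 cact g \o cact h
}.

Variable alpha : cstar_action.

Definition fixed_points (H : {set G}) : set A :=
  [set a | forall h, h \in H -> alpha h a = a].

Definition invariant_state (H : {set G}) (phi : A -> R[i]) :=
  state phi /\ forall h a, h \in H -> phi (alpha h a) = phi a.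

Definition uniquely_ergodic (H : {set G}) :=
  exists! phi : A -> R[i], invariant_state H phi.

Definition l2_inner (xi eta : {ffun G -> A}) : A :=
  \sum_g star (xi g) * eta g.

(* The reduced crossed product, up to isomorphism: the C*-algebra generated by
   the regular covariant representation on the right Hilbert A-module
   l^2(G, A), which for finite G consists of all functions G -> A. The map
   rcp_rep is a faithful *-homomorphism into the C*-algebra of adjointable
   operators on this module, so it is isometric and the norm of rcp_alg is the
   reduced norm; covariance and unitarity follow from the two formulas. *)
Record reduced_crossed_product := ReducedCrossedProduct {
  rcp_alg :> cstarAlgType R;
  rcp_emb : A -> rcp_alg;
  rcp_unit : G -> rcp_alg;
  rcp_rep : rcp_alg -> {ffun G -> A} -> {ffun G -> A};
  rcp_rep_linear : forall (z : R[i]) (b b' : rcp_alg) xi,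
    rcp_rep (z *: b + b') xi = z *: rcp_rep b xi + rcp_rep b' xi;
  rcp_rep1 : forall xi, rcp_rep 1 xi = xi;
  rcp_repM : forall (b b' : rcp_alg) xi,
    rcp_rep (b * b') xi = rcp_rep b (rcp_rep b' xi);
  rcp_rep_star : forall (b : rcp_alg) xi eta,
    l2_inner (rcp_rep b xi) eta = l2_inner xi (rcp_rep (star b) eta);
  rcp_rep_inj : injective rcp_rep;
  rcp_rep_emb : forall a xi g,
    rcp_rep (rcp_emb a) xi g = alpha g^-1%g a * xi g;
  rcp_rep_unit : forall s xi g,
    rcp_rep (rcp_unit s) xi g = xi (s^-1 * g)%g;
  rcp_gen : cstar_gen (range rcp_emb `|` range rcp_unit) = [set: rcp_alg]
              :> set rcp_alg
}.

Definition group_cstar (P : reduced_crossed_product) : cstarSub P :=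
  cstar_gen (range (@rcp_unit P)).

End DynamicalSystems.

Definition scalars (R : realType) (A : cstarAlgType R) : set A :=
  [set z%:A | z in [set: R[i]]].
Arguments scalars {R} A.

Definition finite_dimensional (R : realType) (A : cstarAlgType R) :=
  exists (n : nat) (v : 'I_n -> A), forall a : A,
    exists c : 'I_n -> R[i], a = \sum_(i < n) c i *: v i.

(* Main.v *)
Require Import Defs.
From HB Require Import structures.
From mathcomp Require Import all_boot all_order all_algebra all_fingroup.
From mathcomp Require Import complex ring lra.
From mathcomp Require Import all_classical all_reals all_analysis.

(**
  Since G is finite, C = C*_r(G) is the span of the unitaries [u_g], and every
  condition is equivalent to [C' /\ B = Z(C)], where B is the crossed product.

  Writing elements of B as [sum a_g u_g], an element commutes with C iff
  [a_(h g h^-1) = alpha_h (a_g)], which gives (vii) <-> (viii); averaging over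
  the centralizer gives (vi) <-> (viii).  A pure state of C is compression by a
  projection [p] with [p C p = C p], and its extensions to B are the states of
  [p B p].  Under (vii) averaging over G shows [p B p = C p], which gives PEP and
  aperiodicity.  Conversely, if [b] commutes with C and lies outside C, then
  [J = {c | b c in C}] is a proper ideal of C and a pure state of C vanishing on
  J contradicts both AEP and aperiodicity.

  Conditional expectations are C-bimodule maps, hence determined by their trace
  on G-averages, which lie in [C' /\ B].  If (vii) fails then either A has two
  G-invariant states or the invariant state is faithful, and in that case
  [b |-> E (w b w)] with [w^2 = 1 + e (y - E y)], [y] in [C' /\ B] outside C, is a
  second conditional expectation.  Arveson's theorem shows that C is injective,
  so pseudo-expectations are conditional expectations.

  Finally, if [A^G] is scalar, the invariant state satisfies
  [x^* x <= |G| phi (x^* x)], which bounds orthonormal families by [|G|^2].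
*)

Set Implicit Arguments.
Unset Strict Implicit.
Unset Printing Implicit Defensive.

Import Order.TTheory GRing.Theory Num.Theory.
Import numFieldNormedType.Exports.

Local Open Scope complex_scope.
Local Open Scope classical_set_scope.
Local Open Scope ring_scope.

Local Notation Re := (@complex.Re _).
Local Notation Im := (@complex.Im _).

(** * Linear identities in a module *)

(** Neither Gelfand theory, nor the GNS construction, nor the structure of finite-dimensional
    C*-algebras is invoked. Square roots come from an iteration, and Kaplansky's theorem turns the
    elements [x^* x] into a cone. Minimal projections of C come from densities: a pure state is
    [c |-> tr (q q c)], and purity makes [q] a multiple of a projection. One extension theorem for
    positive functionals, [krein_extension], serves three times: for pure states carried by a
    projection, for the pure state vanishing on J, and for Arveson's theorem. Besides extremality it
    controls a value: the pure state [psi] found for [y] satisfies [p y p <= (psi y + eps) p]. Used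
    for [y] and [- y], this turns the agreement of all pure states carried by [p] at [y] into
    [p y p = z p], which is how uniqueness of extensions becomes algebra. Matrices over a C*-algebra
    must be made into a C*-algebra themselves, so that positivity as a form yields a Gram
    factorization, as complete positivity demands. *)

Inductive lin_expr (K : Type) :=
  LinZero | LinVar of nat | LinAdd of lin_expr K & lin_expr K
| LinOpp of lin_expr K | LinScale of K & lin_expr K
| LinNat of lin_expr K & nat.
Arguments LinZero {K}.
Arguments LinVar {K}.

Section LinExpr.
Variables (K : nzRingType) (V : lmodType K).

Fixpoint lin_eval (env : seq V) (e : lin_expr K) : V :=
  match e with
  | LinZero => 0
  | LinVar n => nth 0 env n
  | LinAdd a b => lin_eval env a + lin_eval env b
  | LinOpp a => - lin_eval env a
  | LinScale k a => k *: lin_eval env a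
  | LinNat a n => lin_eval env a *+ n
  end.

Fixpoint lin_coef (i : nat) (e : lin_expr K) : K :=
  match e with
  | LinZero => 0
  | LinVar n => if i == n then 1 else 0
  | LinAdd a b => lin_coef i a + lin_coef i b
  | LinOpp a => - lin_coef i a
  | LinScale k a => k * lin_coef i a
  | LinNat a n => n%:R * lin_coef i a
  end.

Fixpoint lin_coef_eq (n : nat) (e f : lin_expr K) : Prop :=
  if n is m.+1 then lin_coef m e = lin_coef m f /\ lin_coef_eq m e f else True.

Lemma lin_evalE env e :
  lin_eval env e = \sum_(i < size env) lin_coef i e *: nth 0 env i.
Proof.
elim: e => [|n|a IHa b IHb|a IHa|k a IHa|a IHa n] /=.
- by rewrite big1 // => i _; rewrite scale0r.
- have [lt_n|ge_n] := ltnP n (size env); last first.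
    rewrite nth_default// big1 // => i _.
    by rewrite ifN ?scale0r// ltn_eqF// (leq_trans (ltn_ord i) ge_n).
  rewrite (bigD1 (Ordinal lt_n)) //= eqxx scale1r big1 ?addr0 // => i.
  by rewrite -val_eqE /= => /negPf ->; rewrite scale0r.
- by rewrite IHa IHb -big_split; apply: eq_bigr => i _; rewrite scalerDl.
- by rewrite IHa -sumrN; apply: eq_bigr => i _; rewrite scaleNr.
- by rewrite IHa scaler_sumr; apply: eq_bigr => i _; rewrite scalerA.
- rewrite IHa -sumrMnl; apply: eq_bigr => i _.
  by rewrite -scaler_nat scalerA.
Qed.

Lemma lin_eval_eq env e f :
  lin_coef_eq (size env) e f -> lin_eval env e = lin_eval env f.
Proof.
move=> ef; rewrite !lin_evalE; apply: eq_bigr => i _; congr (_ *: _).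
elim: (size env) i ef => [[]//|n IHn] [i /= i_lt] [eq_n eq_lt].
move: i_lt; rewrite ltnS leq_eqVlt => /orP[/eqP -> //|i_lt].
exact: (IHn (Ordinal i_lt)).
Qed.

End LinExpr.

(* Atoms are compared up to unification: the rewrite rules of rings and of
   algebras leave convertible but distinct structures in the products. *)
Ltac lin_insert x env :=
  lazymatch env with
  | nil => constr:(cons x nil)
  | cons ?y ?s =>
      match goal with
      | _ => let _ := match goal with _ => unify x y end in env
      | _ => let s' := lin_insert x s in constr:(cons y s')
      end
  end.
Ltac lin_index x env :=
  lazymatch env with
  | cons ?y ?s =>
      match goal with
      | _ => let _ := match goal with _ => unify x y end in constr:(O)
      | _ => let n := lin_index x s in constr:(S n)
      end
  end.
Ltac lin_atoms t env :=
  lazymatch t with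
  | @GRing.zero _ => env
  | @GRing.add _ ?a ?b => let env := lin_atoms a env in lin_atoms b env
  | @GRing.opp _ ?a => lin_atoms a env
  | @GRing.scale _ _ _ ?a => lin_atoms a env
  | @GRing.natmul _ ?a _ => lin_atoms a env
  | ?a => lin_insert a env
  end.
Ltac lin_reify K t env :=
  lazymatch t with
  | @GRing.zero _ => constr:(@LinZero K)
  | @GRing.add _ ?a ?b =>
      let a' := lin_reify K a env in
      let b' := lin_reify K b env in constr:(@LinAdd K a' b')
  | @GRing.opp _ ?a => let a' := lin_reify K a env in constr:(@LinOpp K a')
  | @GRing.scale _ _ ?k ?a =>
      let a' := lin_reify K a env in constr:(@LinScale K k a')
  | @GRing.natmul _ ?a ?n =>
      let a' := lin_reify K a env in constr:(@LinNat K a' n)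
  | ?a => let n := lin_index a env in constr:(@LinVar K n)
  end.

(** Both sides become combinations of common atoms, which leaves one scalar equation per atom. Those
    that [field] or [ring] cannot close, typically because they rest on [i * i = -1], are left to
    the caller. *)
Ltac linear_identity K :=
  lazymatch goal with
  | |- @eq ?T ?l ?r =>
    let env := lin_atoms l (@nil T) in
    let env := lin_atoms r env in
    let l' := lin_reify K l env in
    let r' := lin_reify K r env in
    apply: (@lin_eval_eq _ _ env l' r');
    cbn [size lin_coef_eq lin_coef eq_op Nat.eqb];
    rewrite /=;
    repeat match goal with |- context [@GRing.scale _ _ ?a ?b] =>
      change (@GRing.scale _ _ a b) with (a * b) end;
    repeat (split; [try by [field | ring]|]); try exact: I
  end.
Ltac expand_products :=
  rewrite ?expr2; do 3!rewrite ?(mulrDl, mulrDr, mulNr, mulrN, opprD, opprK,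
    mul1r, mulr1, mul0r, mulr0, scalerDr, scalerN, scalerA, mulrA, mulrnAl,
    mulrnAr) -?scalerAl -?scalerAr.

(** * Positivity in C*-algebras *)

Section ComplexScalars.
Variable R : realType.

Lemma conj_real (t : R) : (t%:C)^*%R = t%:C.
Proof. by apply: conj_Creal; apply/complex_realP; exists t. Qed.

Lemma conj_i : ('i%C : R[i])^*%R = - 'i%C.
Proof. by rewrite -[LHS]/(conjc _) /= -[RHS]/(_ +i* _)%C oppr0. Qed.

Lemma ler_gt0_mul (a K : R) : (forall e, 0 < e -> a <= K * e) -> a <= 0.
Proof.
move=> aK; rewrite leNgt; apply/negP => a0.
have K0 : 0 < `|K| + 1 by rewrite ltr_wpDl.
have e0 : 0 < a / (2 * (`|K| + 1)) by rewrite divr_gt0// mulr_gt0.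
have /aK : 0 < a / (2 * (`|K| + 1)) by [].
rewrite leNgt => /negP; apply.
apply: (@le_lt_trans _ _ (`|K| * (a / (2 * (`|K| + 1))))).
  by rewrite ler_pM2r// ler_norm.
rewrite mulrA ltr_pdivrMr ?mulr_gt0// mulrC ltr_pM2l//.
by have := normr_ge0 K; lra.
Qed.

End ComplexScalars.

Section CStarBasics.
Variables (R : realType) (A : cstarAlgType R).
Implicit Types (x y z h k l : A) (t s : R).

Lemma star0 : star (0 : A) = 0.
Proof. by apply: (@addrI _ (star 0)); rewrite -starD !addr0. Qed.

Lemma starN x : star (- x) = - star x.
Proof. by apply: (@addrI _ (star x)); rewrite -starD !subrr star0. Qed.

Lemma starB x y : star (x - y) = star x - star y.
Proof. by rewrite starD starN. Qed.

Lemma star1 : star (1 : A) = 1.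
Proof. by rewrite -[LHS]mulr1 -[X in _ * X]starK -starM mulr1 starK. Qed.

Lemma starZr t x : star (t%:C *: x) = t%:C *: star x.
Proof. by rewrite starZ conj_real. Qed.

Lemma star_sum I (r : seq I) (P : pred I) (F : I -> A) :
  star (\sum_(i <- r | P i) F i) = \sum_(i <- r | P i) star (F i).
Proof. exact: (big_morph _ starD star0). Qed.

Lemma cnorm0 : cnorm (0 : A) = 0.
Proof. by have := cnormZ 0 (0 : A); rewrite scale0r normr0 mul0r => /complexI. Qed.

Lemma cnormZr t x : cnorm (t%:C *: x) = `|t| * cnorm x.
Proof.
apply: complexI; rewrite cnormZ rmorphM /=; congr (_ * _).
by rewrite normc_def /= expr0n /= addr0 sqrtr_sqr.
Qed.

Lemma cnormZi x : cnorm ('i%C *: x) = cnorm x.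
Proof.
apply: complexI; rewrite cnormZ normc_def /= expr0n /= add0r expr1n sqrtr1.
by rewrite mul1r.
Qed.

Lemma cnormB x y : cnorm (x - y) = cnorm (y - x).
Proof. by rewrite -cnormN opprB. Qed.

Lemma cnorm_sub x y : cnorm (x - y) <= cnorm x + cnorm y.
Proof. by rewrite (le_trans (ler_cnormD _ _))// cnormN. Qed.

Lemma cnorm_star x : cnorm (star x) = cnorm x.
Proof.
suff le_star z : cnorm z <= cnorm (star z).
  by apply/eqP; rewrite eq_le le_star -{2}(starK x) le_star.
have [->|z0] := eqVneq (cnorm z) 0; first exact: cnorm_ge0.
have zp : 0 < cnorm z by rewrite lt_def z0 cnorm_ge0.
by rewrite -(ler_pM2r zp) -expr2 -cnorm_starM ler_cnormM.
Qed.

Lemma cnorm1 : cnorm (1 : A) = 1.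
Proof.
have n1 : cnorm (1 : A) != 0.
  by apply/eqP => /cnorm0_eq0/eqP; rewrite oner_eq0.
apply: (mulfI n1); rewrite mulr1 -expr2 -cnorm_starM star1 mulr1 //.
Qed.

Lemma cnorm_sum I (r : seq I) (P : pred I) (F : I -> A) :
  cnorm (\sum_(i <- r | P i) F i) <= \sum_(i <- r | P i) cnorm (F i).
Proof.
elim/big_ind2: _ => [|x a y b xa yb|//]; first by rewrite cnorm0.
by rewrite (le_trans (ler_cnormD _ _))// lerD.
Qed.

Lemma cnorm_le0 x : cnorm x <= 0 -> x = 0.
Proof.
by move=> x0; apply: cnorm0_eq0; apply/eqP; rewrite eq_le x0 cnorm_ge0.
Qed.

Lemma star_mul_eq0 x : star x * x = 0 -> x = 0.
Proof.
move=> x0; apply: cnorm0_eq0; apply/eqP.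
by rewrite -sqrf_eq0 -cnorm_starM x0 cnorm0.
Qed.

Lemma cnorm_dist_le K x y :
  (forall e : R, 0 < e -> cnorm (x - y) <= K * e) -> x = y.
Proof.
by move=> /ler_gt0_mul /cnorm_le0 xy; apply/eqP; rewrite -subr_eq0 xy.
Qed.

(** Majorant method: the increments of [u] are absorbed by those of a bounded real sequence, which
    is nondecreasing because norms are nonnegative. *)
Lemma cnorm_cauchy (u : nat -> A) (r : nat -> R) (M : R) :
    (forall m n, (m <= n)%N -> cnorm (u n - u m) <= r n - r m) ->
    (forall n, r n <= M) ->
  exists l : A, forall e : R, 0 < e ->
    exists N, forall n, (N <= n)%N -> cnorm (u n - l) < e.
Proof.
move=> ur rM.
have r_incr : {homo r : m n / (m <= n)%N >-> m <= n}.
  by move=> m n /ur mn; rewrite -subr_ge0 (le_trans _ mn)// cnorm_ge0.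
have r_cvg : cvgn r.
  by apply: nondecreasing_is_cvgn => //; exists M => _ [n _ <-].
have [l ul] : exists l : A, cnorm (u n - l) @[n --> \oo] --> (0 : R).
  apply: cnorm_complete => e e0.
  have e20 : 0 < e / 2 by rewrite divr_gt0.
  have /cvgrPdist_lt /(_ _ e20) [N _ NP] := r_cvg.
  exists ([set n | (N <= n)%N], [set n | (N <= n)%N]).
    by split; exists N.
  move=> [m n] [/= Nm Nn].
  wlog mn : m n Nm Nn / (m <= n)%N => [H|].
    have [/H|/ltnW/H] := leqP m n; first exact.
    by rewrite cnormB; exact.
  rewrite cnormB (le_lt_trans (ur _ _ mn))//.
  have := NP _ Nm; have := NP _ Nn; rewrite /= !ltr_distl => /andP[? ?] /andP[? ?].
  lra.
exists l => e e0.
have /cvgrPdist_lt /(_ _ e0) [N _ NP] := ul.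
exists N => n /NP /=; rewrite sub0r normrN ger0_norm//; exact: cnorm_ge0.
Qed.

(* The iteration y' = (x + y^2) / 2 is dominated by the same iteration at the
   scalar 1, which increases to 1; its limit solves (1 - y)^2 = 1 - x. *)
Lemma sqrt_one_sub x : star x = x -> cnorm x <= 1 ->
  exists y, [/\ star y = y, cnorm y <= 1, (1 - y) * (1 - y) = 1 - x
    & forall z, z * x = x * z -> z * y = y * z].
Proof.
move=> sx nx.
pose u := fix u n := if n is m.+1 then 2^-1%:C *: (x + u m * u m) else 0 : A.
pose r := fix r n := if n is m.+1 then 2^-1 * (1 + r m * r m) else 0 : R.
have r01 n : 0 <= r n <= 1 by elim: n => [|n /andP[? ?]] /=; nra.
have un n : cnorm (u n) <= r n.
  elim: n => [|n IHn] /=; first by rewrite cnorm0.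
  rewrite cnormZr ger0_norm ?invr_ge0// ler_pM2l ?invr_gt0//.
  rewrite (le_trans (ler_cnormD _ _))// lerD// (le_trans (ler_cnormM _ _))//.
  by rewrite ler_pM ?cnorm_ge0.
(* Each [u n] is a polynomial in [x]; in the limit this gives the commutation clause. *)
have u_comm z : z * x = x * z -> forall n, z * u n = u n * z.
  move=> zx; elim=> [|n IHn] /=; first by rewrite mulr0 mul0r.
  rewrite -scalerAr -scalerAl mulrDl mulrDr zx mulrA IHn -!mulrA IHn //.
have us n : star (u n) = u n.
  by elim: n => [|n IHn] /=; rewrite ?star0// starZr starD starM IHn sx.
have urS n : cnorm (u n.+1 - u n) <= r n.+1 - r n.
  elim: n => [|n IHn].
    rewrite /= subr0 mulr0 addr0 cnormZr ger0_norm ?invr_ge0// mulr0 addr0 subr0.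
    by rewrite ler_pM2l ?invr_gt0.
  have cu : u n.+1 * u n = u n * u n.+1.
    by apply: (u_comm) => //; symmetry; apply: (u_comm).
  have -> : u n.+2 - u n.+1 = 2^-1%:C *: ((u n.+1 - u n) * (u n.+1 + u n)).
    transitivity (2^-1%:C *: (x + u n.+1 * u n.+1) - 2^-1%:C *: (x + u n * u n)).
      by [].
    move: (u n.+1) (u n) cu => a b ab.
    by expand_products; rewrite ab; linear_identity R[i].
  have -> : r n.+2 - r n.+1 = 2^-1 * ((r n.+1 - r n) * (r n.+1 + r n)).
    transitivity (2^-1 * (1 + r n.+1 * r n.+1) - 2^-1 * (1 + r n * r n)).
      by [].
    ring.
  rewrite cnormZr ger0_norm ?invr_ge0// ler_pM2l ?invr_gt0//.
  rewrite (le_trans (ler_cnormM _ _))// ler_pM ?cnorm_ge0//.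
  by rewrite (le_trans (ler_cnormD _ _))// lerD.
have ur m n : (m <= n)%N -> cnorm (u n - u m) <= r n - r m.
  elim: n => [|n IHn]; first by rewrite leqn0 => /eqP ->; rewrite !subrr cnorm0.
  rewrite leq_eqVlt => /orP[/eqP ->|]; first by rewrite !subrr cnorm0.
  rewrite ltnS => /IHn IH.
  have -> : u n.+1 - u m = (u n.+1 - u n) + (u n - u m) by rewrite addrA subrK.
  have -> : r n.+1 - r m = (r n.+1 - r n) + (r n - r m) by rewrite addrA subrK.
  by rewrite (le_trans (ler_cnormD _ _))// lerD.
have [|y uy] := @cnorm_cauchy u r 1 ur; first by move=> n; case/andP: (r01 n).
have near_y e : 0 < e -> exists n, cnorm (u n - y) <= e /\ cnorm (u n.+1 - y) <= e.
  by move=> /uy[N NP]; exists N; split; apply/ltW/NP.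
have sy : star y = y.
  apply: (@cnorm_dist_le 2) => e /near_y[n [ny _]].
  have -> : star y - y = (u n - y) - star (u n - y).
    by rewrite starB us; linear_identity R[i].
  by rewrite (le_trans (cnorm_sub _ _))// cnorm_star; lra.
have y2 : 2^-1%:C *: (x + y * y) = y.
  apply: (@cnorm_dist_le (1 + (1 + cnorm y))) => e /near_y[n [ny nSy]].
  have -> : 2^-1%:C *: (x + y * y) - y =
      (u n.+1 - y) - 2^-1%:C *: ((u n - y) * u n + y * (u n - y)).
    by rewrite /=; expand_products; linear_identity R[i].
  have h1 : cnorm ((u n - y) * u n) <= e * 1.
    rewrite (le_trans (ler_cnormM _ _))// ler_pM ?cnorm_ge0//.
    by rewrite (le_trans (un n))//; case/andP: (r01 n).
  have h2 : cnorm (y * (u n - y)) <= cnorm y * e.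
    by rewrite (le_trans (ler_cnormM _ _))// ler_pM ?cnorm_ge0.
  rewrite (le_trans (cnorm_sub _ _))// cnormZr ger0_norm ?invr_ge0//.
  have := ler_cnormD ((u n - y) * u n) (y * (u n - y)).
  have := cnorm_ge0 ((u n - y) * u n + y * (u n - y)).
  lra.
exists y; split=> //.
    apply/ler_addgt0Pr => e /near_y[n [ny _]].
    rewrite -(subrK (u n) y) addrC (le_trans (ler_cnormD _ _))// cnormB lerD//.
    by rewrite (le_trans (un n))//; case/andP: (r01 n).
  have -> : x = 2%:R *: y - y * y by rewrite -{1}y2; linear_identity R[i].
  by expand_products; linear_identity R[i].
move=> z zx; apply: (@cnorm_dist_le (2 * cnorm z)) => e /near_y[n [ny _]].
have -> : z * y - y * z = (u n - y) * z - z * (u n - y).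
  by expand_products; rewrite (u_comm z zx); linear_identity R[i].
have := ler_cnormM z (u n - y); have := ler_cnormM (u n - y) z.
have := cnorm_ge0 z; have := cnorm_sub ((u n - y) * z) (z * (u n - y)).
nra.
Qed.
End CStarBasics.

Section SelfAdjointSquares.
Variables (R : realType) (A : cstarAlgType R).
Implicit Types (x y z h k l : A) (t s : R).

(** The working notion of positivity until [is_posP]: stability under sums is within reach for
    squares of self-adjoint elements, and Kaplansky's theorem needs it. *)
Definition sa_square h := exists2 k, star k = k & h = k * k.

Lemma sa_square_sa h : sa_square h -> star h = h.
Proof. by move=> [k sk ->]; rewrite starM sk. Qed.

(* [h + i k] is unitary. *)
Lemma cnorm_le1_circle h k : star h = h -> star k = k -> h * k = k * h ->
  h * h + k * k = 1 -> cnorm h <= 1.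
Proof.
move=> sh sk hk hk1; pose u := h + 'i%C *: k.
have i2 : 'i%C * 'i%C = -1 :> R[i] by rewrite -expr2 sqr_i.
have su : star u = h - 'i%C *: k by rewrite /u starD starZ sh sk conj_i scaleNr.
have nu : cnorm u = 1.
  have : cnorm u ^+ 2 = 1.
    rewrite -cnorm_starM su; transitivity (cnorm (1 : A)); last exact: cnorm1.
    congr cnorm; rewrite /u; transitivity (h * h + k * k) => //.
    by expand_products; rewrite hk; linear_identity R[i]; ring: i2.
  by move=> /eqP; rewrite sqrp_eq1 ?cnorm_ge0// => /eqP.
have -> : h = 2^-1%:C *: (u + star u) by rewrite su /u; linear_identity R[i].
rewrite cnormZr ger0_norm ?invr_ge0//.
have := ler_cnormD u (star u); rewrite cnorm_star nu; lra.
Qed.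

Lemma cnorm_sqr h : star h = h -> cnorm (h * h) = cnorm h ^+ 2.
Proof. by move=> sh; rewrite -{1}sh cnorm_starM. Qed.

(** For [h = k^2] and [(1 - y)^2 = 1 - h] the commuting elements [1 - y] and [k] lie on the unit
    circle, so [1 - y] is the real part of a unitary. *)
Lemma sa_square_cnorm1 h : sa_square h -> cnorm h <= 1 -> cnorm (1 - h) <= 1.
Proof.
move=> [k sk ->] nk.
have skk : star (k * k) = k * k by rewrite starM sk.
have [y [sy _ y2 yc]] := sqrt_one_sub skk nk.
have s1y : star (1 - y) = 1 - y by rewrite starB star1 sy.
rewrite -y2 cnorm_sqr// expr_le1// ?cnorm_ge0//.
apply: (@cnorm_le1_circle _ k) => //.
  have /yc ky : k * (k * k) = k * k * k by rewrite mulrA.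
  by rewrite mulrBl mulrBr mul1r mulr1 ky.
by rewrite y2 subrK.
Qed.

Lemma sa_squareZ t h : 0 <= t -> sa_square h -> sa_square (t%:C *: h).
Proof.
move=> t0 [k sk ->]; exists ((Num.sqrt t)%:C *: k); first by rewrite starZr sk.
by rewrite -scalerAl -scalerAr scalerA -rmorphM /= -(expr2 (Num.sqrt _)) sqr_sqrtr.
Qed.

Lemma sa_square0 : sa_square 0.
Proof. by exists 0; rewrite ?star0 ?mulr0. Qed.

Lemma sa_square_sub_cnorm t h :
  sa_square h -> cnorm h <= t -> cnorm (t%:C *: 1 - h) <= t.
Proof.
move=> hP ht; have t0 : 0 <= t by apply: le_trans ht; exact: cnorm_ge0.
have [teq0|tn0] := eqVneq t 0.
  move: ht; rewrite teq0 => /cnorm_le0 ->.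
  by rewrite scale0r subr0 cnorm0.
have tp : 0 < t by rewrite lt_def tn0.
have -> : t%:C *: 1 - h = t%:C *: (1 - t^-1%:C *: h).
  by rewrite scalerBr scalerA -rmorphM /= divff// scale1r.
rewrite cnormZr ger0_norm// -[X in _ <= X]mulr1 ler_pM2l//.
apply: sa_square_cnorm1; first by apply: sa_squareZ => //; rewrite invr_ge0.
by rewrite cnormZr ger0_norm ?invr_ge0// mulrC ler_pdivrMr// mul1r.
Qed.

(** Converse of [sa_square_sub_cnorm]: [h / s] is [1 - x] with [x] in the unit ball. The root
    [1 - y] is again a square because [y] is in the unit ball too. *)
Lemma sa_sqrt s h : star h = h -> 0 < s -> cnorm (s%:C *: 1 - h) <= s ->
  exists k, [/\ star k = k, h = k * k & forall z, z * h = h * z -> z * k = k * z]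
    /\ sa_square k.
Proof.
move=> sh s0 ns; pose x := 1 - s^-1%:C *: h.
have sx : star x = x by rewrite starB star1 starZr sh.
have s1 : (s%:C : R[i]) * s^-1%:C = 1 by rewrite -rmorphM /= divff// gt_eqF.
have nx : cnorm x <= 1.
  rewrite -(ler_pM2l s0) mulr1 -{1}(gtr0_norm s0) -cnormZr.
  by rewrite /x scalerBr scalerA s1 scale1r.
have [y [sy ny y2 yc]] := sqrt_one_sub sx nx.
exists ((Num.sqrt s)%:C *: (1 - y)); split; last first.
  apply: sa_squareZ; first exact: sqrtr_ge0.
  have [w [sw _ w2 _]] := sqrt_one_sub sy ny.
  by exists (1 - w); rewrite ?w2// starB star1 sw.
split.
- by rewrite starZr starB star1 sy.
- rewrite -scalerAl -scalerAr scalerA -rmorphM /= -(expr2 (Num.sqrt _)) sqr_sqrtr ?ltW// y2.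
  by rewrite /x opprB addrC subrK scalerA s1 scale1r.
- move=> z zh; rewrite -scalerAl -scalerAr mulrBl mulrBr mul1r mulr1 yc//.
  by rewrite /x mulrBl mulrBr mul1r mulr1 -scalerAl -scalerAr zh.
Qed.

Lemma sa_squareI s h : star h = h -> 0 < s -> cnorm (s%:C *: 1 - h) <= s ->
  sa_square h.
Proof. by move=> sh s0 /(sa_sqrt sh s0) [k [[? ? _] _]]; exists k. Qed.

Lemma sa_square_sqrt h : sa_square h ->
  exists k, [/\ star k = k, h = k * k & forall z, z * h = h * z -> z * k = k * z]
    /\ sa_square k.
Proof.
move=> hP; have h0 := cnorm_ge0 h.
apply: (@sa_sqrt (cnorm h + 1)); [exact: sa_square_sa|lra|].
by apply: sa_square_sub_cnorm => //; lra.
Qed.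

(** The norm criterion [|s - h| <= s] adds up by the triangle inequality; the summands 1 keep [s]
    positive. *)
Lemma sa_squareD h k : sa_square h -> sa_square k -> sa_square (h + k).
Proof.
move=> hP kP; have h0 := cnorm_ge0 h; have k0 := cnorm_ge0 k.
apply: (@sa_squareI (cnorm h + 1 + (cnorm k + 1))); [|lra|].
  by rewrite starD !sa_square_sa.
have -> : (cnorm h + 1 + (cnorm k + 1))%:C *: 1 - (h + k) =
    ((cnorm h + 1)%:C *: 1 - h) + ((cnorm k + 1)%:C *: 1 - k).
  by rewrite !rmorphD /=; linear_identity R[i].
rewrite (le_trans (ler_cnormD _ _))// lerD// sa_square_sub_cnorm//; lra.
Qed.

(** The two roots commute, since each commutes with whatever commutes with its square. *)
Lemma sa_squareM h k : h * k = k * h -> sa_square h -> sa_square k ->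
  sa_square (h * k).
Proof.
move=> hk /sa_square_sqrt[h' [[sh eh ch] _]] /sa_square_sqrt[k' [[sk ek ck] _]].
have hk' : h' * k' = k' * h'.
  by apply: (ck); symmetry; apply: (ch).
exists (h' * k'); first by rewrite starM sh sk.
by rewrite eh ek !mulrA; congr (_ * _); rewrite -!mulrA hk'.
Qed.

Lemma sa_squareX h n : sa_square h -> sa_square (h ^+ n).
Proof.
move=> hP; elim: n => [|n IHn].
  by exists 1; rewrite ?star1 ?mulr1.
by rewrite exprS; apply: sa_squareM => //; rewrite -exprS -exprSr.
Qed.

Lemma sa_square_scalar t : 0 <= t -> sa_square (t%:C *: 1).
(* Here [1] is obtained as [0 ^+ 0]. *)
Proof. by move=> t0; apply: sa_squareZ => //; exact: (@sa_squareX 0 0 sa_square0). Qed.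

(** The element [t^2 - h^2 = (t - h)^2 + 2 h (t - h)] is a square [l^2], so [h / t] and [l / t] lie
    on the unit circle. *)
Lemma cnorm_le_of_sa_square t h : 0 <= t ->
  sa_square h -> sa_square (t%:C *: 1 - h) -> cnorm h <= t.
Proof.
wlog t0 : t / 0 < t => [H t0 hP thP|_].
  apply/ler_addgt0Pr => e e0; have te : 0 < t + e by rewrite ltr_wpDl.
  apply: H => //; first exact: ltW.
  have -> : (t + e)%:C *: 1 - h = (t%:C *: 1 - h) + e%:C *: 1.
    by rewrite rmorphD /=; linear_identity R[i].
  by apply: sa_squareD => //; apply: sa_square_scalar; exact: ltW.
move=> hP thP; have sh := sa_square_sa hP.
have /sa_square_sqrt[l [[sl el cl] _]] : sa_square ((t ^+ 2)%:C *: 1 - h * h).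
  have -> : (t ^+ 2)%:C *: 1 - h * h =
      (t%:C *: 1 - h) * (t%:C *: 1 - h) + 2%:C *: (h * (t%:C *: 1 - h)).
    rewrite rmorphXn /= rmorph_nat.
    by expand_products; linear_identity R[i].
  apply: sa_squareD; first by apply: sa_squareM.
  apply: sa_squareZ => //; apply: sa_squareM => //.
  by rewrite mulrBl mulrBr -scalerAl -scalerAr mulr1 mul1r.
have hl : h * l = l * h.
  apply: (cl); rewrite mulrBl mulrBr -scalerAl -scalerAr mulr1 mul1r.
  by rewrite mulrA.
have ti : (t^-1%:C : R[i]) * t^-1%:C * (t ^+ 2)%:C = 1.
  by rewrite -!rmorphM /= expr2 mulrA mulfVK ?gt_eqF// mulVf ?gt_eqF.
have : cnorm (t^-1%:C *: h) <= 1.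
  apply: (@cnorm_le1_circle _ (t^-1%:C *: l)); rewrite ?starZr ?sh ?sl//.
    by rewrite -!scalerAl -!scalerAr hl.
  rewrite -!scalerAl -!scalerAr !scalerA -scalerDr -el addrC subrK scalerA.
  by rewrite ti scale1r.
by rewrite cnormZr ger0_norm ?invr_ge0 ?(ltW t0)// mulrC ler_pdivrMr// mul1r.
Qed.

Lemma sa_square_anti h : sa_square h -> sa_square (- h) -> h = 0.
Proof.
move=> hP nhP; apply: cnorm_le0; apply/ler_addgt0Pr => e e0; rewrite add0r.
apply: cnorm_le_of_sa_square => //; first exact: ltW.
by apply: sa_squareD => //; apply: sa_square_scalar; exact: ltW.
Qed.

Lemma sa_square_le_cnorm h : star h = h -> sa_square ((cnorm h)%:C *: 1 - h).
Proof.
move=> sh; have h0 := cnorm_ge0 h.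
have sx : star ((cnorm h)%:C *: 1 - h) = (cnorm h)%:C *: 1 - h.
  by rewrite starB starZr star1 sh.
have [/cnorm0_eq0 ->|n0] := eqVneq (cnorm h) 0.
  by rewrite cnorm0 scale0r subr0; exact: sa_square0.
apply: (@sa_squareI (cnorm h)) => //; first by rewrite lt_def n0.
by rewrite opprB addrC subrK.
Qed.

(* With [|h|] the square root of [h^2] and [b = (|h| - h) / 2], one has
   [b^2 = |h| b], so [b^3] is a square and [b h b = - b^3]; this avoids knowing
   that [b] is positive. *)
Lemma sa_square_criterion h : star h = h ->
    (forall x y, star y = y -> star x * h * x = - (y * y) -> y = 0) ->
  sa_square h.
Proof.
move=> sh crit.
have [a [[sa ea ca] aP]] := sa_square_sqrt (ex_intro2 _ _ h sh erefl).
have [a' [[sa' ea' ca'] _]] := sa_square_sqrt aP.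
have ha : h * a = a * h by apply: ca; rewrite mulrA.
pose b := 2^-1%:C *: (a - h).
have sb : star b = b by rewrite starZr starB sa sh.
have b2 : b * b = a * b.
  by rewrite /b; expand_products; rewrite ha ea; linear_identity R[i].
have ab : a * b = b * a.
  by rewrite /b -scalerAl -scalerAr mulrBl mulrBr ha.
have ba' : b * a' = a' * b by apply: ca'.
have hb : b * h * b = - (b * a * b).
  rewrite -!mulrA -mulrN; congr (_ * _); rewrite -b2.
  by rewrite /b; expand_products; rewrite ha ea; linear_identity R[i].
have y0 : a' * b = 0.
  apply: (crit b); first by rewrite starM sb sa' ba'.
  rewrite sb hb ea'.
  by rewrite !mulrA ba'.
have b4 : star (b * b) * (b * b) = 0.
  by rewrite b2 ea' -!mulrA y0 !mulr0.
have b0 : b = 0.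
  by apply: star_mul_eq0; rewrite sb; apply: star_mul_eq0.
have -> : h = a.
  apply/eqP; rewrite eq_sym -subr_eq0; apply/eqP.
  have -> : a - h = 2%:R *: b by rewrite /b; linear_identity R[i].
  by rewrite b0 scaler0.
by [].
Qed.

(* Kaplansky: for [y^* y = - k^2] the element [y y^*] is a square, so that
   [k^2 (1 + k^2 / t)^n = - y^* (1 - y y^* / t)^n y] is bounded in [n]. *)
Lemma star_mul_opp_square y k : star k = k -> star y * y = - (k * k) -> y = 0.
Proof.
move=> sk yk.
have kP : sa_square (k * k) by exists k.
(* With [a] and [b] the real and imaginary parts of [y], [y^* y + y y^* = 2 (a^2 + b^2)], and here
   [- y^* y = k^2]. *)
have yyP : sa_square (y * star y).
  pose a := 2^-1%:C *: (y + star y); pose b := 2^-1%:C *: ('i%C *: (star y - y)).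
  have sa : star a = a by rewrite starZr starD starK addrC.
  have sb : star b = b.
    rewrite starZr starZ starB starK conj_i; congr (_ *: _).
    by rewrite scaleNr -scalerN opprB.
  have -> : y * star y = 2%:C *: (a * a + b * b) + k * k.
    have i2 : 'i%C * 'i%C = -1 :> R[i] by rewrite -expr2 sqr_i.
    apply: (@addIr _ (star y * y)); rewrite -addrA -(opprK (k * k)) -yk addNr addr0.
    rewrite /a /b; expand_products; linear_identity R[i]; by field: i2.
  apply: sa_squareD => //; apply: sa_squareZ => //.
  by apply: sa_squareD; [exists a|exists b].
pose t := cnorm (y * star y) + 1.
have t0 : 0 < t by rewrite ltr_wpDl// cnorm_ge0.
pose c := t^-1%:C *: (k * k); pose w := 1 - t^-1%:C *: (y * star y).
have ti0 : 0 <= t^-1 by rewrite invr_ge0 ltW.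
have cP : sa_square c by exact: sa_squareZ.
have nw : cnorm w <= 1.
  apply: sa_square_cnorm1; first exact: sa_squareZ.
  by rewrite cnormZr ger0_norm// mulrC ler_pdivrMr// mul1r /t lerDl.
have nwX n : cnorm (w ^+ n) <= 1.
  elim: n => [|n IHn]; first by rewrite cnorm1.
  rewrite exprS (le_trans (ler_cnormM _ _))// -[X in _ <= X]mulr1.
  by rewrite ler_pM ?cnorm_ge0.
have wy : w * y = y * (1 + c).
  rewrite /w /c mulrBl mul1r mulrDr mulr1 -scalerAl -mulrA yk mulrN scalerN.
  by rewrite opprK -scalerAr.
have wXy n : w ^+ n * y = y * (1 + c) ^+ n.
  elim: n => [|n IHn]; first by rewrite mul1r mulr1.
  by rewrite exprSr -mulrA wy mulrA IHn -mulrA -exprSr.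
pose z n := k * k * (1 + c) ^+ n; pose M := cnorm y ^+ 2.
have zM n : cnorm (z n) <= M.
  have -> : z n = - (star y * (w ^+ n * y)).
    by rewrite wXy mulrA yk mulNr opprK.
  rewrite cnormN (le_trans (ler_cnormM _ _))// cnorm_star /M expr2.
  rewrite ler_wpM2l ?cnorm_ge0// (le_trans (ler_cnormM _ _))//.
  by rewrite -[X in _ <= X]mul1r ler_wpM2r ?cnorm_ge0.
have kc : GRing.comm (k * k) c by rewrite /GRing.comm /c -scalerAr -scalerAl.
have comm_poly x n : GRing.comm x c -> GRing.comm x ((1 + c) ^+ n - 1 - c *+ n).
  move=> xc; have x1 := commr1 x.
  by apply: commrB; [apply: commrB => //; apply: commrX; exact: commrD|exact: commrMn].
(* Bernoulli's inequality bounds [n k^2 c] by [z n], hence by [M] for every [n]; the Archimedean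
   property then forces [k^2 c = 0]. *)
have bernoulli n : sa_square ((1 + c) ^+ n - 1 - c *+ n).
  elim: n => [|n IHn]; first by rewrite expr0 subrr subr0; exact: sa_square0.
  have -> : (1 + c) ^+ n.+1 - 1 - c *+ n.+1 =
      ((1 + c) ^+ n - 1 - c *+ n) * (1 + c) + (c * c) *+ n.
    rewrite exprSr; move: ((1 + c) ^+ n) => v; rewrite mulrSr.
    by expand_products; linear_identity R[i].
  apply: sa_squareD.
    apply: sa_squareM => //; last first.
      by apply: sa_squareD => //; exact: (sa_squareX 0 sa_square0).
    by apply/esym/comm_poly/commr_sym/commrD; [exact: commr1|].
  rewrite -scaler_nat -(rmorph_nat (real_complex R)); apply: sa_squareZ => //.
  by exists c => //; exact: sa_square_sa.
have kcP n : sa_square (k * k * c *+ n).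
  rewrite -scaler_nat -(rmorph_nat (real_complex R)); apply: sa_squareZ => //.
  exact: sa_squareM.
have kcM n : cnorm (k * k * c *+ n) <= M.
  apply: cnorm_le_of_sa_square => //; first exact: sqr_ge0.
  have -> : M%:C *: 1 - k * k * c *+ n = (M - cnorm (z n))%:C *: 1 +
      ((cnorm (z n))%:C *: 1 - z n) +
      (k * k * ((1 + c) ^+ n - 1 - c *+ n) + k * k).
    rewrite /z rmorphB /=; move: ((1 + c) ^+ n) => v.
    by expand_products; linear_identity R[i].
  have zP : sa_square (z n).
    apply: sa_squareM => //.
      by apply: commrX; apply: commrD => //; exact: commr1.
    apply: sa_squareX; apply: sa_squareD => //.
    exact: (sa_squareX 0 sa_square0).
  apply: sa_squareD.
    apply: sa_squareD; first by apply: sa_square_scalar; rewrite subr_ge0.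
    exact/sa_square_le_cnorm/sa_square_sa.
  by apply: sa_squareD => //; apply: sa_squareM => //; exact: comm_poly.
have kc0 : k * k * c = 0.
  apply: cnorm0_eq0; apply/eqP/negPn/negP => kc0.
  have kcp : 0 < cnorm (k * k * c) by rewrite lt_def kc0 cnorm_ge0.
  have := kcM (Num.bound (M / cnorm (k * k * c))).
  rewrite -scaler_nat -(rmorph_nat (real_complex R)) cnormZr ger0_norm//.
  rewrite -ler_pdivlMr// leNgt => /negP; apply.
  by apply: archi_boundP; rewrite divr_ge0 ?sqr_ge0 ?cnorm_ge0.
have k4 : star (k * k) * (k * k) = 0.
  apply: (@scalerI _ _ (t^-1%:C)).
    by rewrite fmorph_eq0 invr_eq0 gt_eqF.
  by rewrite scaler0 starM sk scalerAr.
by apply: star_mul_eq0; rewrite yk (star_mul_eq0 k4) oppr0.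
Qed.

(** Kaplansky's theorem: a violation of the criterion by [x^* x] reads [(x v)^* (x v) = - y^2],
    which [star_mul_opp_square] excludes. *)
Lemma is_posP h : is_pos h <-> sa_square h.
Proof.
split=> [[x ->]|[k sk ->]]; last by exists k; rewrite sk.
apply: sa_square_criterion; first by rewrite starM starK.
move=> v y sy; rewrite mulrA -starM -mulrA => e.
have v0 := star_mul_opp_square sy e.
by apply: star_mul_eq0; rewrite sy -[LHS]opprK -e v0 mulr0 oppr0.
Qed.
End SelfAdjointSquares.

Section PositiveCone.
Variables (R : realType) (A : cstarAlgType R).
Implicit Types (x y z h k l : A) (t s : R).

Lemma pos_star_mul x : is_pos (star x * x).
Proof. by exists x. Qed.

Lemma pos_sqr k : star k = k -> is_pos (k * k).
Proof. by move=> sk; exists k; rewrite sk. Qed.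

Lemma pos_sa h : is_pos h -> star h = h.
Proof. by move=> [x ->]; rewrite starM starK. Qed.

Lemma pos0 : is_pos (0 : A).
Proof. by exists 0; rewrite mulr0. Qed.

Lemma posD h k : is_pos h -> is_pos k -> is_pos (h + k).
Proof. by move=> /is_posP ? /is_posP ?; apply/is_posP/sa_squareD. Qed.

Lemma posZ t h : 0 <= t -> is_pos h -> is_pos (t%:C *: h).
Proof. by move=> ? /is_posP ?; apply/is_posP/sa_squareZ. Qed.

Lemma pos_scalar t : 0 <= t -> is_pos (t%:C *: 1 : A).
Proof. by move=> ?; apply/is_posP/sa_square_scalar. Qed.

Lemma pos_conj x h : is_pos h -> is_pos (star x * h * x).
Proof. by move=> [y ->]; exists (y * x); rewrite starM !mulrA. Qed.

Lemma pos_sum I (r : seq I) (P : pred I) (F : I -> A) :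
  (forall i, P i -> is_pos (F i)) -> is_pos (\sum_(i <- r | P i) F i).
Proof.
by move=> FP; elim/big_ind: _ => //; [exact: pos0|move=> ? ?; exact: posD].
Qed.

Lemma pos_anti h : is_pos h -> is_pos (- h) -> h = 0.
Proof. by move=> /is_posP ? /is_posP ?; apply: sa_square_anti. Qed.

Lemma pos_sum_eq0 (I : finType) (F : I -> A) :
    (forall i, is_pos (F i)) -> \sum_i F i = 0 -> forall i, F i = 0.
Proof.
move=> FP F0 i; apply: pos_anti => //.
suff -> : - F i = \sum_(j | j != i) F j by exact: pos_sum.
by move: F0; rewrite (bigD1 i)//= => /eqP; rewrite addrC addr_eq0 => /eqP ->.
Qed.

Lemma pos_sqrt h : is_pos h ->
  exists k, [/\ star k = k, h = k * k & forall z, z * h = h * z -> z * k = k * z].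
Proof. by move=> /is_posP /sa_square_sqrt[k [? _]]; exists k. Qed.

Lemma pos_cnorm_sub h : star h = h -> is_pos ((cnorm h)%:C *: 1 - h).
Proof. by move=> sh; apply/is_posP/sa_square_le_cnorm. Qed.

Lemma pos_le_sub t h : star h = h -> cnorm h <= t -> is_pos (t%:C *: 1 - h).
Proof.
move=> sh ht.
have -> : t%:C *: 1 - h = (t - cnorm h)%:C *: 1 + ((cnorm h)%:C *: 1 - h).
  by rewrite rmorphB /=; linear_identity R[i].
by apply: posD; [apply: pos_scalar; rewrite subr_ge0|exact: pos_cnorm_sub].
Qed.

Lemma pos_le_add t h : star h = h -> cnorm h <= t -> is_pos (t%:C *: 1 + h).
Proof.
by move=> sh ht; rewrite -(opprK h); apply: pos_le_sub; rewrite ?starN ?sh ?cnormN.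
Qed.

Lemma cnorm_pos_le t h : 0 <= t -> is_pos h -> is_pos (t%:C *: 1 - h) ->
  cnorm h <= t.
Proof. by move=> t0 /is_posP ? /is_posP ?; apply: cnorm_le_of_sa_square. Qed.

(** Turns norm estimates into order estimates, which star homomorphisms and sums of Gram terms
    respect. *)
Lemma cnorm_leP t x : 0 <= t ->
  cnorm x <= t <-> is_pos ((t ^+ 2)%:C *: 1 - star x * x).
Proof.
move=> t0; split=> [xt|/(cnorm_pos_le (sqr_ge0 t) (pos_star_mul x))].
  apply: pos_le_sub; first by rewrite starM starK.
  by rewrite cnorm_starM ler_pXn2r// nnegrE cnorm_ge0.
by rewrite cnorm_starM ler_pXn2r// nnegrE cnorm_ge0.
Qed.

Lemma sa_cnorm_le t h : 0 <= t -> star h = h -> is_pos (t%:C *: 1 - h) ->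
  is_pos (t%:C *: 1 + h) -> cnorm h <= t.
Proof.
move=> t0 sh /is_posP hP1 /is_posP hP2.
suff : cnorm h ^+ 2 <= t ^+ 2 by rewrite ler_pXn2r// nnegrE cnorm_ge0.
rewrite -cnorm_sqr//; apply: cnorm_pos_le; rewrite ?sqr_ge0//.
  exact: pos_sqr.
have -> : (t ^+ 2)%:C *: 1 - h * h = (t%:C *: 1 - h) * (t%:C *: 1 + h).
  by rewrite rmorphXn /=; expand_products; linear_identity R[i].
apply/is_posP/sa_squareM => //.
by expand_products; linear_identity R[i].
Qed.

Lemma pos_criterion h : star h = h ->
    (forall x y, star y = y -> star x * h * x = - (y * y) -> y = 0) ->
  is_pos h.
Proof. by move=> ? ?; apply/is_posP/sa_square_criterion. Qed.

Definition re_part x := 2^-1%:C *: (x + star x).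
Definition im_part x := re_part ((- 'i%C) *: x).

Lemma re_part_sa x : star (re_part x) = re_part x.
Proof. by rewrite starZr starD starK addrC. Qed.

Lemma re_im_part x : x = re_part x + 'i%C *: im_part x.
Proof.
have i2 : 'i%C * 'i%C = -1 :> R[i] by rewrite -expr2 sqr_i.
rewrite /im_part /re_part starZ rmorphN /= conj_i.
by linear_identity R[i]; by field: i2.
Qed.

Lemma cnorm_re_part x : cnorm (re_part x) <= cnorm x.
Proof.
rewrite cnormZr ger0_norm ?invr_ge0//.
by have := ler_cnormD x (star x); rewrite cnorm_star; lra.
Qed.

Lemma cnorm_im_part x : cnorm (im_part x) <= cnorm x.
Proof.
by rewrite (le_trans (cnorm_re_part _))// scaleNr cnormN cnormZi.
Qed.

End PositiveCone.

Section StarHom.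
Variables (R : realType) (A B : cstarAlgType R) (f : A -> B).
Hypothesis f_hom : star_hom f.

Lemma star_hom_lin (a : R[i]) x y : f (a *: x + y) = a *: f x + f y.
Proof. by case: f_hom => + _ _; apply. Qed.

Lemma star_homD x y : f (x + y) = f x + f y.
Proof. by rewrite -{1}(scale1r x) star_hom_lin scale1r. Qed.

Lemma star_hom0 : f 0 = 0.
Proof. by apply: (@addrI _ (f 0)); rewrite -star_homD !addr0. Qed.

Lemma star_homZ (a : R[i]) x : f (a *: x) = a *: f x.
Proof. by rewrite -{1}(addr0 (a *: x)) star_hom_lin star_hom0 addr0. Qed.

Lemma star_homN x : f (- x) = - f x.
Proof. by rewrite -scaleN1r star_homZ scaleN1r. Qed.

Lemma star_homB x y : f (x - y) = f x - f y.
Proof. by rewrite star_homD star_homN. Qed.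

Lemma star_homM x y : f (x * y) = f x * f y.
Proof. by case: f_hom => _ [_ +] _; apply. Qed.

Lemma star_hom1 : f 1 = 1.
Proof. by case: f_hom => _ [+ _] _; apply. Qed.

Lemma star_homS x : f (star x) = star (f x).
Proof. by case: f_hom. Qed.

Lemma star_hom_sum I (r : seq I) (P : pred I) (F : I -> A) :
  f (\sum_(i <- r | P i) F i) = \sum_(i <- r | P i) f (F i).
Proof. exact: (big_morph _ star_homD star_hom0). Qed.

Lemma star_hom_pos x : is_pos x -> is_pos (f x).
Proof. by move=> [y ->]; exists (f y); rewrite star_homM star_homS. Qed.

Lemma star_hom_cnorm x : cnorm (f x) <= cnorm x.
Proof.
apply/(cnorm_leP _ (cnorm_ge0 x)); rewrite -star_homS -star_homM -star_hom1.
rewrite -star_homZ -star_homB; apply: star_hom_pos.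
exact/(cnorm_leP _ (cnorm_ge0 x)).
Qed.

End StarHom.

Section PositiveFunctional.
Variables (R : realType) (A : cstarAlgType R) (f : A -> R[i]).
Hypothesis f_lin : scalar f.
Hypothesis f_pos : forall a, is_pos a -> 0 <= f a.
Implicit Types (x y z h : A).

Lemma pfunD x y : f (x + y) = f x + f y.
Proof. by rewrite -{1}(scale1r x) f_lin mul1r. Qed.

Lemma pfun0 : f 0 = 0.
Proof. by apply: (@addrI _ (f 0)); rewrite -pfunD !addr0. Qed.

Lemma pfunZ (a : R[i]) x : f (a *: x) = a * f x.
Proof. by rewrite -{1}(addr0 (a *: x)) f_lin pfun0 addr0. Qed.

Lemma pfunN x : f (- x) = - f x.
Proof. by rewrite -scaleN1r pfunZ mulN1r. Qed.

Lemma pfunB x y : f (x - y) = f x - f y.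
Proof. by rewrite pfunD pfunN. Qed.

Lemma pfun_sum I (r : seq I) (P : pred I) (F : I -> A) :
  f (\sum_(i <- r | P i) F i) = \sum_(i <- r | P i) f (F i).
Proof. exact: (big_morph _ pfunD pfun0). Qed.

Lemma pfun_sa h : star h = h -> f h = (Re (f h))%:C.
Proof.
move=> sh; have := f_pos (pos_cnorm_sub sh).
have := f_pos (pos_scalar A (cnorm_ge0 h)).
rewrite pfunB => /ger0_Im i1 /ger0_Im i2.
have : Im (f h) = 0.
  by move: i2; rewrite raddfB /= i1 sub0r => /eqP; rewrite oppr_eq0 => /eqP.
by case: (f h) => a b /= ->.
Qed.

Lemma pfun_star x : f (star x) = (f x)^*%R.
Proof.
have [sa sb] := (re_part_sa x, re_part_sa ((- 'i%C) *: x)).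
rewrite (re_im_part x) /im_part; move: (re_part x) (re_part (- 'i%C *: x)) sa sb => a b sa sb.
rewrite starD starZ sa sb !pfunD !pfunZ conj_i (pfun_sa sa) (pfun_sa sb).
by rewrite rmorphD rmorphM /= conj_i !conj_real.
Qed.

(* The degenerate case of the Cauchy-Schwarz inequality. *)
Lemma pfun_null x y : f (star y * y) = 0 -> f (star x * y) = 0.
Proof.
move=> fy; pose c := f (star x * y); pose n := Re (f (star x * x)).
have fx : f (star x * x) = n%:C by apply: pfun_sa; rewrite starM starK.
pose m := Re (`|c| ^+ 2).
have cm : c^*%R * c = m%:C.
  rewrite mulrC -normCK /m RRe_real//; apply: ger0_real; exact: exprn_ge0.
have m0 : 0 <= m by rewrite -ler0c -cm mulrC mul_conjC_ge0.
clearbody m n.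
suff : m <= 0.
  move=> mle0; have {mle0}m0' : m = 0 by apply/eqP; rewrite eq_le mle0.
  apply/eqP; have := cm; rewrite m0' => /eqP.
  by rewrite mulf_eq0 conjC_eq0 orbb.
(* Positivity at [y - e c x] gives [2 m <= e m n] for every [e > 0], where [m = |c|^2]. *)
apply: (@ler_gt0_mul _ _ (m * n / 2)) => e e0.
have := f_pos (pos_star_mul (y - (e%:C * c) *: x)).
have -> : star (y - (e%:C * c) *: x) * (y - (e%:C * c) *: x) =
   star y * y - (e%:C * c) *: star (star x * y) - (e%:C * c^*%R) *: (star x * y)
   + (e%:C * c^*%R * (e%:C * c)) *: (star x * x).
  rewrite starM starK starB starZ rmorphM /= conj_real.
  move: (e%:C * c) (e%:C * c^*%R) => u v.
  by expand_products; linear_identity R[i].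
rewrite !(pfunD, pfunN, pfunZ) pfun_star fy fx -/c.
have -> : 0 - e%:C * c * c^*%R - e%:C * c^*%R * c +
    e%:C * c^*%R * (e%:C * c) * n%:C = (- 2 * e * m + e * e * m * n)%:C.
  by rewrite !(rmorphD, rmorphM, rmorphN) /= rmorph1 -cm; ring.
rewrite ler0c => h; have : e * (2 * m) <= e * (e * m * n) by lra.
rewrite ler_pM2l//; lra.
Qed.

End PositiveFunctional.

Lemma state_sub1 (R : realType) (A : cstarAlgType R) (f : A -> R[i]) :
  state f -> forall h, star h = h -> forall t : R, cnorm h <= t ->
  - t <= Re (f h) <= t.
Proof.
move=> [fl fp f1] h sh t ht.
have := fp _ (pos_le_sub sh ht); have := fp _ (pos_le_add sh ht).
rewrite pfunB// pfunD// pfunZ// f1 mulr1 (pfun_sa fl fp sh) -rmorphD -rmorphB /=.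
by rewrite !ler0c => ? ?; apply/andP; split; lra.
Qed.

(** * Extreme functionals below a sublinear functional *)

Section ExtremeHahnBanach.
Variables (R : realType) (W : lmodType R[i]).
Implicit Types (p q F : W -> R) (x y : W) (t s : R).

Definition sublinear q :=
  (forall x y, q (x + y) <= q x + q y) /\
  (forall t x, 0 < t -> q (t%:C *: x) = t * q x).

Definition real_linear F :=
  forall t x y, F (t%:C *: x + y) = t * F x + F y.

Definition below F q := forall x, F x <= q x.

Definition extreme_below F q := forall F1 F2 t,
  real_linear F1 -> real_linear F2 -> below F1 q -> below F2 q -> 0 < t < 1 ->
  (forall x, F x = t * F1 x + (1 - t) * F2 x) -> F1 =1 F /\ F2 =1 F.

Lemma real_linear0 F : real_linear F -> F 0 = 0.
Proof.
by move=> lF; have := lF (-1) 0 0; rewrite scaler0 addr0 mulN1r addNr.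
Qed.

Lemma real_linearN F : real_linear F -> forall x, F (- x) = - F x.
Proof.
move=> lF x; have := lF (-1) x 0.
by rewrite addr0 (real_linear0 lF) addr0 mulN1r rmorphN1 scaleN1r.
Qed.

Lemma real_linearD F : real_linear F -> forall x y, F (x + y) = F x + F y.
Proof. by move=> lF x y; rewrite -{1}(scale1r x) (lF 1) mul1r. Qed.

Lemma real_linearZ F : real_linear F -> forall t x, F (t%:C *: x) = t * F x.
Proof. by move=> lF t x; rewrite -[t%:C *: x]addr0 lF (real_linear0 lF) addr0. Qed.

Lemma sublinear0 q : sublinear q -> q 0 = 0.
Proof.
move=> [_ qZ]; have : q (2%:C *: 0) = 2 * q 0 by apply: qZ.
by rewrite scaler0; lra.
Qed.

Lemma sublinearN q : sublinear q -> forall x, - q (- x) <= q x.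
Proof.
move=> sq x; have [qD _] := sq.
by have := qD x (- x); rewrite subrr sublinear0//; lra.
Qed.

Section Tilt.
Variables (q : W -> R) (x0 : W).
Hypothesis q_sub : sublinear q.

Let tilt_set y := [set q (y + t%:C *: x0) - t * q x0 | t in [set t : R | 0 <= t]].

(** The linear functionals below [tilt] are those below [q] that attain [q] at [x0]: tilting cuts
    out the face on which evaluation at [x0] is maximal. *)
Definition tilt y := inf (tilt_set y).

Let tilt_set_lb y : lbound (tilt_set y) (- q (- y)).
Proof.
move=> _ [t /= t0 <-]; have [qD qZ] := q_sub.
have [->|tn0] := eqVneq t 0.
  by rewrite scale0r addr0 mul0r subr0 sublinearN.
have tp : 0 < t by rewrite lt_def tn0.
have := qD (y + t%:C *: x0) (- y); rewrite addrAC subrr add0r qZ//; lra.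
Qed.

Let tilt_set_ne y : tilt_set y !=set0.
Proof. by exists (q (y + 0%:C *: x0) - 0 * q x0); exists 0 => /=. Qed.

Lemma tilt_le t y : 0 <= t -> tilt y <= q (y + t%:C *: x0) - t * q x0.
Proof.
move=> t0; apply: ge_inf; last by exists t.
by exists (- q (- y)); exact: tilt_set_lb.
Qed.

Lemma tilt_ge y a : (forall t, 0 <= t -> a <= q (y + t%:C *: x0) - t * q x0) ->
  a <= tilt y.
Proof. by move=> H; apply: lb_le_inf => // _ [t /= t0 <-]; exact: H. Qed.

Lemma tilt_le_self : below tilt q.
Proof.
by move=> y; have := @tilt_le 0 y (lexx 0); rewrite scale0r addr0 mul0r subr0.
Qed.

Lemma tiltN : tilt (- x0) <= - q x0.
Proof.
have := @tilt_le 1 (- x0) ler01; rewrite scale1r addNr sublinear0//; lra.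
Qed.

Lemma tilt_sublinear : sublinear tilt.
Proof.
have [qD qZ] := q_sub.
have q0Z t x : 0 <= t -> q (t%:C *: x) = t * q x.
  rewrite le_eqVlt => /orP[/eqP <-|]; last exact: qZ.
  by rewrite scale0r mul0r sublinear0.
split=> [x y|t x t0].
  rewrite -lerBlDr; apply: tilt_ge => s s0.
  rewrite lerBlDl -lerBlDr; apply: tilt_ge => r r0.
  have := @tilt_le (s + r) (x + y) (addr_ge0 s0 r0).
  have := qD (x + s%:C *: x0) (y + r%:C *: x0).
  have -> : x + s%:C *: x0 + (y + r%:C *: x0) = x + y + (s + r)%:C *: x0.
    by rewrite rmorphD /=; linear_identity R[i].
  lra.
apply/eqP; rewrite eq_le; apply/andP; split.
  rewrite mulrC -ler_pdivrMr//; apply: tilt_ge => s s0.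
  rewrite ler_pdivrMr//.
  have := @tilt_le (t * s) (t%:C *: x) (mulr_ge0 (ltW t0) s0).
  by rewrite rmorphM /= -scalerA -scalerDr qZ//; lra.
apply: tilt_ge => s s0.
have := @tilt_le (t^-1 * s) x (mulr_ge0 (ltW (_ : 0 < t^-1)) s0).
rewrite invr_gt0 => /(_ t0); rewrite -(ler_pM2l t0); move/le_trans; apply.
rewrite mulrBr -(qZ t)// scalerDr scalerA -rmorphM /= mulrA divff ?gt_eqF// mul1r.
by rewrite mulrA mulrA divff ?gt_eqF// mul1r.
Qed.

Lemma below_tilt F : real_linear F -> below F q -> q x0 <= F x0 -> below F tilt.
Proof.
move=> lF Fq Fx y; apply: tilt_ge => t t0.
have := Fq (y + t%:C *: x0); rewrite real_linearD// real_linearZ//.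
have := ler_wpM2l t0 Fx; lra.
Qed.

End Tilt.

(** Faces are represented by the sublinear functional that bounds them, so that Zorn's lemma can run
    on functions ordered pointwise. *)
Definition face_of p q := forall F1 F2 t,
  real_linear F1 -> real_linear F2 -> below F1 p -> below F2 p -> 0 < t < 1 ->
  below (fun x => t * F1 x + (1 - t) * F2 x) q -> below F1 q /\ below F2 q.

Lemma tilt_face p q x0 : sublinear q -> face_of p q -> face_of p (tilt q x0).
Proof.
move=> sq fq F1 F2 t l1 l2 b1 b2 t01 bm.
have [q1 q2] : below F1 q /\ below F2 q.
  apply: (fq F1 F2 t) => // x; apply: le_trans (bm x) _.
  exact: tilt_le_self.
have := bm (- x0); rewrite (real_linearN l1) (real_linearN l2) => /le_trans/(_ (tiltN x0 sq)) h.
have [h1 h2] := (q1 x0, q2 x0).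
by split; apply: below_tilt => //; nra.
Qed.

(* Zorn's lemma on the sublinear functionals cutting out a face: a minimal one
   equals each of its tilts, hence is additive. *)
Lemma extreme_below_exists p x0 : sublinear p ->
  exists F, [/\ real_linear F, below F p, F x0 = p x0 & extreme_below F p].
Proof.
move=> sp.
(* The last clause secures [F x0 = p x0] at the end, because [tilt p x0 (- x0) <= - p x0]. *)
pose T := {q : W -> R | [/\ sublinear q, face_of p q & below q (tilt p x0)]}.
pose mk q qP : T := exist (fun q : W -> R =>
  [/\ sublinear q, face_of p q & below q (tilt p x0)]) q qP.
pose ge (q r : T) := `[< forall x, sval r x <= sval q x >].
have tiltP : [/\ sublinear (tilt p x0), face_of p (tilt p x0)
    & below (tilt p x0) (tilt p x0)].
  split=> //; first exact: tilt_sublinear.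
  by apply: tilt_face => // F1 F2 t.
have q_lb (q : T) x : - tilt p x0 (- x) <= sval q x.
  case: q => q [sq _ bq] /=; rewrite (le_trans _ (sublinearN sq x))//.
  by rewrite lerN2.
have ge_refl (q : T) : ge q q by apply/asboolP.
have ge_trans (q r s : T) : ge q r -> ge r s -> ge q s.
  move=> /asboolP qr /asboolP rs; apply/asboolP => x.
  exact: le_trans (rs x) (qr x).
have [|[q [sq fq bq]] qmin] := @ZL_preorder T (mk _ tiltP) ge ge_refl ge_trans.
  move=> A totA; have [->|/set0P[q0 Aq0]] := eqVneq A set0.
    by exists (mk _ tiltP) => s [].
  pose S x := [set sval q x | q in A].
  have Slb x : has_lbound (S x).
    by exists (- tilt p x0 (- x)) => _ [q _ <-]; exact: q_lb.
  have Sne x : S x !=set0 by exists (sval q0 x); exists q0.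
  pose m x := inf (S x).
  have m_le (q : T) x : A q -> m x <= sval q x by move=> Aq; apply: ge_inf => //; exists q.
  have m_ge x a : (forall q : T, A q -> a <= sval q x) -> a <= m x.
    by move=> H; apply: lb_le_inf => // _ [q Aq <-]; exact: H.
  have mP : [/\ sublinear m, face_of p m & below m (tilt p x0)].
    split.
    - split=> [x y|t x t0].
        rewrite -lerBlDr; apply: (m_ge) => q1 A1; rewrite lerBlDl -lerBlDr.
        apply: (m_ge) => q2 A2; rewrite lerBlDl.
        (* Infima are not subadditive in general; along a chain the smaller of [q1] and [q2] can
           serve at both points. *)
        wlog /asboolP le12 : x y q1 q2 A1 A2 / ge q1 q2 => [H|].
          have [/H|/H H'] := totA _ _ A1 A2; first exact.
          by rewrite addrC [X in _ <= X]addrC; exact: H'.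
        apply: le_trans (m_le q2 _ A2) _.
        case: (svalP q2) => -[qD _] _ _.
        by rewrite (le_trans (qD x y))// lerD2r.
      apply/eqP; rewrite eq_le; apply/andP; split.
        rewrite mulrC -ler_pdivrMr//; apply: (m_ge) => q Aq.
        rewrite ler_pdivrMr// mulrC; case: (svalP q) => -[_ qZ] _ _.
        by rewrite -qZ//; exact: (m_le).
      apply: (m_ge) => q Aq; case: (svalP q) => -[_ qZ] _ _.
      by rewrite qZ// ler_pM2l//; exact: (m_le).
    - move=> F1 F2 t l1 l2 b1 b2 t01 bm.
      by split=> x; apply: (m_ge) => q Aq; case: (svalP q) => _ fq _;
        have [] := fq F1 F2 t l1 l2 b1 b2 t01
          (fun y => le_trans (bm y) (m_le q y Aq)).
    - by move=> x; apply: le_trans (m_le q0 x Aq0) _; case: (svalP q0).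
  exists (mk _ mP) => q Aq; apply/asboolP => x; exact: (m_le).
have q_tilt x y : q y <= tilt q x y.
  have tP : [/\ sublinear (tilt q x), face_of p (tilt q x)
      & below (tilt q x) (tilt p x0)].
    split; [exact: tilt_sublinear|exact: tilt_face|].
    by move=> z; apply: le_trans (bq z); exact: tilt_le_self.
  have /qmin /asboolP : ge (mk _ (And3 sq fq bq)) (mk _ tP).
    by apply/asboolP => z /=; exact: tilt_le_self.
  exact.
have qN x : q (- x) = - q x.
  apply/eqP; rewrite eq_le (le_trans (q_tilt x _) (tiltN _ sq))/=.
  by have := sublinearN sq (- x); rewrite opprK.
have [qD qZ] := sq.
have q0 := sublinear0 sq.
have qZr t x : q (t%:C *: x) = t * q x.
  have [t0|t0|->] := ltgtP t 0; last by rewrite scale0r mul0r.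
    by rewrite -[t in LHS]opprK rmorphN scaleNr qN qZ ?oppr_gt0// mulNr opprK.
  exact: qZ.
have qlin : real_linear q.
  move=> t x y; rewrite -qZr; apply/eqP; rewrite eq_le qD/=.
  have := qD (- (t%:C *: x)) (t%:C *: x + y); rewrite addrA addNr add0r qN; lra.
have bqp : below q p by move=> x; apply: le_trans (bq x) _; exact: tilt_le_self.
exists q; split=> //.
  apply/eqP; rewrite eq_le bqp/= -[q x0]opprK -qN lerNr.
  by apply: le_trans (bq _) (tiltN _ sp).
move=> F1 F2 t l1 l2 b1 b2 t01 qE.
have [q1 q2] := fq F1 F2 t l1 l2 b1 b2 t01 (fun x => (fun e : q x = _ => eq_ind _ (fun a => a <= q x) (lexx (q x)) _ e) (qE x)).
have eqF F : real_linear F -> below F q -> F =1 q.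
  move=> lF bF x; apply/eqP; rewrite eq_le bF/=.
  by have := bF (- x); rewrite qN real_linearN// lerN2.
by split; exact: eqF.
Qed.

End ExtremeHahnBanach.

(** * Extreme positive extensions of positive functionals *)

Section KreinExtension.
Variables (R : realType) (W : lmodType R[i]) (st : W -> W).
Variables (K V : W -> Prop) (s : W -> R[i]) (e : W).
Hypothesis st_lin : forall (a : R[i]) x y, st (a *: x + y) = a^*%R *: st x + st y.
Hypothesis stK : involutive st.
Hypothesis K0 : K 0.
Hypothesis KD : forall x y, K x -> K y -> K (x + y).
Hypothesis KZ : forall (t : R) x, 0 < t -> K x -> K (t%:C *: x).
Hypothesis V_lin : forall (a : R[i]) x y, V x -> V y -> V (a *: x + y).
Hypothesis V_st : forall x, V x -> V (st x).
Hypothesis s_lin : forall (a : R[i]) x y, V x -> V y ->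
  s (a *: x + y) = a * s x + s y.
Hypothesis s_pos : forall x, V x -> st x = x -> K x -> 0 <= s x.
Hypothesis Ve : V e.
Hypothesis ste : st e = e.
Hypothesis Ke : K e.
Hypothesis e_unit : forall x, st x = x -> exists t : R, K (t%:C *: e - x).
Implicit Types (x y v : W) (t : R).

Definition positive_extension (F : W -> R[i]) :=
  [/\ scalar F, forall x, V x -> F x = s x & forall x, st x = x -> K x -> 0 <= F x].

Let i2 : 'i%C * 'i%C = -1 :> R[i]. Proof. by rewrite -expr2 sqr_i. Qed.

Let stD x y : st (x + y) = st x + st y.
Proof. by rewrite -{1}(scale1r x) st_lin rmorph1 scale1r. Qed.
Let st0 : st 0 = 0.
Proof. by apply: (@addrI _ (st 0)); rewrite -stD !addr0. Qed.
Let stZ (a : R[i]) x : st (a *: x) = a^*%R *: st x.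
Proof. by rewrite -{1}(addr0 (a *: x)) st_lin st0 addr0. Qed.
Let stN x : st (- x) = - st x.
Proof. by rewrite -scaleN1r stZ rmorphN1 scaleN1r. Qed.
Let stB x y : st (x - y) = st x - st y. Proof. by rewrite stD stN. Qed.

Let V0 : V 0.
Proof. by rewrite -(addNr e) -scaleN1r; apply: V_lin. Qed.
Let VZ (a : R[i]) x : V x -> V (a *: x).
Proof. by move=> Vx; rewrite -(addr0 (a *: x)); apply: V_lin. Qed.
Let VD x y : V x -> V y -> V (x + y).
Proof. by move=> Vx Vy; rewrite -(scale1r x); apply: V_lin. Qed.

Let s0 : s 0 = 0.
Proof.
apply: (@addrI _ (s 0)); rewrite addr0.
by have := s_lin 1 V0 V0; rewrite scale1r mul1r addr0.
Qed.
Let sZ (a : R[i]) x : V x -> s (a *: x) = a * s x.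
Proof. by move=> Vx; rewrite -{1}(addr0 (a *: x)) s_lin// s0 addr0. Qed.
Let sD x y : V x -> V y -> s (x + y) = s x + s y.
Proof. by move=> Vx Vy; rewrite -{1}(scale1r x) s_lin// mul1r. Qed.

Let re x := 2^-1%:C *: (x + st x).
Let re_st x : st (re x) = re x.
Proof. by rewrite /re stZ conj_real stD stK addrC. Qed.
Let re_id x : st x = x -> re x = x.
Proof. by move=> sx; rewrite /re sx; linear_identity R[i]. Qed.
Let reD x y : re (x + y) = re x + re y.
Proof. by rewrite /re stD; linear_identity R[i]. Qed.
Let reZ t x : re (t%:C *: x) = t%:C *: re x.
Proof. by rewrite /re stZ conj_real; linear_identity R[i]. Qed.
Let reN x : re (- x) = - re x.
Proof. by rewrite /re stN; linear_identity R[i]. Qed.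
Let re_im x : x = re x + 'i%C *: re ((- 'i%C) *: x).
Proof.
rewrite /re stZ rmorphN /= conj_i.
by linear_identity R[i]; by field: i2.
Qed.

Let s_re x : V x -> st x = x -> s x = (Re (s x))%:C.
Proof.
move=> Vx sx; have [t tx] := e_unit sx.
have st_te : st (t%:C *: e) = t%:C *: e by rewrite stZ conj_real ste.
have VN : V (- x) by rewrite -scaleN1r; exact: VZ.
have := s_pos (VD (VZ t%:C Ve) VN) (_ : st _ = _) tx.
rewrite stB st_te sx => /(_ erefl) /ger0_Im.
have /ger0_Im := s_pos Ve ste Ke.
rewrite -scaleN1r !sD ?sZ ?mulN1r//; do ?exact: VZ.
case: (s e) (s x) => [a a'] [b b'] /= ->; rewrite mulr0 mul0r !add0r.
by move=> /eqP; rewrite oppr_eq0 => /eqP ->.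
Qed.

Let Vre x : V x -> V (re x).
Proof. by move=> Vx; apply: VZ; apply: VD => //; exact: V_st. Qed.

Let P x := [set complex.Re (s v) | v in [set v | [/\ V v, st v = v & K (v - re x)]]].

Let P_lb x : has_lbound (P x).
Proof.
have [t tx] : exists t, K (t%:C *: e - re (- x)) by apply: e_unit.
exists (- (t * Re (s e))) => _ [v [Vv sv vx] <-].
have /s_pos : V (t%:C *: e + v) by exact: V_lin.
rewrite stD stZ conj_real ste sv => /(_ erefl).
have -> : t%:C *: e + v = (t%:C *: e - re (- x)) + (v - re x).
  by rewrite reN; linear_identity R[i].
move=> /(_ (KD tx vx)).
have -> : (t%:C *: e - re (- x)) + (v - re x) = t%:C *: e + v.
  by rewrite reN; linear_identity R[i].
rewrite s_lin// lecE => /andP[_].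
by case: (s e) (s v) => [a a'] [b b'] /=; rewrite mul0r subr0; lra.
Qed.

Let P_ne x : P x !=set0.
Proof.
have [t tx] := e_unit (re_st x).
exists (Re (s (t%:C *: e))); exists (t%:C *: e) => //; split=> //.
  exact: VZ.
by rewrite stZ conj_real ste.
Qed.

(** The majorant of M. Riesz: the least value of [s] on elements of [V] above the real part of [x].
    The real-linear functionals below [p] are exactly the real parts of positive extensions of [s],
    by [complexify_ext] and [ext_below]. *)
Let p x := inf (P x).

Let p_le x v : V v -> st v = v -> K (v - re x) -> p x <= Re (s v).
Proof. by move=> Vv sv vx; apply: ge_inf => //; exists v. Qed.

Let p_ge x a :
  (forall v, V v -> st v = v -> K (v - re x) -> a <= Re (s v)) -> a <= p x.
Proof. by move=> H; apply: lb_le_inf => // _ [v [Vv sv vx] <-]; exact: H. Qed.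

Let ReM t (z : R[i]) : Re (t%:C * z) = t * Re z.
Proof. by case: z => a b /=; rewrite mul0r subr0. Qed.

Let p_sublinear : sublinear p.
Proof.
split=> [x y|t x t0].
  rewrite -lerBlDr; apply: p_ge => v Vv sv vx.
  rewrite lerBlDl -lerBlDr; apply: p_ge => w Vw sw wy.
  rewrite lerBlDl -raddfD /= -sD//; apply: p_le; [exact: VD|by rewrite stD sv sw|].
  have -> : v + w - re (x + y) = (v - re x) + (w - re y).
    by rewrite reD; linear_identity R[i].
  exact: KD.
apply/eqP; rewrite eq_le; apply/andP; split.
  rewrite mulrC -ler_pdivrMr//; apply: p_ge => v Vv sv vx.
  rewrite ler_pdivrMr// mulrC -ReM -sZ//; apply: p_le; first exact: VZ.
    by rewrite stZ conj_real sv.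
  by rewrite reZ -scalerBr; exact: KZ.
apply: p_ge => v Vv sv vx; rewrite -ler_pdivlMl// -ReM -sZ//.
apply: p_le; first exact: VZ.
  by rewrite stZ conj_real sv.
have -> : re x = t^-1%:C *: re (t%:C *: x).
  by rewrite reZ scalerA -rmorphM /= mulVf ?gt_eqF// scale1r.
by rewrite -scalerBr; apply: KZ; rewrite ?invr_gt0.
Qed.

Let complexify (F : W -> R) x := (F x)%:C + 'i%C * (F ((- 'i%C) *: x))%:C.

Let complexify_scalar F : real_linear F -> scalar (complexify F).
Proof.
move=> lF a x y; have FD := real_linearD lF; have FZ := real_linearZ lF.
have FN := real_linearN lF.
have fi z : complexify F ('i%C *: z) = 'i%C * complexify F z.
  rewrite /complexify scalerA mulNr i2 opprK scale1r !scaleNr !FN rmorphN /=.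
  by ring: i2.
have fD u v : complexify F (u + v) = complexify F u + complexify F v.
  by rewrite /complexify scalerDr !FD !rmorphD /=; ring.
have fZ t z : complexify F (t%:C *: z) = t%:C * complexify F z.
  by rewrite /complexify scalerA [- 'i%C * _]mulrC -scalerA !FZ !rmorphM /=; ring.
have := complexE a; move: (Re a) (Im a) => u v ->.
by rewrite scalerDl -scalerA -addrA fD fZ fD fi fZ; ring.
Qed.

Let below_zero F x : real_linear F -> below F p -> re x = 0 -> F x = 0.
Proof.
move=> lF bF rx0.
have h z : re z = 0 -> F z <= 0.
  move=> rz; apply: le_trans (bF z) _.
  have -> : 0 = complex.Re (s 0) by rewrite s0.
  by apply: p_le; rewrite ?rz ?subr0.
apply/eqP; rewrite eq_le h//=; have := h (- x).
by rewrite reN rx0 oppr0 real_linearN// oppr_le0; apply.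
Qed.

Let below_on F x : real_linear F -> below F p -> V x -> st x = x ->
  F x = Re (s x).
Proof.
move=> lF bF Vx sx.
have h z : V z -> st z = z -> F z <= complex.Re (s z).
  move=> Vz sz; apply: le_trans (bF z) _; apply: p_le => //.
  by rewrite re_id// subrr.
apply/eqP; rewrite eq_le h//=; have := h (- x).
rewrite stN sx real_linearN// -scaleN1r sZ// mulN1r raddfN /= lerN2; apply=> //.
exact: VZ.
Qed.

Let complexify_sa F x : real_linear F -> below F p -> st x = x ->
  complexify F x = (F x)%:C.
Proof.
move=> lF bF sx; rewrite /complexify (@below_zero F ((- 'i%C) *: x))//.
  by rewrite mulr0 addr0.
by rewrite /re stZ sx rmorphN /= conj_i -scalerDl opprK addNr scale0r scaler0.
Qed.

Let complexify_ext F : real_linear F -> below F p ->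
  positive_extension (complexify F).
Proof.
move=> lF bF; have cl := complexify_scalar lF.
split=> // [x Vx|x sx Kx].
  have Vi : V ((- 'i%C) *: x) by exact: VZ.
  rewrite {1}(re_im x) addrC cl (complexify_sa lF bF (re_st _)).
  rewrite (complexify_sa lF bF (re_st x)).
  rewrite !below_on//; try exact: Vre.
  rewrite -!s_re//; try exact: Vre.
  by rewrite -s_lin//; try exact: Vre; rewrite addrC -re_im.
rewrite complexify_sa// ler0c -oppr_le0 -real_linearN//.
apply: le_trans (bF _) _; have -> : 0 = complex.Re (s 0) by rewrite s0.
by apply: p_le => //; rewrite reN sub0r opprK re_id.
Qed.

Let ext_re F x : positive_extension F -> st x = x -> F x = (Re (F x))%:C.
Proof.
move=> [lF eF pF] sx; have [t tx] := e_unit sx.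
have := pF _ _ tx; rewrite stB stZ conj_real ste sx => /(_ erefl) /ger0_Im.
have := pF _ ste Ke => /ger0_Im.
have -> : t%:C *: e - x = t%:C *: e + ((-1) *: x + 0) by rewrite scaleN1r addr0.
have F0 : F 0 = 0.
  apply: (@addrI _ (F 0)); rewrite addr0.
  by have := lF 1 0 0; rewrite scale1r mul1r addr0.
rewrite lF lF F0 addr0 mulN1r.
case: (F e) (F x) => [a a'] [b b'] /= ->; rewrite mulr0 mul0r !add0r.
by move=> /eqP; rewrite oppr_eq0 => /eqP ->.
Qed.

Let ext_below F : positive_extension F ->
  real_linear (fun x => complex.Re (F x)) /\ below (fun x => complex.Re (F x)) p.
Proof.
move=> eF; have [lF sF pF] := eF.
have lre : real_linear (fun x => complex.Re (F x)).
  by move=> t x y; rewrite lF raddfD /= ReM.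
split=> // x; apply: p_ge => v Vv sv vx.
have -> : complex.Re (F x) = complex.Re (F (re x)).
  rewrite {1}(re_im x) addrC lF raddfD /=.
  rewrite (ext_re eF (re_st ((- 'i%C) *: x))).
  by rewrite /= !mul0r !mul1r subrr add0r.
have := pF _ _ vx; rewrite stB sv re_st => /(_ erefl).
rewrite lecE => /andP[_] /=; rewrite -sF//.
have := real_linearD lre v (- re x); rewrite (real_linearN lre) => ->; lra.
Qed.

(** An extreme functional below the majorant that attains it at [y]. The middle clause records this
    maximality: [F y] is approached by values of [s] on elements of [V] above [y]. *)
Lemma krein_extension y : st y = y -> exists F, [/\ positive_extension F,
  (forall eps : R, 0 < eps ->
     exists v, [/\ V v, st v = v, K (v - y) & Re (s v) < Re (F y) + eps]) &
  (forall F1 F2 t, positive_extension F1 -> positive_extension F2 -> 0 < t < 1 ->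
     (forall x, F x = t%:C * F1 x + (1 - t)%:C * F2 x) -> F1 =1 F)].
Proof.
move=> sy; have [F [lF bF Fy xF]] := extreme_below_exists y p_sublinear.
have fP := complexify_ext lF bF.
exists (complexify F); split=> // [eps eps0|F1 F2 t e1 e2 t01 FE x].
  have [_ [v [Vv sv vy] <-] v_lt] := inf_adherent eps0 (conj (P_ne y) (P_lb y)).
  by exists v; rewrite complexify_sa// Fy; split=> //; rewrite -(re_id sy).
have [[l1 b1] [l2 b2]] := (ext_below e1, ext_below e2).
have FRe z : F z = complex.Re (complexify F z).
  by rewrite /complexify /= !mul0r mul1r subr0 addr0.
have [F1E _] := xF _ _ t l1 l2 b1 b2 t01 (fun z =>
  etrans (FRe z) (etrans (congr1 (@complex.Re R) (FE z))
    (etrans (raddfD (@complex.Re R : Rcomplex R -> R) _ _)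
      (congr2 +%R (ReM t _) (ReM (1 - t) _))))).
have [f1 _ _] := e1.
have f0 : F1 0 = 0.
  apply: (@addrI _ (F1 0)); rewrite addr0.
  by have := f1 1 0 0; rewrite scale1r mul1r addr0.
rewrite /complexify -!F1E.
have := f1 (- 'i%C) x 0; rewrite addr0 f0 addr0 => ->.
by case: (F1 x) => a b /=; congr Complex; rewrite /=; ring.
Qed.

End KreinExtension.

(** * States carried by a projection *)

Section CornerStates.
Variables (R : realType) (D : cstarAlgType R).
Implicit Types (p x y : D).

Lemma proj_pos p : star p = p -> p * p = p -> is_pos p.
Proof. by move=> sp pp; rewrite -pp; exact: pos_sqr. Qed.

Lemma proj_compl p : star p = p -> p * p = p ->
  star (1 - p) = 1 - p /\ (1 - p) * (1 - p) = 1 - p.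
Proof.
move=> sp pp; split; first by rewrite starB star1 sp.
by expand_products; rewrite pp; linear_identity R[i].
Qed.

Lemma proj_le1 p : star p = p -> p * p = p -> cnorm p <= 1.
Proof.
move=> sp pp; have [s1 p1] := proj_compl sp pp.
by apply: cnorm_pos_le => //; [exact: proj_pos|rewrite scale1r; exact: proj_pos].
Qed.

(** The complement [1 - p] is null for [f], so every term with a factor [1 - p] vanishes by
    Cauchy-Schwarz. *)
Lemma state_corner (f : D -> R[i]) p : state f -> star p = p -> p * p = p ->
  f p = 1 -> forall x, f x = f (p * x * p).
Proof.
move=> [fl fp f1] sp pp fp1 x; have [s1 p1] := proj_compl sp pp.
have f0 : f (star (1 - p) * (1 - p)) = 0 by rewrite s1 p1 pfunB// f1 fp1 subrr.
have fr z : f (z * (1 - p)) = 0.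
  by rewrite -(starK z); apply: pfun_null.
have fl' z : f ((1 - p) * z) = 0.
  by rewrite -(starK ((1 - p) * z)) pfun_star// starM s1 fr conjC0.
have {1}-> : x = p * x * p + p * x * (1 - p) + (1 - p) * x.
  by expand_products; linear_identity R[i].
by rewrite !pfunD// fr fl' !addr0.
Qed.

(** The value 1 at [p] is the largest possible, so the states that take it form a face, and
    extremality inside that face suffices. *)
Lemma corner_pure (phi : D -> R[i]) p : state phi -> star p = p -> p * p = p ->
    phi p = 1 ->
    (forall f, state f -> f p = 1 -> forall t : R, 0 < t < 1 -> forall g, state g ->
      g p = 1 -> (forall a, phi a = t%:C * f a + (1 - t)%:C * g a) -> f =1 phi) ->
  pure_state phi.
Proof.
move=> sphi sp pp phi1 ext; split=> // f g t sf sg t01 fgE.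
have [s1 p1] := proj_compl sp pp; have /andP[t0 t1] := t01.
have [[fl fp f1] [gl gp g1]] := (sf, sg).
have q0 : is_pos (1 - p) by exact: proj_pos.
have [] : f p = 1 /\ g p = 1.
  have := fp _ q0; have := gp _ q0; rewrite !pfunB// f1 g1.
  have -> : f p = (Re (f p))%:C.
    by apply: pfun_sa.
  have -> : g p = (Re (g p))%:C.
    by apply: pfun_sa.
  have : Re (phi p) = t * Re (f p) + (1 - t) * Re (g p).
    rewrite fgE raddfD /=; case: (f p) (g p) => [a a'] [b b'] /=.
    by rewrite !mul0r !subr0.
  rewrite phi1 -[1 : R[i]]/(1%:C) -!rmorphB !ler0c /=.
  move: (Re (f p)) (Re (g p)) => a b h1 h2 h3.
  have {h1 h2 h3} : a = 1 /\ b = 1 by split; nra.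
  by move=> [-> ->].
move=> fp1 gp1; split; apply/funext => x.
  exact: (ext f sf fp1 t t01 g sg gp1).
apply: (ext g sg gp1 (1 - t) _ f sf fp1) => [|a].
  by apply/andP; split; lra.
by rewrite fgE !rmorphB /= rmorph1; ring.
Qed.

Lemma scaler_injl x : x != 0 -> injective (fun z : R[i] => z *: x).
Proof.
move=> x0 z w /eqP; rewrite -subr_eq0 -scalerBl scaler_eq0 (negPf x0) orbF.
by rewrite subr_eq0 => /eqP.
Qed.

Lemma scaler1_inj : injective (fun z : R[i] => z *: (1 : D)).
Proof. exact/scaler_injl/oner_neq0. Qed.

(** Extension from the scalars, for the cone of elements whose corner is positive. The maximality at
    [y] becomes the order bound on [p y p]. *)
Lemma corner_state p y : star p = p -> p * p = p -> p != 0 -> star y = y ->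
  exists psi, [/\ pure_state psi, psi p = 1 & forall eps : R, 0 < eps ->
    is_pos ((Re (psi y) + eps)%:C *: p - p * y * p)].
Proof.
move=> sp pp p0 sy.
pose K x := is_pos (p * x * p).
pose V (x : D) := exists z : R[i], x = z *: 1.
(* Reads [z] off [z *: 1]; outside the scalars, where its value is never consulted, it is 0. *)
pose s (x : D) : R[i] := xget 0 [set z | x = z *: 1].
have sE z : s (z *: 1) = z.
  by rewrite /s; apply: xget_unique => // w /scaler1_inj.
have pzp (z : R[i]) : p * (z *: 1) * p = z *: p.
  by rewrite -scalerAr -scalerAl mulr1 pp.
have pP := proj_pos sp pp.
have [|||||||||||||psi [[psil psie psip] psiy psix]] := @krein_extension _ _
    (@star R D) K V s 1 _ _ _ _ _ _ _ _ _ _ _ _ _ y sy.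
- by move=> a u v; rewrite starD starZ.
- exact: starK.
- by rewrite /K mulr0 mul0r; exact: pos0.
- by move=> u v Ku Kv; rewrite /K mulrDr mulrDl; exact: posD.
- by move=> t u t0 Ku; rewrite /K -scalerAr -scalerAl; apply: posZ => //; exact: ltW.
- by move=> a _ _ [z ->] [w ->]; exists (a * z + w); rewrite scalerDl scalerA.
- by move=> _ [z ->]; exists z^*%R; rewrite starZ star1.
- by move=> a _ _ [z ->] [w ->]; rewrite scalerA -scalerDl !sE.
- move=> _ [z ->]; rewrite starZ star1 => /scaler1_inj zr; rewrite /K sE pzp.
  have [r ->] : exists r, z = r%:C.
    by apply/complex_realP; rewrite CrealE zr.
  rewrite ler0c => rp; rewrite leNgt; apply/negP => r0.
  case/negP: p0; apply/eqP/pos_anti => //.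
  have -> : - p = (- r)^-1%:C *: (r%:C *: p).
    rewrite scalerA -rmorphM /= invrN mulNr mulVf ?lt_eqF// rmorphN1 scaleN1r //.
  by apply: posZ => //; rewrite invr_ge0 oppr_ge0 ltW.
- by exists 1; rewrite scale1r.
- exact: star1.
- by rewrite /K mulr1 pp.
- move=> x sx; exists (cnorm x); rewrite /K -{1}sp; apply: pos_conj.
  exact: pos_cnorm_sub.
have K0 x : p * x * p = 0 -> K x by move=> e; rewrite /K e; exact: pos0.
have psi1 : psi 1 = 1.
  by rewrite psie; [rewrite -[1 in LHS]scale1r sE|exists 1; rewrite scale1r].
have psiN x : psi (- x) = - psi x.
  by have := psil (-1) x 0; rewrite addr0 scaleN1r (pfun0 psil) addr0 mulN1r.
have psip1 : psi p = 1.
  apply/eqP; rewrite -psi1 eq_le -![psi _ <= psi _]subr_ge0 -!psiN.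
  rewrite -!(pfunD psil) !psip//; rewrite ?starB ?star1 ?sp//;
    apply: K0; rewrite mulrBr mulrBl !mulr1 !pp subrr //.
have spsi : state psi.
  split=> // a aP; apply: psip; first exact: pos_sa.
  by rewrite /K -{1}sp; exact: pos_conj.
have ext_state f : state f -> f p = 1 -> positive_extension (@star R D) K V s f.
  move=> sf fp1; have [fl fp f1] := sf; split=> //.
    by move=> _ [z ->]; rewrite pfunZ// f1 mulr1 sE.
  by move=> x sx Kx; rewrite (state_corner sf sp pp fp1); exact: fp.
exists psi; split=> //.
  apply: (corner_pure spsi sp pp psip1) => f sf fp1 t t01 g sg gp1 fg.
  exact: (psix _ _ t (ext_state _ sf fp1) (ext_state _ sg gp1) t01 fg).
move=> eps /psiy[_ [[z ->]]]; rewrite starZ star1 => /scaler1_inj zr.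
have [r ->] : exists r, z = r%:C.
  by apply/complex_realP; rewrite CrealE zr.
rewrite sE /K mulrBr mulrBl pzp /= => rP rlt.
have -> : (Re (psi y) + eps)%:C *: p - p * y * p =
    (Re (psi y) + eps - r)%:C *: p + (r%:C *: p - p * y * p).
  by rewrite rmorphB /=; linear_identity R[i].
by apply: posD => //; apply: posZ => //; rewrite subr_ge0 ltW.
Qed.

End CornerStates.

(** * Matrix algebras over a C*-algebra *)

Section MatrixForm.
Variables (R : realType) (D : cstarAlgType R).

Definition adjmx m n (X : 'M[D]_(m, n)) : 'M[D]_(n, m) := (map_mx star X)^T.

Lemma adjmxE m n (X : 'M[D]_(m, n)) i j : adjmx X i j = star (X j i).
Proof. by rewrite !mxE. Qed.

Lemma adjmxK m n : cancel (@adjmx m n) (@adjmx n m).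
Proof. by move=> X; apply/matrixP => i j; rewrite !adjmxE starK. Qed.

Lemma adjmxD m n (X Y : 'M[D]_(m, n)) : adjmx (X + Y) = adjmx X + adjmx Y.
Proof. by apply/matrixP => i j; rewrite !mxE starD. Qed.

Lemma adjmxM m n p (X : 'M[D]_(m, n)) (Y : 'M[D]_(n, p)) :
  adjmx (X *m Y) = adjmx Y *m adjmx X.
Proof.
apply/matrixP => i j; rewrite !mxE star_sum; apply: eq_bigr => k _.
by rewrite starM !mxE.
Qed.

Variable n : nat.
Implicit Types (X Y : 'M[D]_n) (v w : 'cV[D]_n).

Definition mx_form X v : D := (adjmx v *m X *m v) 0 0.

(* Positivity of X as an operator on the Hilbert module D^n. *)
Definition form_pos X := forall v, is_pos (mx_form X v).

Lemma mx_formE X v : mx_form X v = \sum_i \sum_j star (v i 0) * X i j * v j 0.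
Proof.
rewrite /mx_form -mulmxA mxE; apply: eq_bigr => i _.
rewrite adjmxE mxE mulr_sumr; apply: eq_bigr => j _; exact: mulrA.
Qed.

Lemma mx_form_sum v : mx_form 1%:M v = \sum_i star (v i 0) * v i 0.
Proof.
by rewrite /mx_form mulmx1 mxE; apply: eq_bigr => i _; rewrite adjmxE.
Qed.

Lemma mx_formD X Y v : mx_form (X + Y) v = mx_form X v + mx_form Y v.
Proof. by rewrite /mx_form mulmxDr mulmxDl mxE. Qed.

Lemma mx_formN X v : mx_form (- X) v = - mx_form X v.
Proof. by rewrite /mx_form mulmxN mulNmx mxE. Qed.

Lemma mx_form_gram m (Y : 'M[D]_(m, n)) v : mx_form (adjmx Y *m Y) v =
  \sum_i star ((Y *m v) i 0) * (Y *m v) i 0.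
Proof.
rewrite /mx_form mulmxA -mulmxA -adjmxM mxE.
by apply: eq_bigr => i _; rewrite adjmxE.
Qed.

Lemma mx_form_conj X Y v : mx_form (adjmx Y *m X *m Y) v = mx_form X (Y *m v).
Proof. by rewrite /mx_form adjmxM !mulmxA. Qed.

Lemma form_posD X Y : form_pos X -> form_pos Y -> form_pos (X + Y).
Proof. by move=> XP YP v; rewrite mx_formD; exact: posD. Qed.

Lemma form_pos_conj X Y : form_pos X -> form_pos (adjmx Y *m X *m Y).
Proof. by move=> XP v; rewrite mx_form_conj. Qed.

Lemma form_pos_gram m (Y : 'M[D]_(m, n)) : form_pos (adjmx Y *m Y).
Proof. by move=> v; rewrite mx_form_gram; apply: pos_sum => i _; exists ((Y *m v) i 0). Qed.

Lemma mx_form_delta X i : mx_form X (delta_mx i 0) = X i i.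
Proof.
rewrite mx_formE (bigD1 i)//= (bigD1 i)//= !mxE !eqxx star1 mul1r mulr1.
rewrite big1 ?addr0 => [|j ji]; last by rewrite !mxE (negPf ji) mulr0.
rewrite big1 ?addr0// => k ki; rewrite big1// => j _.
by rewrite !mxE (negPf ki) star0 !mul0r.
Qed.

(** Polarization: [a = 1] and [a = i] together recover the off-diagonal entries from the form. *)
Lemma mx_form_delta2 X i j (a : R[i]) : i != j ->
  mx_form X (delta_mx i 0 + map_mx ( *:%R a) (delta_mx j 0)) =
  X i i + a *: X i j + a^*%R *: X j i + (a^*%R * a) *: X j j.
Proof.
move=> ij; have ji : j != i by rewrite eq_sym.
have e k : (delta_mx i 0 + map_mx ( *:%R a) (delta_mx j 0) : 'cV[D]_n) k 0 =
    (k == i)%:R + a *: (k == j)%:R by rewrite !mxE !andbT.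
have inner k : \sum_l star ((k == i)%:R + a *: (k == j)%:R) * X k l *
    ((l == i)%:R + a *: (l == j)%:R) =
    star ((k == i)%:R + a *: (k == j)%:R) * (X k i + a *: X k j).
  rewrite (bigD1 i)//= (bigD1 j)//= eqxx (negPf ij) (negPf ji) eqxx big1.
    rewrite /= !(mulr0n, mulr1n) scaler0 !addr0 add0r mulr1 -scalerAr mulr1.
    by rewrite [RHS]mulrDr -scalerAr.
  by move=> l /andP[/negPf -> /negPf ->]; rewrite /= !mulr0n scaler0 addr0 mulr0.
rewrite mx_formE; under eq_bigr do under eq_bigr do rewrite !e.
under eq_bigr do rewrite inner.
rewrite (bigD1 i)//= (bigD1 j)//= eqxx (negPf ij) (negPf ji) eqxx big1.
  rewrite /= !(mulr0n, mulr1n) !scaler0 !addr0 !add0r star1 starZ star1.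
  by expand_products; linear_identity R[i].
by move=> l /andP[/negPf -> /negPf ->]; rewrite /= !mulr0n scaler0 addr0 star0 mul0r.
Qed.

Lemma form_pos_adj X : form_pos X -> adjmx X = X.
Proof.
move=> XP; apply/matrixP => i j; rewrite adjmxE.
have diag k : star (X k k) = X k k by rewrite -mx_form_delta pos_sa.
have [->|ij] := eqVneq i j; first exact: diag.
have := pos_sa (XP (delta_mx i 0 + map_mx ( *:%R 1) (delta_mx j 0))).
have := pos_sa (XP (delta_mx i 0 + map_mx ( *:%R 'i%C) (delta_mx j 0))).
have i2 : 'i%C * 'i%C = -1 :> R[i] by rewrite -expr2 sqr_i.
rewrite !mx_form_delta2// !starD !starZ !rmorphM /= !conj_i !rmorphN /= conj_i.
rewrite !rmorph1 !diag => e1 e2.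
have : star (X j i) - X i j = 2^-1%:C *:
  ((X i i + 1 *: star (X i j) + 1 *: star (X j i) + (1 * 1) *: X j j) -
   (X i i + 1 *: X i j + 1 *: X j i + (1 * 1) *: X j j)) +
  (2^-1%:C * - 'i%C) *:
  ((X i i + - 'i%C *: star (X i j) + - - 'i%C *: star (X j i) + (- - 'i%C * - 'i%C) *: X j j) -
   (X i i + 'i%C *: X i j + - 'i%C *: X j i + (- 'i%C * 'i%C) *: X j j)).
  by linear_identity R[i]; by field: i2.
rewrite e1 e2 !subrr !scaler0 addr0 => /eqP; rewrite subr_eq0 => /eqP ->.
by [].
Qed.

Lemma form_pos_anti X : form_pos X -> form_pos (- X) -> X = 0.
Proof.
move=> XP NP; have X0 v : mx_form X v = 0.
  by apply: pos_anti; rewrite -?mx_formN.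
have i2 : 'i%C * 'i%C = -1 :> R[i] by rewrite -expr2 sqr_i.
have diag k : X k k = 0 by rewrite -mx_form_delta.
apply/matrixP => i j; rewrite !mxE.
have [->|ij] := eqVneq i j; first exact: diag.
have := X0 (delta_mx i 0 + map_mx ( *:%R 1) (delta_mx j 0)).
have := X0 (delta_mx i 0 + map_mx ( *:%R 'i%C) (delta_mx j 0)).
rewrite !mx_form_delta2// conj_i rmorph1 !diag => e1 e2.
have -> : X i j = 2^-1%:C *: (0 + 1 *: X i j + 1 *: X j i + (1 * 1) *: 0) +
  (2^-1%:C * - 'i%C) *: (0 + 'i%C *: X i j + - 'i%C *: X j i + (- 'i%C * 'i%C) *: 0).
  by linear_identity R[i]; by field: i2.
by rewrite e1 e2 !scaler0 addr0.
Qed.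

End MatrixForm.

Section MatrixAlgebra.
Variables (R : realType) (D : cstarAlgType R) (n : nat).

(* 'M[D]_n.+1 as an algebra over the complex numbers, and not over D. *)
Definition mxalg := 'M[D]_n.+1.
HB.instance Definition _ := GRing.NzRing.copy mxalg 'M[D]_n.+1.

Implicit Types (X Y : mxalg).

Definition mxalg_scale (a : R[i]) X : mxalg := map_mx ( *:%R a) X.

Lemma mxalg_scaleA a b X :
  mxalg_scale a (mxalg_scale b X) = mxalg_scale (a * b) X.
Proof. by apply/matrixP => i j; rewrite !mxE scalerA. Qed.
Lemma mxalg_scale1 : left_id 1 mxalg_scale.
Proof. by move=> X; apply/matrixP => i j; rewrite !mxE scale1r. Qed.
Lemma mxalg_scaleDr : right_distributive mxalg_scale +%R.
Proof. by move=> a X Y; apply/matrixP => i j; rewrite !mxE scalerDr. Qed.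
Lemma mxalg_scaleDl X : {morph mxalg_scale^~ X : a b / a + b}.
Proof. by move=> a b; apply/matrixP => i j; rewrite !mxE scalerDl. Qed.
HB.instance Definition _ := GRing.Zmodule_isLmodule.Build R[i] mxalg
  mxalg_scaleA mxalg_scale1 mxalg_scaleDr mxalg_scaleDl.

Lemma mxalg_scaleAl (a : R[i]) (X Y : mxalg) : a *: (X * Y) = a *: X * Y.
Proof.
apply/matrixP => i j; rewrite !mxE scaler_sumr; apply: eq_bigr => k _.
by rewrite mxE scalerAl.
Qed.
HB.instance Definition _ := GRing.Lmodule_isLalgebra.Build R[i] mxalg
  mxalg_scaleAl.
Lemma mxalg_scaleAr (a : R[i]) (X Y : mxalg) : a *: (X * Y) = X * (a *: Y).
Proof.
apply/matrixP => i j; rewrite !mxE scaler_sumr; apply: eq_bigr => k _.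
by rewrite mxE scalerAr.
Qed.
HB.instance Definition _ := GRing.Lalgebra_isAlgebra.Build R[i] mxalg
  mxalg_scaleAr.

Let star_mx (X : mxalg) : mxalg := adjmx X.

Lemma mxalg_starK : involutive star_mx. Proof. exact: adjmxK. Qed.
Lemma mxalg_starD : {morph star_mx : X Y / X + Y}.
Proof. by move=> X Y; exact: adjmxD. Qed.
Lemma mxalg_starZ (a : R[i]) (X : mxalg) : star_mx (a *: X) = (a^*)%R *: star_mx X.
Proof. by apply/matrixP => i j; rewrite !mxE starZ. Qed.
Lemma mxalg_starM (X Y : mxalg) : star_mx (X * Y) = star_mx Y * star_mx X.
Proof. exact: adjmxM. Qed.

Let fposZ (t : R) X : 0 <= t -> form_pos X -> form_pos (t%:C *: X).
Proof.
move=> t0 XP v; have -> : mx_form (t%:C *: X : mxalg) v = t%:C *: mx_form X v.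
  rewrite !mx_formE scaler_sumr; apply: eq_bigr => i _.
  rewrite scaler_sumr; apply: eq_bigr => j _.
  by rewrite mxE -scalerAr -scalerAl.
exact: posZ.
Qed.

Let fposD X Y : form_pos X -> form_pos Y -> form_pos (X + Y).
Proof. exact: form_posD. Qed.
Let fpos_conj X Y : form_pos X -> form_pos (star_mx Y * X * Y).
Proof. exact: form_pos_conj. Qed.
Let fpos_gram Y : form_pos (star_mx Y * Y). Proof. exact: form_pos_gram. Qed.
Let star_mx1 : star_mx 1 = 1.
Proof.
apply/matrixP => i j; rewrite !mxE eq_sym.
by case: eqP => _ /=; rewrite ?mulr1n ?mulr0n ?star1 ?star0.
Qed.
Let fpos1 : form_pos (1 : mxalg).
Proof. by rewrite -(mulr1 1) -{1}star_mx1; exact: fpos_gram. Qed.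
Let star_mxN X : star_mx (- X) = - star_mx X.
Proof. by rewrite -scaleN1r mxalg_starZ rmorphN1 scaleN1r. Qed.
Let star_mxZr (t : R) X : star_mx (t%:C *: X) = t%:C *: star_mx X.
Proof. by rewrite mxalg_starZ conj_real. Qed.

(** [X^* X <= t^2] on the Hilbert module, so the infimum of such [t] is the operator norm. Taking
    [t] positive allows division by it. *)
Definition mx_bound X (t : R) :=
  0 < t /\ form_pos ((t ^+ 2)%:C *: (1 : mxalg) - star_mx X * X).

Definition mxnorm X : R := inf [set t | mx_bound X t].

Lemma mx_bound_entry X t i j : mx_bound X t -> cnorm (X i j) <= t.
Proof.
move=> [t0 XP]; apply/(cnorm_leP _ (ltW t0)).
have := XP (delta_mx j 0); rewrite mx_form_delta !mxE eqxx mulr1n.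
rewrite (bigD1 i)//= adjmxE => tX.
have -> : (t ^+ 2)%:C *: 1 - star (X i j) * X i j =
   ((t ^+ 2)%:C *: 1 - (star (X i j) * X i j +
      \sum_(k < n.+1 | k != i) adjmx X j k * X k j)) +
   \sum_(k < n.+1 | k != i) adjmx X j k * X k j.
  by linear_identity R[i].
apply: posD => //; apply: pos_sum => k _; rewrite adjmxE; exact: pos_star_mul.
Qed.

Lemma mx_bound_of_entry X (e : R) : 0 < e -> (forall i j, cnorm (X i j) <= e) ->
  mx_bound X (n.+1%:R * e).
Proof.
move=> e0 Xe; split; first by rewrite mulr_gt0// ltr0n.
move=> v; rewrite mx_formD mx_formN mx_form_gram.
have -> : mx_form (((n.+1%:R * e) ^+ 2)%:C *: 1 : mxalg) v =
    \sum_(i < n.+1) \sum_(j < n.+1) (n.+1%:R * e ^+ 2)%:C *: (star (v j 0) * v j 0).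
  rewrite sumr_const card_ord.
  have -> : mx_form (((n.+1%:R * e) ^+ 2)%:C *: 1 : mxalg) v =
      ((n.+1%:R * e) ^+ 2)%:C *: mx_form (1%:M : 'M[D]_n.+1) v.
    rewrite !mx_formE scaler_sumr; apply: eq_bigr => i _.
    rewrite scaler_sumr; apply: eq_bigr => j _.
    by rewrite mxE -scalerAr -scalerAl.
  rewrite mx_form_sum -scaler_sumr scalerMnl -raddfMn /=.
  by congr (_%:C *: _); ring.
rewrite -sumrB; apply: pos_sum => i _; rewrite mxE.
pose a j := X i j * v j 0.
have -> : \sum_(j < n.+1) (n.+1%:R * e ^+ 2)%:C *: (star (v j 0) * v j 0) -
    star (\sum_j X i j * v j 0) * (\sum_j X i j * v j 0) =
  \sum_j n.+1%:R%:C *: (star (v j 0) * ((e ^+ 2)%:C *: 1 - star (X i j) * X i j) * v j 0)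
  + 2^-1%:C *: \sum_j \sum_k star (a j - a k) * (a j - a k).
  (* Lagrange's identity behind Cauchy-Schwarz: it bounds the square of a sum of [n.+1] terms by
     [n.+1] times the sum of the squares. *)
  have -> : \sum_j \sum_k star (a j - a k) * (a j - a k) =
     2%:C *: (n.+1%:R%:C *: (\sum_j star (a j) * a j)
              - star (\sum_j a j) * (\sum_j a j)).
    transitivity (\sum_(j < n.+1) (n.+1%:R%:C *: (star (a j) * a j) -
        star (a j) * (\sum_k a k) - star (\sum_k a k) * a j +
        \sum_k star (a k) * a k)).
      apply: eq_bigr => j _; rewrite star_sum mulr_suml mulr_sumr.
      have -> : n.+1%:R%:C *: (star (a j) * a j) =
          \sum_(k < n.+1) star (a j) * a j.
        by rewrite sumr_const card_ord rmorph_nat scaler_nat.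
      rewrite -!sumrB -big_split /=; apply: eq_bigr => k _.
      by rewrite starB; expand_products; linear_identity R[i].
    rewrite big_split !sumrB -scaler_sumr -mulr_suml -mulr_sumr -star_sum /=.
    by rewrite sumr_const card_ord !rmorph_nat; linear_identity R[i].
  rewrite scalerA -rmorphM mulVf// scale1r scaler_sumr addrA -big_split /=.
  congr (_ - _); apply: eq_bigr => j _; rewrite /a starM.
  rewrite rmorphM /=; move: (n.+1%:R%:C) ((e ^+ 2)%:C) => u w.
  by expand_products; linear_identity R[i].
apply: posD.
  apply: pos_sum => j _; apply: posZ => //; apply: pos_conj.
  exact/(cnorm_leP _ (ltW e0)).
apply: posZ; rewrite ?invr_ge0//; apply: pos_sum => j _; apply: pos_sum => k _.
exact: pos_star_mul.
Qed.

Lemma mx_bound_ne X : [set t | mx_bound X t] !=set0.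
Proof.
exists (n.+1%:R * (1 + \sum_i \sum_j cnorm (X i j))); apply: mx_bound_of_entry.
  by rewrite ltr_wpDr// sumr_ge0// => i _; rewrite sumr_ge0// => j _; exact: cnorm_ge0.
move=> i j; rewrite (bigD1 i)//= (bigD1 j)//=.
have sum0 (F : 'I_n.+1 -> R) (P : pred 'I_n.+1) :
  (forall k, 0 <= F k) -> 0 <= \sum_(k | P k) F k by move=> F0; exact: sumr_ge0.
have := sum0 (fun k => cnorm (X i k)) (fun k => k != j) (fun=> cnorm_ge0 _).
have := sum0 (fun k => \sum_l cnorm (X k l)) (fun k => k != i)
  (fun k => sumr_ge0 _ (fun l _ => cnorm_ge0 _)).
lra.
Qed.

Lemma mx_bound_lb X : has_lbound [set t | mx_bound X t].
Proof. by exists 0 => t [/ltW]. Qed.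

Lemma mxnorm_le X t : mx_bound X t -> mxnorm X <= t.
Proof. by move=> Xt; apply: ge_inf => //; exact: mx_bound_lb. Qed.

Lemma mxnorm_ge X a : (forall t, mx_bound X t -> a <= t) -> a <= mxnorm X.
Proof. by move=> H; apply: lb_le_inf => //; exact: mx_bound_ne. Qed.

Lemma mx_bound0 t : 0 < t -> mx_bound 0 t.
Proof.
move=> t0; split=> //; rewrite mulr0 subr0; apply: fposZ => //; exact: sqr_ge0.
Qed.

Lemma mx_boundD X Y s t :
  mx_bound X s -> mx_bound Y t -> mx_bound (X + Y) (s + t).
Proof.
move=> [s0 XP] [t0 YP]; split; first exact: addr_gt0.
(* The weights are chosen so that the cross terms complete the square of [t X - s Y], while the
   scalars still sum to [(s + t)^2]. *)
have -> : ((s + t) ^+ 2)%:C *: 1 - star_mx (X + Y) * (X + Y) =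
  (1 + t / s)%:C *: ((s ^+ 2)%:C *: 1 - star_mx X * X) +
  (1 + s / t)%:C *: ((t ^+ 2)%:C *: 1 - star_mx Y * Y) +
  (t * s)^-1%:C *: (star_mx (t%:C *: X - s%:C *: Y) * (t%:C *: X - s%:C *: Y)).
  rewrite !mxalg_starD star_mxN !star_mxZr.
  have s1 : s%:C != 0 :> R[i] by rewrite fmorph_eq0 gt_eqF.
  have t1 : t%:C != 0 :> R[i] by rewrite fmorph_eq0 gt_eqF.
  rewrite !(rmorphXn, rmorphD, rmorphM, fmorphV, rmorph1) /=.
  move: (s%:C) (t%:C) s1 t1 => u w u0 w0.
  by expand_products; linear_identity R[i]; field; rewrite u0 w0.
have st0 : 0 <= (t * s)^-1 by rewrite invr_ge0 mulr_ge0// ltW.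
have sd : 0 <= 1 + t / s by rewrite addr_ge0// divr_ge0// ltW.
have td : 0 <= 1 + s / t by rewrite addr_ge0// divr_ge0// ltW.
by apply: fposD; [apply: fposD; exact: fposZ|exact: fposZ].
Qed.

Lemma mx_boundM X Y s t :
  mx_bound X s -> mx_bound Y t -> mx_bound (X * Y) (s * t).
Proof.
move=> [s0 XP] [t0 YP]; split; first exact: mulr_gt0.
have -> : ((s * t) ^+ 2)%:C *: 1 - star_mx (X * Y) * (X * Y) =
  (s ^+ 2)%:C *: ((t ^+ 2)%:C *: 1 - star_mx Y * Y) +
  star_mx Y * ((s ^+ 2)%:C *: 1 - star_mx X * X) * Y.
  rewrite mxalg_starM exprMn rmorphM /=.
  move: ((s ^+ 2)%:C) ((t ^+ 2)%:C) => u w.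
  by expand_products; linear_identity R[i].
by apply: fposD; [apply: fposZ => //; exact: sqr_ge0|exact: fpos_conj].
Qed.

(* For [a = X X^*]: [s^2 (s^2 - a) = (s^2 - a)^2 + X (s^2 - X^* X) X^*]. *)
Lemma mx_bound_star X s : mx_bound X s -> mx_bound (star_mx X) s.
Proof.
move=> [s0 XP]; split=> //; rewrite mxalg_starK; pose a := X * star_mx X.
have sa : star_mx a = a by rewrite mxalg_starM mxalg_starK.
have sN : (s ^+ 2)%:C != 0 :> R[i] by rewrite fmorph_eq0 expf_eq0/= gt_eqF.
have -> : (s ^+ 2)%:C *: 1 - X * star_mx X = (s ^+ 2)^-1%:C *:
  (star_mx ((s ^+ 2)%:C *: 1 - a) * ((s ^+ 2)%:C *: 1 - a) +
   star_mx (star_mx X) * ((s ^+ 2)%:C *: 1 - star_mx X * X) * star_mx X).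
  rewrite mxalg_starD star_mxN star_mxZr star_mx1 sa mxalg_starK /a fmorphV /=.
  move: ((s ^+ 2)%:C) sN => u u0.
  by expand_products; linear_identity R[i]; field.
apply: fposZ; first by rewrite invr_ge0 sqr_ge0.
by apply: fposD; [exact: fpos_gram|exact: fpos_conj].
Qed.

(* For [a = X^* X]: [2 c (c - a) = (c - a)^2 + (c^2 - a^2)]. *)
Lemma mx_bound_gram X c : mx_bound (star_mx X * X) c -> mx_bound X (Num.sqrt c).
Proof.
move=> [c0 aP]; split; first by rewrite sqrtr_gt0.
rewrite sqr_sqrtr ?ltW//; set a := star_mx X * X in aP *.
have sa : star_mx a = a by rewrite mxalg_starM mxalg_starK.
have cN : c%:C != 0 :> R[i] by rewrite fmorph_eq0 gt_eqF.
have -> : c%:C *: 1 - a = (2 * c)^-1%:C *: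
  (star_mx (c%:C *: 1 - a) * (c%:C *: 1 - a) + ((c ^+ 2)%:C *: 1 - star_mx a * a)).
  rewrite mxalg_starD star_mxN star_mxZr star_mx1 sa fmorphV rmorphXn rmorphM /=.
  rewrite rmorph_nat; move: (c%:C) cN => u u0.
  have u2 : u + u != 0 by rewrite -mulr2n mulrn_eq0.
  by expand_products; linear_identity R[i]; field; rewrite ?u2.
apply: fposZ; first by rewrite invr_ge0 mulr_ge0// ltW.
by apply: fposD => //; exact: fpos_gram.
Qed.

Lemma mxnorm_ge0 X : 0 <= mxnorm X.
Proof. by apply: mxnorm_ge => t [/ltW]. Qed.

Lemma mxnorm_entry X i j : cnorm (X i j) <= mxnorm X.
Proof. by apply: mxnorm_ge => t; exact: mx_bound_entry. Qed.

Lemma mxnorm_le_entry X (e : R) : 0 < e -> (forall i j, cnorm (X i j) <= e) ->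
  mxnorm X <= n.+1%:R * e.
Proof. by move=> e0 Xe; apply: mxnorm_le; exact: mx_bound_of_entry. Qed.

Lemma mxnorm0_eq0 X : mxnorm X = 0 -> X = 0.
Proof.
move=> X0; apply/matrixP => i j; rewrite mxE; apply: cnorm_le0.
by rewrite -X0; exact: mxnorm_entry.
Qed.

Lemma ler_mxnormD X Y : mxnorm (X + Y) <= mxnorm X + mxnorm Y.
Proof.
rewrite -lerBlDr; apply: mxnorm_ge => s Xs; rewrite lerBlDl -lerBlDr.
apply: mxnorm_ge => t Yt; rewrite lerBlDl; apply: mxnorm_le; exact: mx_boundD.
Qed.

Lemma ler_mxnormM X Y : mxnorm (X * Y) <= mxnorm X * mxnorm Y.
Proof.
suff H s : mx_bound X s -> mxnorm (X * Y) <= s * mxnorm Y.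
  have [Y0|Y0] := eqVneq (mxnorm Y) 0.
    have [s Xs] := mx_bound_ne X.
    by have := H s Xs; rewrite Y0 !mulr0.
  have Yp : 0 < mxnorm Y by rewrite lt_def Y0 mxnorm_ge0.
  rewrite -ler_pdivrMr//; apply: mxnorm_ge => s /H.
  by rewrite ler_pdivrMr.
move=> Xs; have [s0 _] := Xs.
rewrite -ler_pdivrMl//; apply: mxnorm_ge => t Yt; rewrite ler_pdivrMl//.
by apply: mxnorm_le; exact: mx_boundM.
Qed.

Lemma mxnorm_star X : mxnorm (star_mx X) = mxnorm X.
Proof.
suff le Y : mxnorm (star_mx Y) <= mxnorm Y.
  by apply/eqP; rewrite eq_le le -{1}(mxalg_starK X) le.
by apply: mxnorm_ge => t Yt; apply: mxnorm_le; exact: mx_bound_star.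
Qed.

Lemma mxnorm_starM X : mxnorm (star_mx X * X) = mxnorm X ^+ 2.
Proof.
apply/eqP; rewrite eq_le; apply/andP; split.
  by rewrite expr2 (le_trans (ler_mxnormM _ _))// mxnorm_star.
apply: mxnorm_ge => c Xc; have [c0 _] := Xc.
rewrite -[leRHS](@sqr_sqrtr _ c) ?(ltW c0)// ler_pXn2r ?nnegrE ?sqrtr_ge0 ?mxnorm_ge0//.
by apply: mxnorm_le; exact: mx_bound_gram.
Qed.

Let normCR (a : R[i]) : `|a| = (Normc.normc a)%:C. Proof. by []. Qed.

Lemma mxnormZ (a : R[i]) X : (mxnorm (a *: X))%:C = `|a| * (mxnorm X)%:C.
Proof.
rewrite normCR -rmorphM /=; congr (_%:C).
have nz (b : R[i]) : b != 0 -> 0 < Normc.normc b.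
  by move=> b0; rewrite -ltcR -normCR normr_gt0.
have le (b : R[i]) Y : b != 0 -> mxnorm (b *: Y) <= Normc.normc b * mxnorm Y.
  move=> b0; rewrite -ler_pdivrMl ?nz//; apply: mxnorm_ge => t [t0 Yt].
  rewrite ler_pdivrMl ?nz//; apply: mxnorm_le; split; first by rewrite mulr_gt0 ?nz.
  have -> : ((Normc.normc b * t) ^+ 2)%:C *: 1 - star_mx (b *: Y) * (b *: Y) =
      (Normc.normc b ^+ 2)%:C *: ((t ^+ 2)%:C *: 1 - star_mx Y * Y).
    have bb : (Normc.normc b ^+ 2)%:C = b^*%R * b.
      by rewrite mulrC -normCK normCR rmorphXn.
    rewrite mxalg_starZ exprMn rmorphM /= bb -scalerAl -scalerAr scalerA.
    by rewrite scalerBr -?scalerAl; linear_identity R[i].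
  by apply: fposZ => //; exact: sqr_ge0.
have [->|a0] := eqVneq a 0.
  rewrite scale0r Normc.normc0 mul0r; apply/eqP; rewrite eq_le mxnorm_ge0 andbT.
  by apply/ler_addgt0Pr => t t0; rewrite add0r; apply: mxnorm_le; exact: mx_bound0.
apply/eqP; rewrite eq_le le//= -ler_pdivlMl ?nz// -Normc.normcV.
rewrite -{1}(scale1r X) -(mulVf a0) -scalerA; apply: le; exact: invr_neq0.
Qed.

Lemma mxnorm_complete (u : nat -> mxalg) :
  (forall e : R, 0 < e -> \forall m & n \near \oo, mxnorm (u m - u n) < e) ->
  exists l : mxalg, mxnorm (u n - l) @[n --> \oo] --> (0 : R).
Proof.
move=> uC.
have entry i j : exists l : D, cnorm (u n i j - l) @[n --> \oo] --> (0 : R).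
  apply: cnorm_complete => e /uC; apply: filterS => -[k l] /= H.
  apply: le_lt_trans H; have := mxnorm_entry (u k - u l) i j.
  by rewrite !mxE.
have [L LP] := choice (fun ij : 'I_n.+1 * 'I_n.+1 => entry ij.1 ij.2).
exists (\matrix_(i, j) L (i, j) : mxalg).
apply/cvgrPdist_le => e e0.
have e1 : 0 < e / n.+1%:R by rewrite divr_gt0// ltr0n.
have : \forall k \near \oo, forall ij : 'I_n.+1 * 'I_n.+1,
    cnorm (u k ij.1 ij.2 - L ij) <= e / n.+1%:R.
  apply: filter_forall => ij.
  have /cvgrPdist_le /(_ _ e1) := LP ij; apply: filterS => k.
  by rewrite sub0r normrN ger0_norm// cnorm_ge0.
apply: filterS => k H; rewrite sub0r normrN ger0_norm ?mxnorm_ge0//.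
rewrite -[leRHS](@divfK _ n.+1%:R) ?pnatr_eq0// mulrC.
by apply: mxnorm_le_entry => // i j; have := H (i, j); rewrite !mxE.
Qed.

HB.instance Definition _ := isCStarAlgebra.Build R mxalg
  mxalg_starK mxalg_starD mxalg_starZ mxalg_starM mxnorm0_eq0 ler_mxnormD mxnormZ
  ler_mxnormM mxnorm_starM mxnorm_complete.

Lemma mxalg_starE X : star X = adjmx X. Proof. by []. Qed.

End MatrixAlgebra.

(** The Gram factor comes from [pos_criterion] in the C*-algebra of matrices, where [- y^2] would be
    both positive and negative as a form. Size 0 is apart because [mxalg] starts at size 1. *)
Lemma mx_posP (R : realType) (D : cstarAlgType R) n (X : 'M[D]_n) :
  mx_pos X <-> form_pos X.
Proof.
split=> [[Y ->]|XP]; first exact: form_pos_gram.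
case: n X XP => [|n] X XP; first by exists X; apply/matrixP => -[].
have [Z XZ] : is_pos (X : mxalg D n).
  apply: pos_criterion; first exact: form_pos_adj.
  move=> x y sy xy; have yP : form_pos (y * y).
    by rewrite -{1}sy; exact: form_pos_gram.
  have : form_pos (- (y * y)) by rewrite -xy; exact: form_pos_conj.
  by move=> /(form_pos_anti yP) y0; apply: star_mul_eq0; rewrite sy.
by exists Z.
Qed.

(** * Group C*-algebras of finite groups *)

(* The relations of the group C*-algebra of a finite group, whose canonical
   unitaries form a basis. *)
Record group_algebra (R : realType) (G : finGroupType) (C : cstarAlgType R) :=
  GroupAlgebra {
    ga_unit : G -> C;
    ga_coef : C -> G -> R[i];
    ga_coef_lin : forall g, scalar (ga_coef^~ g);
    ga_coefE : forall c, c = \sum_g ga_coef c g *: ga_unit g;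
    ga_coef_unit : forall g h, ga_coef (ga_unit g) h = (g == h)%:R;
    ga_unit1 : ga_unit 1%g = 1;
    ga_unitM : forall g h, ga_unit (g * h)%g = ga_unit g * ga_unit h;
    ga_unit_star : forall g, star (ga_unit g) = ga_unit g^-1%g
  }.

Section GroupAlgebra.
Variables (R : realType) (G : finGroupType) (C : cstarAlgType R).
Variable b : group_algebra G C.
Local Notation u := (ga_unit b).
Local Notation k := (ga_coef b).
Let k_lin := ga_coef_lin b.
Let kE := ga_coefE b.
Let ku := ga_coef_unit b.
Let u1 := ga_unit1 b.
Let uM := ga_unitM b.
Let u_star := ga_unit_star b.
Implicit Types (c d x y : C) (g h l : G).

Lemma coefD x y g : k (x + y) g = k x g + k y g.
Proof. by rewrite -{1}(scale1r x) k_lin mul1r. Qed.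

Lemma coef0 g : k 0 g = 0.
Proof. by apply: (@addrI _ (k 0 g)); rewrite -coefD !addr0. Qed.

Lemma coefZ (a : R[i]) x g : k (a *: x) g = a * k x g.
Proof. by rewrite -{1}(addr0 (a *: x)) k_lin coef0 addr0. Qed.

Lemma coefN x g : k (- x) g = - k x g.
Proof. by rewrite -scaleN1r coefZ mulN1r. Qed.

Lemma coef_sum I (r : seq I) (P : pred I) (F : I -> C) g :
  k (\sum_(i <- r | P i) F i) g = \sum_(i <- r | P i) k (F i) g.
Proof. exact: (big_morph (k^~ g) (fun x y => coefD x y g) (coef0 g)). Qed.

Lemma coef_lincomb (a : G -> R[i]) g : k (\sum_h a h *: u h) g = a g.
Proof.
rewrite coef_sum (bigD1 g)//= coefZ ku eqxx mulr1 big1 ?addr0// => h hg.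
by rewrite coefZ ku (negPf hg) mulr0.
Qed.

Lemma coef_ext x y : k x =1 k y -> x = y.
Proof. by move=> xy; rewrite (kE x) (kE y); apply: eq_bigr => g _; rewrite xy. Qed.

Lemma coef_uMl g c h : k (u g * c) h = k c (g^-1 * h)%g.
Proof.
rewrite {1}(kE c) mulr_sumr.
under eq_bigr => l _ do rewrite -scalerAr -uM.
rewrite (reindex_inj (mulgI g^-1%g)) /=.
by under eq_bigr => l _ do rewrite mulKVg; rewrite coef_lincomb.
Qed.

Lemma coef_uMr g c h : k (c * u g) h = k c (h * g^-1)%g.
Proof.
rewrite {1}(kE c) mulr_suml.
under eq_bigr => l _ do rewrite -scalerAl -uM.
rewrite (reindex_inj (mulIg g^-1%g)) /=.
by under eq_bigr => l _ do rewrite mulgKV; rewrite coef_lincomb.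
Qed.

Lemma coef_star c g : k (star c) g = (k c g^-1%g)^*%R.
Proof.
rewrite {1}(kE c) star_sum; under eq_bigr => l _ do rewrite starZ u_star.
rewrite (reindex_inj invg_inj) /=.
by under eq_bigr => l _ do rewrite invgK; rewrite (coef_lincomb (fun h => (k c h^-1%g)^*%R)).
Qed.

Definition trace c := k c 1%g.

Lemma traceM x y : trace (x * y) = \sum_g k x g * k y g^-1%g.
Proof.
rewrite /trace {1}(kE x) mulr_suml coef_sum; apply: eq_bigr => g _.
by rewrite -scalerAl coefZ coef_uMl mulg1.
Qed.

Lemma traceC x y : trace (x * y) = trace (y * x).
Proof.
rewrite !traceM (reindex_inj invg_inj) /=; apply: eq_bigr => g _.
by rewrite invgK mulrC.
Qed.

Lemma trace_gram x : trace (star x * x) = \sum_g `|k x g| ^+ 2.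
Proof.
rewrite traceM (reindex_inj invg_inj) /=; apply: eq_bigr => g _.
by rewrite coef_star invgK mulrC -normCK.
Qed.

Lemma trace_gram_ge0 x : 0 <= trace (star x * x).
Proof. by rewrite trace_gram sumr_ge0// => g _; exact: exprn_ge0. Qed.

Lemma trace_pos x : is_pos x -> 0 <= trace x.
Proof. by move=> [y ->]; exact: trace_gram_ge0. Qed.

Lemma trace_gram_eq0 x : trace (star x * x) <= 0 -> x = 0.
Proof.
move=> x0; apply: coef_ext => g; rewrite coef0.
have : trace (star x * x) = 0 by apply/le_anti; rewrite x0 trace_gram_ge0.
rewrite trace_gram => /eqP; rewrite psumr_eq0 => [|h _]; last exact: exprn_ge0.
by move=> /allP/(_ g (mem_index_enum _))/=; rewrite expf_eq0/= normr_eq0 => /eqP.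
Qed.

Lemma trace_uc g c : trace (u g * c) = k c g^-1%g.
Proof. by rewrite /trace coef_uMl mulg1. Qed.

(** Polarization over [1 + a u_g] shows [x] self-adjoint; then faithfulness of the trace verifies
    the criterion. *)
Lemma pos_of_trace x : (forall d, 0 <= trace (star d * x * d)) -> is_pos x.
Proof.
move=> xP; have i2 : 'i%C * 'i%C = -1 :> R[i] by rewrite -expr2 sqr_i.
apply: pos_criterion.
  suff : x - star x = 0 by move=> /eqP; rewrite subr_eq0 => /eqP.
  pose w := x - star x.
  have w0 d : trace (star d * w * d) = 0.
    rewrite /w mulrBr mulrBl /trace coefD coefN.
    have -> : star d * star x * d = star (star d * x * d).
      by rewrite !starM starK mulrA.
    rewrite coef_star invg1 -/(trace _) geC0_conj ?subrr//.
  apply: coef_ext => g; rewrite coef0.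
  have polar (a : R[i]) : trace (star (1 + a *: u g) * w * (1 + a *: u g)) =
      trace w + a * trace (u g * w) + a^*%R * trace (w * u g^-1%g) +
      a^*%R * a * trace (u g^-1%g * w * u g).
    rewrite starD starZ star1 u_star mulrDl mul1r mulrDr mulr1 mulrDl.
    rewrite -![in LHS]scalerAr -![in LHS]scalerAl /trace !coefD !coefZ -!/(trace _).
    by rewrite (traceC w (u g)) (traceC (u g^-1%g) w); ring.
  have t1 : trace w = 0.
    by have := w0 1; rewrite star1 mul1r mulr1.
  have tg : trace (u g^-1%g * w * u g) = 0.
    by have := w0 (u g); rewrite u_star.
  have := w0 (1 + 1 *: u g); have := w0 (1 + 'i%C *: u g).
  rewrite !polar t1 tg rmorph1 conj_i (traceC w) trace_uc trace_uc invgK -/w.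
  move: (k w g) (k w g^-1%g) => a a' e1 e2.
  have -> : a = 2^-1 * (0 + 1 * a' + 1 * a + 1 * 1 * 0) -
      2^-1 * - 'i%C * (0 + 'i%C * a' + - 'i%C * a + - 'i%C * 'i%C * 0).
    by field: i2.
  by rewrite e1 e2 !mulr0 subrr.
move=> v y sy e; apply: trace_gram_eq0; rewrite sy.
by rewrite -oppr_ge0 -coefN -e; exact: xP.
Qed.

Lemma mx_pos_of_trace n (T : 'M[C]_n) :
  (forall c : 'I_n -> C, 0 <= trace (\sum_i \sum_j star (c i) * T i j * c j)) ->
  mx_pos T.
Proof.
move=> TP; apply/mx_posP => v; apply: pos_of_trace => d.
rewrite mx_formE mulr_sumr mulr_suml.
under eq_bigr => i _.
  rewrite mulr_sumr mulr_suml.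
  under eq_bigr => j _.
    rewrite (_ : _ * _ = star (v i 0 * d) * T i j * (v j 0 * d)); last first.
      by rewrite starM !mulrA.
    over.
  over.
exact: (TP (fun i => v i 0 * d)).
Qed.

End GroupAlgebra.

(** * Arveson's extension theorem with values in the group algebra *)

Section Arveson.
Variables (R : realType) (G : finGroupType) (C : cstarAlgType R).
Variable b : group_algebra G C.
Local Notation u := (ga_unit b).
Local Notation k := (ga_coef b).
Local Notation tr := (trace b).
Implicit Types (g h l : G).

Lemma trace_double_sum n (F : 'I_n -> 'I_n -> C) (c : 'I_n -> C) :
  tr (\sum_i \sum_j star (c i) * F i j * c j) =
  \sum_i \sum_j \sum_g \sum_h
    (k (c i) g)^*%R * k (c j) h * k (F i j) (g * h^-1)%g.
Proof.
rewrite /trace coef_sum; apply: eq_bigr => i _.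
rewrite coef_sum; apply: eq_bigr => j _.
rewrite {1}(ga_coefE b (c i)) star_sum -mulrA mulr_suml coef_sum.
apply: eq_bigr => g _; rewrite starZ ga_unit_star -scalerAl coefZ coef_uMl.
rewrite mulg1 invgK {1}(ga_coefE b (c j)) mulr_sumr coef_sum mulr_sumr.
apply: eq_bigr => h _; rewrite -scalerAr coefZ coef_uMr; exact: mulrA.
Qed.

Lemma ucp_of_trace (D : cstarAlgType R) (F : D -> C) :
    (forall (a : R[i]) x y, F (a *: x + y) = a *: F x + F y) -> F 1 = 1 ->
    (forall n (Y : 'M[D]_n) (c : 'I_n -> C),
       0 <= tr (\sum_i \sum_j star (c i) * F ((adjmx Y *m Y) i j) * c j)) ->
  ucp F.
Proof.
move=> F_lin F1 F_pos; split=> //.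
move=> n _ _ [Y ->]; apply: (mx_pos_of_trace (b := b)) => c.
rewrite (_ : \sum_i _ = \sum_i \sum_j star (c i) * F ((adjmx Y *m Y) i j) * c j)//.
by apply: eq_bigr => i _; apply: eq_bigr => j _; rewrite mxE.
Qed.

(** [mxalg D N] consists of matrices of size [N.+1], so with this value its indices enumerate G. *)
Local Notation N := (#|G|.-1).
Let cardG : N.+1 = #|G|. Proof. by rewrite prednK// -cardsT cardG_gt0. Qed.
Let elt (i : 'I_N.+1) : G := enum_val (cast_ord cardG i).
Let idx (g : G) : 'I_N.+1 := cast_ord (esym cardG) (enum_rank g).
Let eltK : cancel elt idx.
Proof. by move=> i; rewrite /idx /elt enum_valK cast_ordK. Qed.
Let idxK : cancel idx elt.
Proof. by move=> g; rewrite /idx /elt cast_ordKV enum_rankK. Qed.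

Let sum_elt (V : nmodType) (F : 'I_N.+1 -> V) : \sum_i F i = \sum_g F (idx g).
Proof.
by rewrite (reindex idx)//; exists elt => i _; [exact: idxK|exact: eltK].
Qed.

Section Extension.
Variables (D : cstarAlgType R) (E : set D) (phi : D -> C).
Hypothesis E_sys : operator_system E.
Hypothesis phi_ucp : ucp_on E [set: C] phi.
Local Notation W := (mxalg D N).

Let E1 : E 1. Proof. by case: E_sys. Qed.
Let E_lin (a : R[i]) x y : E x -> E y -> E (a *: x + y).
Proof. by case: E_sys => _ + _; apply. Qed.
Let E0 : E 0.
Proof. by rewrite -(addNr 1) -scaleN1r; exact: E_lin. Qed.
Let phi_lin (a : R[i]) x y : E x -> E y -> phi (a *: x + y) = a *: phi x + phi y.
Proof. by case: phi_ucp => _ _ + _; apply. Qed.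
Let phi0 : phi 0 = 0.
Proof.
apply: (@addrI _ (phi 0)); rewrite addr0.
by have := phi_lin 1 E0 E0; rewrite !scale1r addr0.
Qed.

Let mxE_sys (X : W) := forall i j, E (X i j).
(** The trace of [sum_ij u_i^* phi (X_ij) u_j]: complete positivity of [phi] makes this scalar
    functional positive, which reduces the extension of [phi] to the extension of a functional. *)
Let sfun (X : W) : R[i] :=
  \sum_i \sum_j k (phi (X i j)) (elt i * (elt j)^-1)%g.
Let unit_mx i j (x : D) : W := \matrix_(i', j') (if (i' == i) && (j' == j) then x else 0).

Let sfun_unit g h x : E x -> sfun (unit_mx (idx g) (idx h) x) = k (phi x) (g * h^-1)%g.
Proof.
move=> Ex; rewrite /sfun (bigD1 (idx g))//= (bigD1 (idx h))//= !mxE !eqxx /=.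
rewrite !idxK big1 ?addr0 => [|j jh]; last first.
  by rewrite !mxE (negPf jh) andbF phi0 coef0.
rewrite big1 ?addr0// => i ig; rewrite big1// => j _.
by rewrite !mxE (negPf ig) phi0 coef0.
Qed.

Let unit_mx_lin i j (a : R[i]) x y :
  unit_mx i j (a *: x + y) = a *: unit_mx i j x + unit_mx i j y.
Proof.
by apply/matrixP => i' j'; rewrite !mxE; case: ifP => //; rewrite scaler0 addr0.
Qed.

Let sfun_pos (X : W) : mxE_sys X -> is_pos X -> 0 <= sfun X.
Proof.
move=> EX [Y XY]; have : mx_pos (X : 'M[D]_N.+1) by exists Y.
case: phi_ucp => _ _ _ cp /(cp _ _ EX) /mx_posP /(_ (\col_i u (elt i))) fP.
have -> : sfun X = tr (mx_form (map_mx phi (X : 'M[D]_N.+1)) (\col_i u (elt i))).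
  rewrite mx_formE /trace coef_sum; apply: eq_bigr => i _.
  rewrite coef_sum; apply: eq_bigr => j _.
  by rewrite !mxE ga_unit_star -mulrA coef_uMl coef_uMr invgK mulg1.
exact: trace_pos.
Qed.

Lemma matrix_functional_extension : exists F : W -> R[i],
  [/\ scalar F, forall X, is_pos X -> 0 <= F X &
   forall g h x, E x -> F (unit_mx (idx g) (idx h) x) = k (phi x) (g * h^-1)%g].
Proof.
have [|||||||||||||F [[F_lin FE F_pos] _ _]] := @krein_extension _ _
    (@star R W) (@is_pos R W) mxE_sys sfun 1 _ _ _ _ _ _ _ _ _ _ _ _ _ 0 (star0 _).
- by move=> a x y; rewrite starD starZ.
- exact: starK.
- exact: pos0.
- exact: posD.
- by move=> t x /ltW; exact: posZ.
- by move=> a x y Ex Ey i j; rewrite !mxE; exact: E_lin.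
- by move=> x Ex i j; rewrite mxalg_starE adjmxE; case: E_sys => _ _; apply.
- move=> a x y Ex Ey; rewrite /sfun mulr_sumr -big_split /=; apply: eq_bigr => i _.
  rewrite mulr_sumr -big_split /=; apply: eq_bigr => j _.
  by rewrite !mxE phi_lin// coefD coefZ.
- by move=> x Ex _; exact: sfun_pos.
- by move=> i j; rewrite !mxE; case: eqP.
- exact: star1.
- by rewrite -(mulr1 1) -{1}(star1 W); exact: pos_star_mul.
- by move=> x sx; exists (cnorm x); exact: pos_cnorm_sub.
exists F; split=> // [X XP|g h x Ex]; first exact: F_pos (pos_sa XP) XP.
rewrite FE ?sfun_unit// => i j; rewrite mxE; by case: ifP.
Qed.

(* The extension is averaged over the right translations of G, under which
   the functional X |-> <X u, u> is invariant. *)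
Lemma arveson_extension : exists2 psi : D -> C, ucp psi &
  forall x, E x -> psi x = phi x.
Proof.
have [F [F_lin F_pos FE]] := matrix_functional_extension.
(* On [E] every term is the coefficient of [phi x] at [g], since [g l l^-1 = g], so averaging
   changes nothing there. *)
pose c g x := N.+1%:R^-1 * \sum_l F (unit_mx (idx (g * l)%g) (idx l) x).
have N0 : N.+1%:R != 0 :> R[i] by rewrite pnatr_eq0.
pose psi x := \sum_g c g x *: u g.
have psiE x : E x -> psi x = phi x.
  move=> Ex; apply: (coef_ext (b := b)) => g; rewrite coef_lincomb /c.
  under eq_bigr do rewrite FE// mulgK.
  rewrite sumr_const (_ : #|_| = N.+1); last by rewrite cardG; exact: eq_card.
  by rewrite -[_ *+ N.+1]mulr_natl mulKf.
exists psi => //; apply: ucp_of_trace.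
- move=> a x y; rewrite /psi scaler_sumr -big_split /=; apply: eq_bigr => g _.
  rewrite scalerA -scalerDl; congr (_ *: _); rewrite /c mulrCA -mulrDr.
  congr (_ * _); rewrite mulr_sumr -big_split /=; apply: eq_bigr => l _.
  by rewrite unit_mx_lin F_lin.
- by rewrite psiE//; case: phi_ucp.
move=> n Y d.
rewrite trace_double_sum.
have coef_psi x g h : k (psi x) (g * h^-1)%g =
    N.+1%:R^-1 * \sum_l F (unit_mx (idx (g * l)%g) (idx (h * l)%g) x).
  rewrite coef_lincomb /c; congr (_ * _); rewrite (reindex_inj (mulgI h)) /=.
  by apply: eq_bigr => l _; rewrite -mulgA mulKg.
(* Chosen so that the trace form to be estimated is the average over [l] of [F] at the Gram matrices
   of the [Q l]. *)
pose Q l : 'M[D]_(n, N.+1) := \matrix_(m, i) \sum_j k (d j) (elt i * l^-1)%g *: Y m j.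
have FD x y : F (x + y) = F x + F y by exact: pfunD.
have Fsum l : F (adjmx (Q l) *m Q l : W) =
    \sum_i \sum_j \sum_g \sum_h (k (d i) g)^*%R * k (d j) h *
      F (unit_mx (idx (g * l)%g) (idx (h * l)%g) ((adjmx Y *m Y) i j)).
  have entry g h : (adjmx (Q l) *m Q l) (idx (g * l)%g) (idx (h * l)%g) =
      \sum_i \sum_j ((k (d i) g)^*%R * k (d j) h) *: (adjmx Y *m Y) i j.
    rewrite mxE; under eq_bigr => m _.
      rewrite adjmxE !mxE !idxK !mulgK star_sum mulr_suml.
      under eq_bigr => i _.
        rewrite mulr_sumr; under eq_bigr => j _.
          rewrite starZ -scalerAr -scalerAl scalerA mulrC. over.
        over.
      over.
    rewrite exchange_big; apply: eq_bigr => i _.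
    rewrite exchange_big; apply: eq_bigr => j _.
    rewrite mxE scaler_sumr; apply: eq_bigr => m _; by rewrite adjmxE mulrC.
  have units (X : W) : X = \sum_i \sum_j unit_mx i j (X i j).
    apply/matrixP => i j; rewrite summxE (bigD1 i)//= summxE (bigD1 j)//=.
    rewrite !mxE !eqxx /= big1 ?addr0 => [|j' jj]; last first.
      by rewrite !mxE [j == _]eq_sym (negPf jj) andbF.
    rewrite big1 ?addr0// => i' ii; rewrite summxE big1// => j' _.
    by rewrite !mxE [i == _]eq_sym (negPf ii).
  rewrite {1}(units (adjmx (Q l) *m Q l)) pfun_sum// sum_elt.
  rewrite (reindex_inj (mulIg l)) /=.
  under eq_bigr => g _.
    rewrite pfun_sum// sum_elt (reindex_inj (mulIg l)) /=.
    under eq_bigr => h _.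
      rewrite entry.
      rewrite (pfun_sum (f := fun x => F (unit_mx (idx (g * l)%g) (idx (h * l)%g) x)));
        last by move=> a x y; rewrite unit_mx_lin F_lin.
      under eq_bigr => i _.
        rewrite (pfun_sum (f := fun x => F (unit_mx (idx (g * l)%g) (idx (h * l)%g) x)));
          last by move=> a x y; rewrite unit_mx_lin F_lin.
        under eq_bigr => j _.
          rewrite (pfunZ (f := fun x => F (unit_mx (idx (g * l)%g) (idx (h * l)%g) x)));
            last by move=> a x y; rewrite unit_mx_lin F_lin.
          over.
        over.
      over.
    rewrite exchange_big /=.
    over.
  rewrite exchange_big; apply: eq_bigr => i _ /=.
  under eq_bigr do rewrite exchange_big /=.
  by rewrite exchange_big.
have -> : \sum_i \sum_j \sum_g \sum_h
     (k (d i) g)^*%R * k (d j) h * k (psi ((adjmx Y *m Y) i j)) (g * h^-1)%g =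
   N.+1%:R^-1 * \sum_l F (adjmx (Q l) *m Q l : W).
  under [in RHS]eq_bigr do rewrite Fsum.
  rewrite [in RHS]exchange_big mulr_sumr /=; apply: eq_bigr => i _.
  rewrite [in RHS]exchange_big mulr_sumr /=; apply: eq_bigr => j _.
  rewrite [in RHS]exchange_big mulr_sumr /=; apply: eq_bigr => g _.
  rewrite [in RHS]exchange_big mulr_sumr /=; apply: eq_bigr => h _.
  by rewrite coef_psi -mulr_sumr mulrCA.
rewrite mulr_ge0 ?invr_ge0//; apply: sumr_ge0 => l _; apply: F_pos.
have /mx_posP[Z ZE] := form_pos_gram (Q l).
by exists Z.
Qed.

End Extension.
End Arveson.

(** * Injectivity of the group algebra, and its pure states *)

Section GroupAlgebraStates.
Variables (R : realType) (G : finGroupType) (C : cstarAlgType R).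
Variable b : group_algebra G C.
Local Notation u := (ga_unit b).
Local Notation k := (ga_coef b).
Local Notation tr := (trace b).
Implicit Types (c d x y : C) (g h l : G).

Lemma group_algebra_injective : injective_system [set: C].
Proof.
split; first by split.
move=> D E F E_sys _ _ phi phi_ucp.
have [psi [_ psi1 psi_lin psi_cp] psiE] := arveson_extension b E_sys phi_ucp.
exists psi => //; split=> // [a x y _ _|n X _]; first exact: psi_lin.
exact: psi_cp.
Qed.

Lemma trace_scalar : scalar tr.
Proof. by move=> a x y; rewrite /trace coefD coefZ. Qed.

Lemma trace_ext x y : (forall c, tr (x * c) = tr (y * c)) -> x = y.
Proof.
move=> xy; apply: (coef_ext (b := b)) => g.
have := xy (u g^-1%g); rewrite /trace !coef_uMr.
by rewrite invgK mul1g.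
Qed.

Lemma functional_density (phi : C -> R[i]) : scalar phi ->
  exists rho, forall c, phi c = tr (rho * c).
Proof.
move=> phi_lin; exists (\sum_g phi (u g^-1%g) *: u g) => c.
rewrite {1}(ga_coefE b c) (pfun_sum phi_lin) traceC traceM.
by apply: eq_bigr => g _; rewrite (pfunZ phi_lin) coef_lincomb invgK.
Qed.

(* Purity forces [q y q] to be a multiple of [q^2] for every [y], where [q] is
   the square root of the density of the state. *)
Lemma pure_density_scalar (phi : C -> R[i]) q : pure_state phi -> star q = q ->
  (forall c, phi c = tr (q * q * c)) ->
  forall y, exists r : R[i], q * y * q = r *: (q * q).
Proof.
move=> [[phi_lin phi_pos phi1] phi_ext] sq phiE.
have half (y : C) : star y = y -> cnorm y <= 2^-1 ->
    exists r : R[i], q * y * q = r *: (q * q).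
  (* As [|y| <= 1/2], [1/4 <= y' <= 3/4]; hence the weight [s = f 1] stays away from 0 and 1, and
     both [f] and [phi - f] can be normalized to states. *)
  move=> sy ny; pose y' := 2^-1%:C *: (1 + y).
  pose f c := tr (q * y' * q * c).
  have f_lin : scalar f.
    by move=> a x z; rewrite /f mulrDr -scalerAr trace_scalar.
  have fpos z : is_pos z -> forall x, is_pos x -> 0 <= tr (q * z * q * x).
    move=> [w ->] _ [v ->].
    have -> : q * (star w * w) * q * (star v * v) = q * star w * (w * q * star v * v).
      by rewrite !mulrA.
    rewrite traceC.
    have -> : w * q * star v * v * (q * star w) = w * q * star v * (v * q * star w).
      by rewrite !mulrA.
    have -> : w * q * star v * (v * q * star w) = star (v * q * star w) * (v * q * star w).
      by rewrite !starM starK sq !mulrA.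
    exact: trace_gram_ge0.
  have y'1 : is_pos (y' - 4^-1%:C *: 1).
    have -> : y' - 4^-1%:C *: 1 = 2^-1%:C *: (2^-1%:C *: 1 + y).
      rewrite /y'; have -> : 4^-1%:C = 2^-1 * 2^-1 :> R[i].
        by rewrite fmorphV rmorph_nat -invfM -natrM.
      by rewrite fmorphV rmorph_nat; linear_identity R[i].
    by apply: posZ; rewrite ?invr_ge0//; exact: pos_le_add.
  have y'2 : is_pos (4^-1%:C *: 1 - (y' - 2^-1%:C *: 1)).
    have -> : 4^-1%:C *: 1 - (y' - 2^-1%:C *: 1) = 2^-1%:C *: (2^-1%:C *: 1 - y).
      rewrite /y'; have -> : 4^-1%:C = 2^-1 * 2^-1 :> R[i].
        by rewrite fmorphV rmorph_nat -invfM -natrM.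
      by rewrite fmorphV rmorph_nat; linear_identity R[i].
    by apply: posZ; rewrite ?invr_ge0//; exact: pos_le_sub.
  have y'P : is_pos y'.
    by rewrite -(subrK (4^-1%:C *: 1) y'); apply: posD => //; apply: pos_scalar.
  have y''P : is_pos (1 - y').
    have -> : 1 - y' = (4^-1%:C *: 1 - (y' - 2^-1%:C *: 1)) + 4^-1%:C *: 1.
      have -> : 4^-1%:C = 2^-1 * 2^-1 :> R[i].
        by rewrite fmorphV rmorph_nat -invfM -natrM.
      by rewrite fmorphV rmorph_nat; linear_identity R[i].
    by apply: posD => //; apply: pos_scalar.
  have one_pos : is_pos (1 : C) by rewrite -(mulr1 1) -{1}star1; exists 1.
  pose s := Re (f 1).
  have fs : f 1 = s%:C by apply: pfun_sa (star1 C) => // a aP; exact: fpos.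
  have tr_shift z (a : R) : tr (q * (z - a%:C *: 1) * q * 1) = tr (q * z * q * 1) - a%:C.
    rewrite mulrBr mulrBl mulrBl -!scalerAr -!scalerAl (pfunB trace_scalar).
    by rewrite (pfunZ trace_scalar) !mulr1 -(mulr1 (q * q)) -phiE phi1 mulr1.
  have s1 : 4^-1 <= s.
    have := fpos _ y'1 1 one_pos; rewrite tr_shift -/(f 1) fs.
    by rewrite -rmorphB ler0c; lra.
  have s2 : s <= 3 / 4.
    have := fpos _ y'2 1 one_pos.
    have -> : 4^-1%:C *: 1 - (y' - 2^-1%:C *: 1) = - (y' - (4^-1 + 2^-1)%:C *: 1).
      by rewrite rmorphD /=; linear_identity R[i].
    rewrite mulrN !mulNr (pfunN trace_scalar) tr_shift -/(f 1) fs.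
    by rewrite -rmorphB -rmorphN ler0c; lra.
  pose f1 c := s^-1%:C * f c; pose f2 c := (1 - s)^-1%:C * (phi c - f c).
  have s0 : 0 < s by lra.
  have s10 : 0 < 1 - s by lra.
  have sC : s%:C != 0 :> R[i] by rewrite fmorph_eq0 gt_eqF.
  have sC1 : (1 - s)%:C != 0 :> R[i] by rewrite fmorph_eq0 gt_eqF.
  have st1 : state f1.
    split=> [a x z|x xP|]; first by rewrite /f1 f_lin; ring.
      by rewrite mulr_ge0 ?ler0c ?invr_ge0 ?(ltW s0)//; exact: fpos.
    by rewrite /f1 fs fmorphV mulVf.
  have st2 : state f2.
    split=> [a x z|x xP|]; first by rewrite /f2 f_lin phi_lin; ring.
      rewrite mulr_ge0 ?ler0c ?invr_ge0 ?(ltW s10)//.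
      rewrite phiE /f -(pfunB trace_scalar) -mulrBl.
      have -> : q * q - q * y' * q = q * (1 - y') * q by rewrite mulrBr mulrBl mulr1.
      exact: fpos.
    by rewrite /f2 fs phi1 -[1 in X in _ * X]/(1%:C) -rmorphB fmorphV mulVf.
  have [] := phi_ext f1 f2 s st1 st2.
  - by apply/andP; split; lra.
  - by move=> a; rewrite /f1 /f2 !mulrA !fmorphV !mulfV// !mul1r addrC subrK.
  move=> f1phi _.
  have fphi c : f c = s%:C * phi c.
    by rewrite -f1phi /f1 mulrA fmorphV mulfV// mul1r.
  have yq : q * y' * q = s%:C *: (q * q).
    apply: trace_ext => c; rewrite -scalerAl (pfunZ trace_scalar) -phiE.
    exact: fphi.
  exists (2 * s%:C - 1); rewrite scalerBl -scalerA -yq /y' scale1r.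
  by rewrite fmorphV rmorph_nat; expand_products; linear_identity R[i].
have sa (y : C) : star y = y -> exists r : R[i], q * y * q = r *: (q * q).
  move=> sy; pose t := 2 * (cnorm y + 1).
  have t0 : 0 < t by rewrite /t; have := cnorm_ge0 y; lra.
  have [||r re] := half (t^-1%:C *: y).
  - by rewrite starZr sy.
  - rewrite cnormZr ger0_norm ?invr_ge0 ?(ltW t0)// mulrC ler_pdivrMr// /t.
    by have := cnorm_ge0 y; lra.
  exists (t%:C * r); rewrite -scalerA -re -scalerAr -scalerAl scalerA -rmorphM.
  by rewrite mulfV ?gt_eqF// scale1r.
move=> y; have [r1 e1] := sa _ (re_part_sa y).
have [r2 e2] := sa _ (re_part_sa ((- 'i%C) *: y)).
exists (r1 + 'i%C * r2); rewrite (re_im_part y) mulrDr mulrDl e1.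
by rewrite -scalerAr -scalerAl e2 scalerA -scalerDl.
Qed.

(** With [q^2] the density, [pure_density_scalar] at [y = q] gives [q^3 = r q^2], hence [q^2 = r q],
    and [q / r] is the projection. *)
Lemma pure_state_projection (phi : C -> R[i]) : pure_state phi ->
  exists p, [/\ star p = p, p * p = p, p != 0, phi p = 1
    & forall c, p * c * p = phi c *: p].
Proof.
move=> phiP; have [[phi_lin phi_pos phi1] _] := phiP.
have [rho phiE] := functional_density phi_lin.
have [q [sq rhoE _]] : exists q, [/\ star q = q, rho = q * q &
    forall z, z * rho = rho * z -> z * q = q * z].
  apply: pos_sqrt; apply: (pos_of_trace (b := b)) => d.
  rewrite traceC mulrA traceC -phiE; apply: phi_pos.
  by exists (star d); rewrite starK.
subst rho; have qyq := pure_density_scalar phiP sq phiE.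
have q2N : q * q != 0.
  apply/eqP => q0; have := phiE 1; rewrite phi1 q0 mul0r (pfun0 trace_scalar).
  by move/eqP; rewrite oner_eq0.
have qN : q != 0 by apply: contraNneq q2N => ->; rewrite mul0r.
have [r qr] := qyq q.
have rN : r != 0.
  apply: contraNneq q2N => r0; apply/eqP/star_mul_eq0.
  by rewrite starM sq mulrA qr r0 scale0r mul0r.
have q2 : q * q = r *: q.
  apply/eqP; rewrite -subr_eq0; apply/eqP.
  (* [r] is not yet known to be real, so with [w = q^2 - r q] it is [w w^*] that is computed: its
     left factor meets [q] on the right and produces [q^3 - r q^2 = 0]. *)
  rewrite -[LHS]starK -[RHS](star0 C); congr star; apply: star_mul_eq0.
  rewrite starK starB starZ starM sq mulrBr -scalerAr !mulrBl !mulrA qr.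
  by rewrite -!scalerAl ?qr !subrr scaler0 subrr.
have rr : r^*%R = r.
  apply: (scaler_injl qN) => /=.
  by rewrite -q2 -{1}sq -starZ -q2 starM sq.
pose p := r^-1 *: q.
have sp : star p = p by rewrite starZ sq fmorphV /= rr.
have pp : p * p = p.
  by rewrite /p -scalerAl -scalerAr q2 !scalerA mulfVK// mulVf.
have pN : p != 0 by rewrite scaler_eq0 invr_eq0 negb_or rN.
have pcp c : exists a, p * c * p = a *: p.
  have [a qcq] := qyq c; exists a.
  by rewrite /p -!scalerAl -scalerAr qcq q2 !scalerA; congr (_ *: _); field.
have phip c : phi c = r * r * tr (p * c * p).
  have -> : phi c = tr (q * c * q) by rewrite phiE -[q * q * c]mulrA traceC.
  have -> : p * c * p = (r^-1 * r^-1) *: (q * c * q).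
    by rewrite /p -!scalerAl -scalerAr scalerA.
  by rewrite (pfunZ trace_scalar); field.
have rtr : r * r * tr p = 1 by rewrite -phi1 phip mulr1 pp.
have pE c : p * c * p = phi c *: p.
  have [a e] := pcp c; rewrite e phip e (pfunZ trace_scalar) mulrCA rtr mulr1.
  by [].
exists p; split=> //.
by apply: (scaler_injl pN); rewrite /= -pE pp pp scale1r.
Qed.

End GroupAlgebraStates.

(** * The reduced crossed product by a finite group *)

Lemma exists_state (R : realType) (A : cstarAlgType R) :
  exists omega : A -> R[i], state omega.
Proof.
have [||||psi [[sp _] _ _]] := @corner_state R A 1 0.
- exact: star1.
- exact: mulr1.
- exact: oner_neq0.
- exact: star0.
- by exists psi.
Qed.

(** The factor 2 comes from splitting into real and imaginary parts; continuity is all that is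
    wanted. *)
Lemma state_scalar_bound (R : realType) (A : cstarAlgType R) (f : A -> R[i]) :
  state f -> forall x, cnorm (f x *: (1 : A)) <= 2 * cnorm x.
Proof.
move=> sf x; have [fl fp f1] := sf.
have bound h : star h = h -> cnorm (f h *: (1 : A)) <= cnorm h.
  move=> sh; rewrite (pfun_sa fl fp sh) cnormZr cnorm1 mulr1.
  by rewrite ler_norml; exact: (state_sub1 sf sh (lexx _)).
rewrite (re_im_part x) pfunD// pfunZ// scalerDl -scalerA.
rewrite (le_trans (ler_cnormD _ _))// cnormZi mulr2n mulrDl mul1r -(re_im_part x).
apply: lerD; apply: le_trans (bound _ (re_part_sa _)) _.
  exact: cnorm_re_part.
exact: cnorm_im_part.
Qed.

Section CrossedProduct.
Variables (R : realType) (A : cstarAlgType R) (G : finGroupType).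
Variables (alpha : cstar_action A G) (B : reduced_crossed_product alpha).
Implicit Types (a : A) (b c : B) (g h s : G) (xi eta : {ffun G -> A}).
Local Notation rep := (@rcp_rep _ _ _ _ B).
Local Notation emb := (@rcp_emb _ _ _ _ B).
Local Notation unt := (@rcp_unit _ _ _ _ B).

Let actH g : star_hom (alpha g) := cact_hom alpha g.

Lemma actKV g a : alpha g (alpha g^-1%g a) = a.
Proof. by rewrite -[LHS](cactM alpha g g^-1%g a) mulgV cact1. Qed.

Lemma rep_ext b c : (forall xi g, rep b xi g = rep c xi g) -> b = c.
Proof.
by move=> bc; apply: rcp_rep_inj; apply/funext => xi; apply/ffunP => g.
Qed.

Lemma repD b c xi : rep (b + c) xi = rep b xi + rep c xi.
Proof. by rewrite -{1}(scale1r b) rcp_rep_linear scale1r. Qed.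

Lemma rep0 xi : rep 0 xi = 0.
Proof. by apply: (@addrI _ (rep 0 xi)); rewrite -repD !addr0. Qed.

Lemma repZ (z : R[i]) b xi : rep (z *: b) xi = z *: rep b xi.
Proof. by rewrite -{1}(addr0 (z *: b)) rcp_rep_linear rep0 addr0. Qed.

Lemma repN b xi : rep (- b) xi = - rep b xi.
Proof. by rewrite -scaleN1r repZ scaleN1r. Qed.

Lemma rep_star_uniq b c :
  (forall xi eta, l2_inner (rep b xi) eta = l2_inner xi (rep c eta)) -> star b = c.
Proof.
move=> bc; apply: rep_ext => eta g.
pose d : {ffun G -> A} := [ffun h => if h == g then 1 else 0].
have inner z : l2_inner d z = z g.
  rewrite /l2_inner (bigD1 g)//= ffunE eqxx star1 mul1r big1 ?addr0// => h hg.
  by rewrite ffunE (negPf hg) star0 mul0r.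
by rewrite -!inner -bc rcp_rep_star.
Qed.

Lemma emb_hom : star_hom emb.
Proof.
split.
- move=> z x y; apply: rep_ext => xi g; rewrite rcp_rep_linear !ffunE.
  rewrite !rcp_rep_emb (star_hom_lin (actH _)) mulrDl.
  by rewrite -scalerAl.
- split; last first.
    move=> x y; apply: rep_ext => xi g.
    by rewrite rcp_repM !rcp_rep_emb (star_homM (actH _)) mulrA.
  by apply: rep_ext => xi g; rewrite rcp_rep_emb (star_hom1 (actH _)) mul1r rcp_rep1.
- move=> x; symmetry; apply: rep_star_uniq => xi eta.
  apply: eq_bigr => g _; rewrite !rcp_rep_emb starM (star_homS (actH _)).
  by rewrite mulrA.
Qed.

Lemma unit1 : unt 1%g = 1.
Proof. by apply: rep_ext => xi g; rewrite rcp_rep_unit invg1 mul1g rcp_rep1. Qed.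

Lemma unitM g h : unt (g * h)%g = unt g * unt h.
Proof.
by apply: rep_ext => xi l; rewrite rcp_repM !rcp_rep_unit invMg mulgA.
Qed.

Lemma unit_star g : star (unt g) = unt g^-1%g.
Proof.
apply: rep_star_uniq => xi eta; rewrite /l2_inner (reindex_inj (mulgI g)) /=.
by apply: eq_bigr => h _; rewrite !rcp_rep_unit mulKg invgK.
Qed.

Lemma unit_emb h a : unt h * emb a = emb (alpha h a) * unt h.
Proof.
apply: rep_ext => xi g; rewrite !rcp_repM !(rcp_rep_emb, rcp_rep_unit).
by rewrite invMg invgK cactM.
Qed.

Let delta : {ffun G -> A} := [ffun g => if g == 1%g then 1 else 0].

(** The coefficient of [u_g]: on [delta], [a u_g] has the value [alpha g^-1 a] at [g], and the outer
    [alpha g] undoes the twist. *)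
Definition cp_coef b g : A := alpha g (rep b delta g).

Lemma cp_coef_lin (z : R[i]) b c g :
  cp_coef (z *: b + c) g = z *: cp_coef b g + cp_coef c g.
Proof. by rewrite /cp_coef rcp_rep_linear !ffunE (star_hom_lin (actH _)). Qed.

Lemma cp_coefD b c g : cp_coef (b + c) g = cp_coef b g + cp_coef c g.
Proof. by rewrite -{1}(scale1r b) cp_coef_lin scale1r. Qed.

Lemma cp_coef0 g : cp_coef 0 g = 0.
Proof. by apply: (@addrI _ (cp_coef 0 g)); rewrite -cp_coefD !addr0. Qed.

Lemma cp_coefZ (z : R[i]) b g : cp_coef (z *: b) g = z *: cp_coef b g.
Proof. by rewrite -{1}(addr0 (z *: b)) cp_coef_lin cp_coef0 addr0. Qed.

Lemma cp_coefB b c g : cp_coef (b - c) g = cp_coef b g - cp_coef c g.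
Proof. by rewrite cp_coefD -scaleN1r cp_coefZ scaleN1r. Qed.

Lemma cp_coef_sum I (r : seq I) (P : pred I) (F : I -> B) g :
  cp_coef (\sum_(i <- r | P i) F i) g = \sum_(i <- r | P i) cp_coef (F i) g.
Proof. exact: (big_morph (cp_coef^~ g) (fun x y => cp_coefD x y g) (cp_coef0 g)). Qed.

Lemma cp_coef_emb_unit a s g :
  cp_coef (emb a * unt s) g = if s == g then a else 0.
Proof.
rewrite /cp_coef rcp_repM rcp_rep_emb rcp_rep_unit ffunE -eq_mulVg1.
by case: eqP => _; rewrite ?mulr1 ?mulr0 ?actKV ?(star_hom0 (actH _)).
Qed.

Lemma cp_coef_lincomb (x : G -> A) g : cp_coef (\sum_s emb (x s) * unt s) g = x g.
Proof.
rewrite cp_coef_sum (bigD1 g)//= cp_coef_emb_unit eqxx big1 ?addr0// => s sg.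
by rewrite cp_coef_emb_unit (negPf sg).
Qed.

(** Evaluating [b^* b <= |b|^2] at [delta] bounds the sum of all [x_h^* x_h], with
    [x = rep b delta], hence each term. This continuity makes the spans below closed. *)
Lemma cnorm_cp_coef b g : cnorm (cp_coef b g) <= cnorm b.
Proof.
apply: le_trans (star_hom_cnorm (actH _) _) _.
have b0 := cnorm_ge0 b; apply/(cnorm_leP _ b0).
have [k ek] := (cnorm_leP b b0).1 (lexx _).
have inner xi : l2_inner delta xi = xi 1%g.
  rewrite /l2_inner (bigD1 1%g)//= ffunE eqxx star1 mul1r big1 ?addr0// => h hg.
  by rewrite ffunE (negPf hg) star0 mul0r.
have gram c : rep (star c * c) delta 1%g = \sum_h star (rep c delta h) * rep c delta h.
  by rewrite -inner rcp_repM -rcp_rep_star.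
have : (cnorm b ^+ 2)%:C *: 1 - \sum_h star (rep b delta h) * rep b delta h =
    \sum_h star (rep k delta h) * rep k delta h.
  by rewrite -!gram -ek repD repN repZ rcp_rep1 !ffunE eqxx.
rewrite (bigD1 g)//= => e.
have -> : (cnorm b ^+ 2)%:C *: 1 - star (rep b delta g) * rep b delta g =
   \sum_h star (rep k delta h) * rep k delta h +
   \sum_(h | h != g) star (rep b delta h) * rep b delta h.
  by rewrite -e; linear_identity R[i].
by apply: posD; apply: pos_sum => h _; exact: pos_star_mul.
Qed.

Definition cp_span : set B := [set b | exists x : G -> A, b = \sum_g emb (x g) * unt g].

Let span_emb_unit a s : cp_span (emb a * unt s).
Proof.
exists (fun g => if g == s then a else 0); rewrite (bigD1 s)//= eqxx.
rewrite big1 ?addr0// => g gs.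
by rewrite (negPf gs) (star_hom0 emb_hom) mul0r.
Qed.

Let span_lin (z : R[i]) b c : cp_span b -> cp_span c -> cp_span (z *: b + c).
Proof.
move=> [x ->] [y ->]; exists (fun g => z *: x g + y g).
rewrite scaler_sumr -big_split; apply: eq_bigr => g _ /=.
by rewrite (star_hom_lin emb_hom) mulrDl -scalerAl.
Qed.

Let span0 : cp_span 0.
Proof.
exists (fun=> 0); rewrite big1// => g _; by rewrite (star_hom0 emb_hom) mul0r.
Qed.

Let span_sum (F : G -> B) : (forall g, cp_span (F g)) -> cp_span (\sum_g F g).
Proof.
move=> FP; elim/big_ind: _ => // x y xP yP.
by rewrite -(scale1r x); exact: span_lin.
Qed.

Let span1 : cp_span 1.
Proof. by rewrite -(mulr1 1) -{1}(star_hom1 emb_hom) -{1}unit1; exact: span_emb_unit. Qed.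

Let span_mul b c : cp_span b -> cp_span c -> cp_span (b * c).
Proof.
move=> [x ->] [y ->]; rewrite mulr_suml; apply: span_sum => g.
rewrite mulr_sumr; apply: span_sum => h.
rewrite mulrA -(mulrA (emb _)) unit_emb mulrA -(star_homM emb_hom) -mulrA -unitM.
exact: span_emb_unit.
Qed.

Let span_star b : cp_span b -> cp_span (star b).
Proof.
move=> [x ->]; rewrite star_sum; apply: span_sum => g.
by rewrite starM unit_star -(star_homS emb_hom) unit_emb; exact: span_emb_unit.
Qed.

Let span_closed : cnorm_closed cp_span.
Proof.
(* The error is that of [b - y] itself plus one for each of its [#|G|] coefficients. *)
move=> b bP; exists (cp_coef b); apply: (@cnorm_dist_le _ _ (1 + #|G|%:R)) => e e0.
have [y [x yx] bye] := bP e e0.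
have yE : y = \sum_g emb (cp_coef y g) * unt g.
  by rewrite {1}yx; apply: eq_bigr => g _; rewrite yx cp_coef_lincomb.
have -> : b - \sum_g emb (cp_coef b g) * unt g =
    (b - y) - \sum_g emb (cp_coef (b - y) g) * unt g.
  rewrite -addrA; congr (_ + _); rewrite {1}yE -opprD -big_split; congr (- _).
  apply: eq_bigr => g _ /=; rewrite -mulrDl -(star_homD emb_hom) -cp_coefD.
  by rewrite addrC subrK.
have un g : cnorm (unt g) = 1.
  apply/eqP; rewrite -(@eqrXn2 _ 2) ?cnorm_ge0//.
  by rewrite -cnorm_starM unit_star -unitM mulVg unit1 cnorm1 expr1n.
rewrite (le_trans (cnorm_sub _ _))// mulrDl mul1r lerD ?(ltW bye)//.
rewrite (le_trans (cnorm_sum _ _ _))//.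
have -> : #|G|%:R * e = \sum_(g : G) e by rewrite sumr_const mulr_natl.
apply: ler_sum => g _; rewrite (le_trans (ler_cnormM _ _))// un mulr1.
rewrite (le_trans (star_hom_cnorm emb_hom _))//.
by rewrite (le_trans (cnorm_cp_coef _ _))// ltW.
Qed.

Lemma cp_coefE b : b = \sum_g emb (cp_coef b g) * unt g.
Proof.
suff [x bx] : cp_span b.
  by rewrite {1}bx; apply: eq_bigr => g _; rewrite bx cp_coef_lincomb.
pose S := CStarSub span1 span_lin span_mul span_star span_closed.
suff : cs_set (cstar_gen (range emb `|` range unt)) b by move=> /(_ S); apply;
  move=> _ [[a _ <-]|[g _ <-]]; [rewrite -(mulr1 (emb a)) -unit1|
  rewrite -(mul1r (unt g)) -(star_hom1 emb_hom)]; exact: span_emb_unit.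
by rewrite rcp_gen.
Qed.

Lemma cp_coef_ext b c : cp_coef b =1 cp_coef c -> b = c.
Proof.
by move=> bc; rewrite (cp_coefE b) (cp_coefE c); apply: eq_bigr => g _; rewrite bc.
Qed.

Lemma cp_coef_embl a b g : cp_coef (emb a * b) g = a * cp_coef b g.
Proof.
rewrite {1}(cp_coefE b) mulr_sumr.
under eq_bigr => h _ do rewrite mulrA -(star_homM emb_hom).
by rewrite (cp_coef_lincomb (fun h => a * cp_coef b h)).
Qed.

Lemma cp_coef_unitl h b g : cp_coef (unt h * b) g = alpha h (cp_coef b (h^-1 * g)%g).
Proof.
rewrite {1}(cp_coefE b) mulr_sumr.
under eq_bigr => l _ do rewrite mulrA unit_emb -mulrA -unitM.
rewrite (reindex_inj (mulgI h^-1%g)) /=.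
under eq_bigr => l _ do rewrite mulKVg.
by rewrite (cp_coef_lincomb (fun l => alpha h (cp_coef b (h^-1 * l)%g))).
Qed.

Lemma cp_coef_unitr h b g : cp_coef (b * unt h) g = cp_coef b (g * h^-1)%g.
Proof.
rewrite {1}(cp_coefE b) mulr_suml.
under eq_bigr => l _ do rewrite -mulrA -unitM.
rewrite (reindex_inj (mulIg h^-1%g)) /=.
under eq_bigr => l _ do rewrite mulgKV.
by rewrite (cp_coef_lincomb (fun l => cp_coef b (l * h^-1)%g)).
Qed.

Lemma cp_coefM b c g :
  cp_coef (b * c) g = \sum_h cp_coef b h * alpha h (cp_coef c (h^-1 * g)%g).
Proof.
rewrite {1}(cp_coefE b) mulr_suml cp_coef_sum; apply: eq_bigr => h _.
by rewrite -mulrA cp_coef_embl cp_coef_unitl.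
Qed.

Lemma cp_coef_star b g : cp_coef (star b) g = alpha g (star (cp_coef b g^-1%g)).
Proof.
rewrite {1}(cp_coefE b) star_sum.
under eq_bigr => h _ do
  rewrite starM unit_star -(star_homS emb_hom) unit_emb.
rewrite (reindex_inj invg_inj) /=.
under eq_bigr => h _ do rewrite invgK.
by rewrite (cp_coef_lincomb (fun h => alpha h (star (cp_coef b h^-1%g)))).
Qed.

Lemma cp_coef_emb a g : cp_coef (emb a) g = if g == 1%g then a else 0.
Proof. by rewrite -(mulr1 (emb a)) -unit1 cp_coef_emb_unit eq_sym. Qed.

Lemma cp_coef_unit h g : cp_coef (unt h) g = (h == g)%:R.
Proof.
rewrite -(mul1r (unt h)) -(star_hom1 emb_hom) cp_coef_emb_unit.
by case: eqP.
Qed.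

Lemma cp_coef_gram b : cp_coef (star b * b) 1%g =
  \sum_g alpha g^-1%g (star (cp_coef b g) * cp_coef b g).
Proof.
rewrite cp_coefM (reindex_inj invg_inj) /=; apply: eq_bigr => g _.
by rewrite cp_coef_star invgK mulg1 (star_homM (actH _)).
Qed.

Definition scalar_coefs : set B := [set b | forall g, exists z : R[i], cp_coef b g = z *: 1].

Let act_scalar h (z : R[i]) : alpha h (z *: 1) = z *: 1.
Proof. by rewrite (star_homZ (actH _)) (star_hom1 (actH _)). Qed.

Let sc1 : scalar_coefs 1.
Proof. by move=> g; exists (1%g == g)%:R; rewrite -unit1 cp_coef_unit scaler_nat. Qed.
Let sc_lin (z : R[i]) b c : scalar_coefs b -> scalar_coefs c -> scalar_coefs (z *: b + c).
Proof.
move=> bP cP g; have [x ex] := bP g; have [y ey] := cP g.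
by exists (z * x + y); rewrite cp_coef_lin ex ey scalerA -scalerDl.
Qed.
Let sc_mul b c : scalar_coefs b -> scalar_coefs c -> scalar_coefs (b * c).
Proof.
move=> /choice[x xE] /choice[y yE] g; exists (\sum_h x h * y (h^-1 * g)%g).
rewrite cp_coefM scaler_suml; apply: eq_bigr => h _.
by rewrite xE yE act_scalar -scalerAl mul1r scalerA.
Qed.
Let sc_star b : scalar_coefs b -> scalar_coefs (star b).
Proof.
move=> bP g; have [x ex] := bP g^-1%g; exists x^*%R.
by rewrite cp_coef_star ex starZ star1 act_scalar.
Qed.
Let sc_closed : cnorm_closed scalar_coefs.
Proof.
move=> b bP g; have [om sOm] := exists_state A; have [ol _ o1] := sOm.
(* A state reads off the scalar; 3 is 1 for the coefficient plus 2 from [state_scalar_bound]. *)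
exists (om (cp_coef b g)); apply: (@cnorm_dist_le _ _ 3) => e /bP[y /(_ g)[z yz] bye].
have n1 : cnorm (cp_coef b g - z *: 1) <= e.
  by rewrite -yz -cp_coefB (le_trans (cnorm_cp_coef _ _))// ltW.
have -> : cp_coef b g - om (cp_coef b g) *: 1 =
    (cp_coef b g - z *: 1) - om (cp_coef b g - z *: 1) *: 1.
  by rewrite (pfunB ol) (pfunZ ol) o1 mulr1; linear_identity R[i].
rewrite (le_trans (cnorm_sub _ _))//.
by have := state_scalar_bound sOm (cp_coef b g - z *: 1); lra.
Qed.

Lemma group_cstarP b : cs_set (group_cstar B) b <-> scalar_coefs b.
Proof.
split=> [|bP S uS].
  move=> /(_ (CStarSub sc1 sc_lin sc_mul sc_star sc_closed)); apply => _ [h _ <-] g.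
  by exists (h == g)%:R; rewrite cp_coef_unit scaler_nat.
have S0 : cs_set S 0.
  by rewrite -(addNr 1) -scaleN1r; apply: csP; exact: cs1.
rewrite (cp_coefE b); elim/big_ind: _ => // [x y Sx Sy|g _].
  by rewrite -(scale1r x); exact: csP.
have [z ->] := bP g; rewrite (star_homZ emb_hom) (star_hom1 emb_hom).
rewrite -scalerAl mul1r -(addr0 (z *: _)); apply: csP => //.
by apply: uS; exists g.
Qed.

Lemma group_cstar_unit g : cs_set (group_cstar B) (unt g).
Proof. by move=> S; apply; exists g. Qed.

Lemma group_cstar_algebra : exists ga : group_algebra G (subalg (group_cstar B)),
  forall g, subalg_val (ga_unit ga g) = unt g.
Proof.
have [om [ol _ o1]] := exists_state A.
pose u g := subalg_of (group_cstar_unit g).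
pose k (c : subalg (group_cstar B)) g := om (cp_coef (subalg_val c) g).
have kE (c : subalg (group_cstar B)) g : cp_coef (subalg_val c) g = k c g *: 1.
  have /group_cstarP/(_ g)[z zE] := subalgP c.
  by rewrite /k zE (pfunZ ol) o1 mulr1.
have svD (x y : subalg (group_cstar B)) :
  subalg_val (x + y) = subalg_val x + subalg_val y by [].
have svZ (z : R[i]) (x : subalg (group_cstar B)) :
  subalg_val (z *: x) = z *: subalg_val x by [].
have sv_sum (F : G -> subalg (group_cstar B)) :
    subalg_val (\sum_g F g) = \sum_g subalg_val (F g).
  by apply: (big_morph _ svD).
have k_lin g : scalar (k^~ g).
  by move=> z x y; rewrite /k svD svZ cp_coef_lin ol.
have kE' (c : subalg (group_cstar B)) : c = \sum_g k c g *: u g.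
  apply: val_inj => /=; rewrite sv_sum (cp_coefE (subalg_val c)).
  apply: eq_bigr => g _.
  by rewrite kE svZ (star_homZ emb_hom) (star_hom1 emb_hom) -scalerAl mul1r.
have ku g h : k (u g) h = (g == h)%:R.
  by rewrite /k /= cp_coef_unit; case: eqP => _; rewrite ?o1// (pfun0 ol).
have u1 : u 1%g = 1 by apply: val_inj => /=; rewrite unit1.
have uM g h : u (g * h)%g = u g * u h by apply: val_inj => /=; rewrite unitM.
have uS g : star (u g) = u g^-1%g by apply: val_inj => /=; rewrite unit_star.
by exists (GroupAlgebra k_lin kE' ku u1 uM uS).
Qed.

End CrossedProduct.

(** The pure states that [corner_state] gives for [y] and for [- y] both take the prescribed value,
    and so bound [p y p - z p] from above and from below. *)
Lemma corner_unique (R : realType) (D : cstarAlgType R) (p y : D) (z : R[i]) :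
    star p = p -> p * p = p -> p != 0 -> star y = y ->
    (forall psi, pure_state psi -> psi p = 1 -> psi y = z) ->
  p * y * p = z *: p.
Proof.
move=> sp pp p0 sy psiz.
have [psi [psiP psip psiy]] := corner_state sp pp p0 sy.
have sNy : star (- y) = - y by rewrite starN sy.
have [chi [chiP chip chiy]] := corner_state sp pp p0 sNy.
have zE := psiz _ psiP psip.
have chiE : chi (- y) = - z.
  by rewrite -(psiz _ chiP chip) pfunN//; case: chiP => -[].
have zr : z = (Re z)%:C.
  by rewrite -zE; case: psiP => -[? ? _] _; exact: pfun_sa.
move: (Re z) zr zE chiE psiy chiy => t -> zE chiE psiy chiy.
apply: (@cnorm_dist_le _ _ 1) => e e0; rewrite mul1r.
have [s1 p1] := proj_compl sp pp.
have eP : is_pos (e%:C *: (1 - p)) by apply: posZ; [exact: ltW|exact: proj_pos].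
apply: sa_cnorm_le; first exact: ltW.
- by rewrite starB !starM sy sp starZr sp mulrA.
- have -> : e%:C *: 1 - (p * y * p - t%:C *: p) =
      e%:C *: (1 - p) + ((Re (psi y) + e)%:C *: p - p * y * p).
    by rewrite zE rmorphD /=; linear_identity R[i].
  exact: posD (psiy e e0).
- have -> : e%:C *: 1 + (p * y * p - t%:C *: p) =
      e%:C *: (1 - p) + ((Re (chi (- y)) + e)%:C *: p - p * - y * p).
    rewrite chiE mulrN mulNr !rmorphD /= rmorphN /=.
    by linear_identity R[i].
  exact: posD (chiy e e0).
Qed.

(** * Averaging over a subgroup, and unique ergodicity *)

Section Averages.
Variables (R : realType) (A : cstarAlgType R) (G : finGroupType).
Variables (alpha : cstar_action A G) (H : {group G}).
Implicit Types (a y : A) (g h : G).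

Let actH g : star_hom (alpha g) := cact_hom alpha g.
Let N : R[i] := #|H|%:R.
Let N0 : N != 0. Proof. by rewrite pnatr_eq0 -lt0n cardG_gt0. Qed.

Definition group_avg a := #|H|%:R^-1 *: \sum_(h in H) alpha h a.

Lemma group_avg_act g a : g \in H -> group_avg (alpha g a) = group_avg a.
Proof.
move=> gH; congr (_ *: _); rewrite [RHS](reindex_inj (mulIg g)) /=.
by apply: eq_big => [h|h _]; [rewrite groupMr|rewrite (cactM alpha h g)].
Qed.

Lemma act_group_avg g a : g \in H -> alpha g (group_avg a) = group_avg a.
Proof.
move=> gH; rewrite (star_homZ (actH g)) (star_hom_sum (actH g)); congr (_ *: _).
rewrite [RHS](reindex_inj (mulgI g)) /=.
by apply: eq_big => [h|h _]; [rewrite groupMl|rewrite (cactM alpha g h)].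
Qed.

Lemma group_avg_fixed a : fixed_points alpha H (group_avg a).
Proof. by move=> h hH; exact: act_group_avg. Qed.

Lemma group_avg_id a : fixed_points alpha H a -> group_avg a = a.
Proof.
move=> aH; rewrite /group_avg (eq_bigr (fun=> a)) => [|h hH]; last exact: aH.
by rewrite sumr_const -[a *+ _]scaler_nat scalerA mulVf// scale1r.
Qed.

Lemma group_avg_lin (z : R[i]) a y : group_avg (z *: a + y) = z *: group_avg a + group_avg y.
Proof.
rewrite /group_avg (eq_bigr (fun h => z *: alpha h a + alpha h y)) => [|h _].
  by rewrite big_split /= -scaler_sumr; linear_identity R[i].
exact: (star_hom_lin (actH h)).
Qed.

Lemma group_avg_pos a : is_pos a -> is_pos (group_avg a).
Proof.
move=> aP; have -> : group_avg a = #|H|%:R^-1%:C *: \sum_(h in H) alpha h a.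
  by rewrite fmorphV rmorph_nat.
by apply: posZ; rewrite ?invr_ge0//; apply: pos_sum => h _; exact: star_hom_pos.
Qed.

Lemma invariant_state_avg (om : A -> R[i]) : state om ->
  invariant_state alpha H (om \o group_avg).
Proof.
move=> [ol op o1]; split=> [|h a hH]; last by rewrite /= group_avg_act.
split=> [z x y|a aP|] /=; first by rewrite group_avg_lin ol.
  by apply/op/group_avg_pos.
by rewrite group_avg_id// => h _; rewrite (star_hom1 (actH h)).
Qed.

Lemma invariant_state_avgE f a : invariant_state alpha H f -> f (group_avg a) = f a.
Proof.
move=> [[fl fp f1] fH]; rewrite (pfunZ fl) (pfun_sum fl).
rewrite (eq_bigr (fun=> f a)) => [|h hH]; last exact: fH.
by rewrite sumr_const -[f a *+ _]mulr_natl mulKf.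
Qed.

Lemma fixed_points_scalars : scalars A `<=` fixed_points alpha H.
Proof.
by move=> _ [z _ <-] h _; rewrite (star_homZ (actH h)) (star_hom1 (actH h)).
Qed.

Lemma fixed_points_star a : fixed_points alpha H a -> fixed_points alpha H (star a).
Proof. by move=> aH h hH; rewrite (star_homS (actH h)) aH. Qed.

Lemma fixed_points_lin (z : R[i]) a y : fixed_points alpha H a ->
  fixed_points alpha H y -> fixed_points alpha H (z *: a + y).
Proof. by move=> aH yH h hH; rewrite (star_hom_lin (actH h)) aH// yH. Qed.

(* Invariant states are the states of the fixed point algebra. *)
Lemma uniquely_ergodicP : uniquely_ergodic alpha H <-> fixed_points alpha H = scalars A.
Proof.
split=> [[f0 [f0I f0U]]|fixE].
  apply/seteqP; split; last exact: fixed_points_scalars.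
  have sa y : star y = y -> fixed_points alpha H y -> y = f0 y *: 1.
    move=> sy yH; rewrite -[LHS](mulr1 y) -[LHS](mul1r (y * 1)) mulrA.
    apply: corner_unique => //; [exact: star1|exact: mulr1|exact: oner_neq0|].
    move=> psi [sp _] _; rewrite (f0U _ (invariant_state_avg sp)) /=.
    by rewrite group_avg_id.
  move=> a aH; exists (f0 (re_part a) + 'i%C * f0 (im_part a)) => //.
  have h0 : fixed_points alpha H 0 by move=> h _; rewrite (star_hom0 (actH h)).
  have reH y : fixed_points alpha H y -> fixed_points alpha H (re_part y).
    move=> yH; rewrite /re_part -(addr0 (_ *: _)); apply: fixed_points_lin => //.
    rewrite -{1}(scale1r y); apply: fixed_points_lin => //.
    exact: fixed_points_star.
  have imH : fixed_points alpha H (im_part a).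
    by apply: reH; rewrite -(addr0 (_ *: _)); apply: fixed_points_lin.
  rewrite scalerDl -scalerA -(sa (re_part a)) ?re_part_sa//; last exact: reH.
  by rewrite -(sa (im_part a)) ?re_part_sa// -re_im_part.
have [om sOm] := exists_state A; have [ol _ o1] := sOm.
exists (om \o group_avg); split=> [|f fI]; first exact: invariant_state_avg.
apply/funext => a /=; rewrite -(invariant_state_avgE a fI).
have : scalars A (group_avg a) by rewrite -fixE; exact: group_avg_fixed.
move=> [z _ <-]; have [[fl _ f1] _] := fI.
by rewrite (pfunZ ol) (pfunZ fl) o1 f1.
Qed.

End Averages.

Lemma subalg_val_hom (R : realType) (A : cstarAlgType R) (S : cstarSub A) :
  star_hom (@subalg_val R A S).
Proof. by split. Qed.

(** * The relative commutant and unique extension of pure states *)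

Section RelativeCommutant.
Variables (R : realType) (A : cstarAlgType R) (G : finGroupType).
Variables (alpha : cstar_action A G) (B : reduced_crossed_product alpha).
Local Notation C := (subalg (group_cstar B)).
Local Notation sv := (@subalg_val R B (group_cstar B)).
Local Notation unt := (@rcp_unit _ _ _ _ B).
Local Notation emb := (@rcp_emb _ _ _ _ B).
Variable ga : group_algebra G C.
Hypothesis ga_unitE : forall g, sv (ga_unit ga g) = unt g.
Implicit Types (b x y : B) (c : C) (g h : G).

Let actH g : star_hom (alpha g) := cact_hom alpha g.

Lemma sv_sum_unit c : sv c = \sum_g ga_coef ga c g *: unt g.
Proof.
rewrite {1}(ga_coefE ga c) (star_hom_sum (subalg_val_hom _)).
by apply: eq_bigr => g _; rewrite (star_homZ (subalg_val_hom _)) ga_unitE.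
Qed.

Lemma relative_commutant_unit b :
  relative_commutant (group_cstar B) b <-> forall h, b * unt h = unt h * b.
Proof.
split=> [bC h|bu x xC]; first by apply: bC; exact: group_cstar_unit.
have -> : x = sv (subalg_of xC) by [].
rewrite sv_sum_unit mulr_sumr mulr_suml; apply: eq_bigr => g _.
by rewrite -scalerAr -scalerAl bu.
Qed.

Lemma relative_commutantP b : relative_commutant (group_cstar B) b <->
  forall h g, cp_coef b (h * g * h^-1)%g = alpha h (cp_coef b g).
Proof.
rewrite relative_commutant_unit; split=> [bu h g|bh h].
  by rewrite -[LHS]cp_coef_unitr bu cp_coef_unitl mulKg.
apply: cp_coef_ext => g; rewrite cp_coef_unitr cp_coef_unitl -bh.
by rewrite mulKVg.
Qed.

Lemma relative_commutant_avg b :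
  relative_commutant (group_cstar B) (\sum_h unt h * b * unt h^-1%g).
Proof.
apply/relative_commutant_unit => l; rewrite mulr_suml mulr_sumr.
rewrite (reindex_inj (mulgI l)) /=; apply: eq_bigr => h _.
by rewrite !mulrA -unitM -!mulrA -unitM invMg mulgKV.
Qed.

Lemma relative_commutant_star b :
  relative_commutant (group_cstar B) b -> relative_commutant (group_cstar B) (star b).
Proof.
move=> bC c cC; rewrite -[c in LHS]starK -starM -bC; last exact: csV.
by rewrite starM starK.
Qed.

Lemma relative_commutant_lin (z : R[i]) x y : relative_commutant (group_cstar B) x ->
  relative_commutant (group_cstar B) y -> relative_commutant (group_cstar B) (z *: x + y).
Proof.
move=> xC yC c cC.
by rewrite mulrDl mulrDr -scalerAl -scalerAr xC// yC.
Qed.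

Definition commutant_trivial := relative_commutant (group_cstar B) `<=` cs_set (group_cstar B).

Lemma commutant_trivialP :
  relative_commutant (group_cstar B) = sub_center (group_cstar B) <-> commutant_trivial.
Proof.
split=> [E b|sub]; first by rewrite E => -[].
by apply/seteqP; split=> [b bC|b []//]; split=> //; exact: sub.
Qed.

Lemma commutant_trivial_sa :
  (forall b, star b = b -> relative_commutant (group_cstar B) b ->
     cs_set (group_cstar B) b) -> commutant_trivial.
Proof.
move=> sa b bC.
have C0 : relative_commutant (group_cstar B) 0 by move=> c _; rewrite mul0r mulr0.
have CZ (z : R[i]) x : relative_commutant (group_cstar B) x ->
    relative_commutant (group_cstar B) (z *: x).
  by move=> xC; rewrite -(addr0 (z *: x)); exact: relative_commutant_lin.
have re x : relative_commutant (group_cstar B) x -> cs_set (group_cstar B) (re_part x).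
  move=> xC; apply: sa; first exact: re_part_sa.
  apply: CZ; rewrite -{1}(scale1r x); apply: relative_commutant_lin => //.
  exact: relative_commutant_star.
rewrite (re_im_part b) addrC; apply: csP; last exact: re.
by apply: re; exact: CZ.
Qed.

Lemma commutant_trivial_fixed_points :
  commutant_trivial <-> forall g, fixed_points alpha 'C[g]%g = scalars A.
Proof.
split=> [triv g|fixE b /relative_commutantP bh]; last first.
  apply/group_cstarP => g.
  have : scalars A (cp_coef b g).
    rewrite -(fixE g) => h /cent1P hg; rewrite -bh hg mulgK //.
  by move=> [z _ <-]; exists z.
apply/seteqP; split; last exact: (@fixed_points_scalars _ _ _ alpha 'C[g]%G).
(* Only the [h] centralizing [g] contribute to the coefficient of this average at [g], and each
   contributes [a]. *)
move=> a aH; have /triv/group_cstarP/(_ g)[z] := relative_commutant_avg (emb a * unt g).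
have -> : cp_coef (\sum_h unt h * (emb a * unt g) * unt h^-1%g) g =
    \sum_(h in 'C[g]%g) a.
  rewrite cp_coef_sum [RHS]big_mkcond; apply: eq_bigr => h _.
  rewrite mulrA unit_emb -!mulrA -!unitM cp_coef_emb_unit mulgA.
  have -> : (h * g * h^-1 == g)%g = (h \in 'C[g]%g).
    apply/eqP/cent1P => [e|e]; first by rewrite /commute -{2}e mulgKV.
    by rewrite e mulgK.
  by case: ifP => // hC; rewrite aH.
rewrite sumr_const -scaler_nat => az.
have N0 : #|'C[g]%g|%:R != 0 :> R[i] by rewrite pnatr_eq0 -lt0n cardG_gt0.
exists (#|'C[g]%g|%:R^-1 * z) => //.
by rewrite -scalerA -az scalerA mulVf// scale1r.
Qed.

(* Compressing the average of [p b p] by a minimal projection [p] yields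
   [sum_h |phi (u h)|^2] times [p b p]. *)
Lemma commutant_trivial_corner (phi : C -> R[i]) (p : C) : commutant_trivial ->
    state phi -> star p = p -> p * p = p -> (forall c, p * c * p = phi c *: p) ->
  forall b, exists z : R[i], sv p * b * sv p = z *: sv p.
Proof.
move=> triv sphi sp pp pE b; have [pl ppos p1] := sphi.
pose q := sv p.
have qq : q * q = q by rewrite -(star_homM (subalg_val_hom _)) pp.
have qu h : q * unt h * q = phi (ga_unit ga h) *: q.
  rewrite -ga_unitE -!(star_homM (subalg_val_hom _)) pE.
  exact: (star_homZ (subalg_val_hom _)).
pose Z := \sum_h unt h * (q * b * q) * unt h^-1%g.
have ZC : cs_set (group_cstar B) Z by apply: triv; exact: relative_commutant_avg.
pose w := \sum_h `|phi (ga_unit ga h)| ^+ 2.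
have qZ : q * Z * q = w *: (q * b * q).
  rewrite mulr_sumr mulr_suml scaler_suml; apply: eq_bigr => h _.
  have -> : q * (unt h * (q * b * q) * unt h^-1%g) * q =
      (q * unt h * q) * b * (q * unt h^-1%g * q) by rewrite !mulrA.
  rewrite !qu -scalerAl -scalerAl -scalerAr scalerA -ga_unit_star (pfun_star pl ppos).
  by rewrite normCK.
have w1 : 1 <= w.
  by rewrite /w (bigD1 1%g)//= ga_unit1 p1 normr1 expr1n lerDl sumr_ge0.
have w0 : w != 0 by rewrite gt_eqF// (lt_le_trans ltr01).
exists (w^-1 * phi (subalg_of ZC)); rewrite -scalerA.
have <- : q * Z * q = phi (subalg_of ZC) *: q.
  transitivity (sv p * sv (subalg_of ZC) * sv p) => //.
  rewrite -!(star_homM (subalg_val_hom _)) pE.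
  exact: (star_homZ (subalg_val_hom _)).
by rewrite qZ scalerA mulVf// scale1r.
Qed.

Lemma state_restriction (psi : B -> R[i]) (phi : C -> R[i]) (p : C) : state psi ->
    star p = p -> p * p = p -> (forall c, p * c * p = phi c *: p) ->
    psi (sv p) = 1 -> psi \o sv = phi.
Proof.
move=> spsi sp pp pE psip; apply/funext => c /=; have [pl _ _] := spsi.
have hom := subalg_val_hom (group_cstar B).
rewrite (state_corner spsi _ _ psip) -?(star_homS hom) ?sp// -?(star_homM hom) ?pp//.
by rewrite pE (star_homZ hom) (pfunZ pl) psip mulr1.
Qed.

Lemma commutant_trivial_PEP : commutant_trivial -> PEP (group_cstar B).
Proof.
move=> triv phi phiP; have [sphi _] := phiP.
have hom := subalg_val_hom (group_cstar B).
have [p [sp pp p0 phip pE]] := pure_state_projection ga phiP.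
have sq : star (sv p) = sv p by rewrite -(star_homS hom) sp.
have qq : sv p * sv p = sv p by rewrite -(star_homM hom) pp.
have q0 : sv p != 0.
  apply: contraNneq p0 => e; apply/eqP/val_inj.
  by rewrite /= e; exact/esym/(star_hom0 hom).
have [psi [psiP psip _]] := corner_state sq qq q0 (star0 _).
have [spsi _] := psiP.
exists psi; split; first by split=> //; exact: (state_restriction spsi sp pp pE psip).
move=> chi [[schi _] chiE]; apply/funext => b.
have chip : chi (sv p) = 1 by rewrite -phip -chiE.
rewrite (state_corner spsi sq qq psip) (state_corner schi sq qq chip).
have [z ->] := commutant_trivial_corner triv sphi sp pp pE b.
have [[pl _ _] [cl _ _]] := (spsi, schi).
by rewrite (pfunZ pl) (pfunZ cl) psip chip.
Qed.

Lemma PEP_AEP : PEP (group_cstar B) -> AEP (group_cstar B).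
Proof. by move=> pep phi phiP; apply: subset_closure; split=> //; exact: pep. Qed.

(** Every pure state of B with value 1 at [p] extends [phi], so all of them agree at [y] and
    [corner_unique] applies. *)
Lemma unique_extension_corner (phi : C -> R[i]) (p : C) :
    unique_pure_extension phi -> star p = p -> p * p = p -> p != 0 ->
    (forall c, p * c * p = phi c *: p) ->
  forall y, star y = y -> exists z : R[i], sv p * y * sv p = z *: sv p.
Proof.
move=> [psi0 [_ psiU]] sp pp p0 pE y sy.
have hom := subalg_val_hom (group_cstar B).
exists (psi0 y); apply: corner_unique => //.
- by rewrite -(star_homS hom) sp.
- by rewrite -(star_homM hom) pp.
move=> psi psiP psip; rewrite (psiU psi)//; split=> //.
by case: psiP => spsi _; exact: (state_restriction spsi sp pp pE psip).
Qed.

End RelativeCommutant.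

(** * A pure state vanishing on the ideal J, and the AEP *)

Section CommutantState.
Variables (R : realType) (A : cstarAlgType R) (G : finGroupType).
Variables (alpha : cstar_action A G) (B : reduced_crossed_product alpha).
Local Notation C := (subalg (group_cstar B)).
Local Notation sv := (@subalg_val R B (group_cstar B)).
Variable ga : group_algebra G C.
Hypothesis ga_unitE : forall g, sv (ga_unit ga g) = rcp_unit B g.
Implicit Types (c p : C) (g h : G).

Let hom : star_hom sv := subalg_val_hom _.

Section Witness.
Variable b : B.
Hypothesis sb : star b = b.
Hypothesis bC : relative_commutant (group_cstar B) b.
Hypothesis bnC : ~ cs_set (group_cstar B) b.

(* A proper two-sided ideal of C. *)
Let J c := cs_set (group_cstar B) (b * sv c).

Let J_lin (z : R[i]) c d : J c -> J d -> J (z *: c + d).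
Proof.
by move=> Jc Jd; rewrite /J (star_hom_lin hom) mulrDr -scalerAr; exact: csP.
Qed.
Let J0 : J 0.
Proof.
rewrite /J (star_hom0 hom) mulr0 -(star_hom0 hom); exact: subalgP.
Qed.
Let JZ (z : R[i]) c : J c -> J (z *: c).
Proof. by move=> Jc; rewrite -(addr0 (z *: c)); exact: J_lin. Qed.
Let JN c : J c -> J (- c).
Proof. by move=> Jc; rewrite -scaleN1r; exact: JZ. Qed.
Let JD c d : J c -> J d -> J (c + d).
Proof. by move=> Jc Jd; rewrite -(scale1r c); exact: J_lin. Qed.
Let J_mull c d : J d -> J (c * d).
Proof.
move=> Jd; rewrite /J (star_homM hom) mulrA bC; last exact: subalgP.
rewrite -mulrA.
by apply: csM => //; exact: subalgP.
Qed.
Let J_star c : J c -> J (star c).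
Proof.
rewrite /J (star_homS hom) => /csV; rewrite starM sb bC //.
by rewrite -(star_homS hom); exact: subalgP.
Qed.
Let J1 : ~ J 1.
Proof. by rewrite /J (star_hom1 hom) mulr1. Qed.

(* An invertible element of J would put the unit in J; the inverse is avoided
   through the powers of [x = 1 - j / t], of norm less than 1. *)
Let J_not_bounded_below c (r : R) : J c -> 0 < r -> ~ is_pos (c - r%:C *: 1).
Proof.
move=> Jc r0 cr; apply: bnC; pose t := cnorm c + r.
have t0 : 0 < t by have := cnorm_ge0 c; rewrite /t; lra.
have sc : star c = c.
  by have := pos_sa cr; rewrite starB starZr star1 => /addIr.
pose x := 1 - t^-1%:C *: c.
have tt : t%:C * t^-1%:C = 1 :> R[i] by rewrite -rmorphM /= mulfV ?gt_eqF.
have tt' : t^-1%:C * t%:C = 1 :> R[i] by rewrite mulrC.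
have xP : is_pos x.
  have -> : x = t^-1%:C *: (t%:C *: 1 - c).
    by rewrite /x scalerBr scalerA tt' scale1r.
  apply: posZ; first by rewrite invr_ge0 ltW.
  by apply: pos_le_sub => //; rewrite /t; lra.
pose theta := 1 - r / t.
have theta01 : 0 <= theta < 1.
  have rt : r / t <= 1.
    by rewrite ler_pdivrMr// mul1r /t; have := cnorm_ge0 c; lra.
  have : 0 < r / t by rewrite divr_gt0.
  by rewrite /theta => ?; apply/andP; split; lra.
have /andP[theta0 theta1] := theta01.
have nx : cnorm x <= theta.
  apply: cnorm_pos_le => //.
  have -> : theta%:C *: 1 - x = t^-1%:C *: (c - r%:C *: 1).
    rewrite /theta /x rmorphB rmorphM rmorph1 /=.
    by linear_identity R[i].
  by apply: posZ => //; rewrite invr_ge0 ltW.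
have nxX n : cnorm (x ^+ n) <= theta ^+ n.
  elim: n => [|n IHn]; first by rewrite cnorm1.
  rewrite !exprS (le_trans (ler_cnormM _ _))//.
  by rewrite ler_pM ?cnorm_ge0.
have Jx n : J (1 - x ^+ n).
  elim: n => [|n IHn]; first by rewrite subrr.
  have -> : 1 - x ^+ n.+1 = (1 - x ^+ n) + x ^+ n * (t^-1%:C *: c).
    rewrite exprSr {2}/x; move: (x ^+ n) => w.
    by expand_products; linear_identity R[i].
  by apply: JD => //; apply: J_mull; exact: JZ.
apply: cs_closed => e e0; have b0 := cnorm_ge0 b.
have /cvgrPdist_lt /(_ (e / (cnorm b + 1))) : theta ^+ n @[n --> \oo] --> (0 : R).
  by apply: cvg_expr; rewrite ger0_norm.
have bp : 0 < cnorm b + 1 by lra.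
case; first by rewrite divr_gt0.
move=> N _ /(_ N (leqnn N)); rewrite /= sub0r normrN ger0_norm ?exprn_ge0// => thN.
exists (b * sv (1 - x ^+ N)); first exact: Jx.
have -> : b - b * sv (1 - x ^+ N) = b * sv (x ^+ N).
  by rewrite (star_homB hom) (star_hom1 hom) mulrBr mulr1 opprB addrC subrK.
rewrite (le_lt_trans (ler_cnormM _ _))//.
apply: (@le_lt_trans _ _ ((cnorm b + 1) * theta ^+ N)).
  apply: ler_pM => //; rewrite ?cnorm_ge0//; [lra|exact: nxX].
by rewrite mulrC -ltr_pdivlMr.
Qed.

(** [V] is J plus the scalars, and [s] is the functional on it that kills J and fixes the scalars;
    it is well defined since J is proper. *)
Let V c := exists z : R[i], J (c - z *: 1).
Let s c : R[i] := xget 0 [set z | J (c - z *: 1)].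

Let sE c z : J (c - z *: 1) -> s c = z.
Proof.
move=> Jz; apply: xget_unique => //= w Jw; apply/eqP; rewrite -subr_eq0.
apply/negPn/negP => zw; apply: J1.
have -> : (1 : C) = (w - z)^-1 *: ((c - z *: 1) - (c - w *: 1)).
  have -> : (c - z *: 1) - (c - w *: 1) = (w - z) *: 1 by linear_identity R[i].
  by rewrite scalerA mulVf// scale1r.
by apply/JZ/JD => //; exact: JN.
Qed.

Let V_lin (z : R[i]) c d : V c -> V d -> V (z *: c + d).
Proof.
move=> [v Jc] [w Jd]; exists (z * v + w).
have -> : z *: c + d - (z * v + w) *: 1 = z *: (c - v *: 1) + (d - w *: 1).
  by linear_identity R[i].
exact: J_lin.
Qed.

(** [s] is positive because [j + z >= 0] with [z < 0] would bound [j] in J below by [- z > 0]. An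
    extreme positive extension is then pure among all states. *)
Lemma commutant_state : exists2 phi : C -> R[i], pure_state phi &
  forall c, cs_set (group_cstar B) (b * sv c) -> phi c = 0.
Proof.
have [|||||||||||||F [[Fl FE Fp] _ xF]] := @krein_extension _ _
    (@star R C) (@is_pos R C) V s 1 _ _ _ _ _ _ _ _ _ _ _ _ _ 0 (star0 _).
- by move=> a x y; rewrite starD starZ.
- exact: starK.
- exact: pos0.
- exact: posD.
- by move=> t x /ltW; exact: posZ.
- exact: V_lin.
- move=> c [z Jz]; exists z^*%R.
  by rewrite -(star1 C) -starZ -starB; exact: J_star.
- move=> z c d [v Jc] [w Jd]; rewrite (sE Jc) (sE Jd); apply: sE.
  have -> : z *: c + d - (z * v + w) *: 1 = z *: (c - v *: 1) + (d - w *: 1).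
    by linear_identity R[i].
  exact: J_lin.
- move=> c [z Jz] sc cP; rewrite (sE Jz).
  have zr : z^*%R = z.
    rewrite -(sE Jz); apply/esym/sE.
    by rewrite -{1}sc -(star1 C) (sE Jz) -starZ -starB; exact: J_star.
  have [r zE] : exists r, z = r%:C by apply/complex_realP; rewrite CrealE zr.
  rewrite {}zE in Jz zr *; rewrite ler0c leNgt; apply/negP => r0.
  apply: (J_not_bounded_below Jz (_ : 0 < - r)); first by rewrite oppr_gt0.
  by rewrite rmorphN /= scaleNr opprK subrK.
- by exists 1; rewrite scale1r subrr.
- exact: star1.
- by rewrite -(mulr1 1) -{1}(star1 C); exact: pos_star_mul.
- by move=> x sx; exists (cnorm x); exact: pos_cnorm_sub.
have FJ c : J c -> F c = 0.
  move=> Jc; have Jc0 : J (c - 0 *: 1) by rewrite scale0r subr0.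
  by rewrite FE ?(sE Jc0)//; exists 0.
have F1 : F 1 = 1.
  have J11 : J (1 - 1 *: 1) by rewrite scale1r subrr.
  by rewrite FE ?(sE J11)//; exists 1.
have sF : state F by split=> // a aP; apply: Fp => //; exact: pos_sa.
(* Components of [F] extend [s] as well: [t f (j^* j) <= F (j^* j) = 0] for [j] in J, so [f j = 0]
   by Cauchy-Schwarz. *)
have ext (f g : C -> R[i]) (t : R) : state f -> state g -> 0 < t < 1 ->
    (forall a, F a = t%:C * f a + (1 - t)%:C * g a) ->
    positive_extension (@star R C) (@is_pos R C) V s f.
  move=> [fl fp f1] [gl gp g1] /andP[t0 t1] fg; split=> // [c [z Jz]|c _ cP].
    rewrite (sE Jz) -{1}(subrK (z *: 1) c) (pfunD fl) (pfunZ fl) f1 mulr1.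
    suff -> : f (c - z *: 1) = 0 by rewrite add0r.
    set j := c - z *: 1 in Jz *.
    rewrite -(mul1r j) -(star1 C); apply: (pfun_null fl fp).
    have := fg (star j * j); rewrite FJ; last exact: J_mull.
    have := fp _ (pos_star_mul j); have := gp _ (pos_star_mul j).
    move=> g0 f0 /esym/eqP; rewrite paddr_eq0; last 2 first.
    - by rewrite mulr_ge0// ler0c ltW.
    - by rewrite mulr_ge0// ler0c subr_ge0 ltW.
    by rewrite mulf_eq0 fmorph_eq0 (gt_eqF t0) /= => /andP[/eqP].
  exact: fp.
exists F => //; split=> // f g t sf sg t01 fg.
have /andP[t0 t1] := t01.
have t01' : 0 < 1 - t < 1 by apply/andP; split; lra.
have gf a : F a = (1 - t)%:C * g a + (1 - (1 - t))%:C * f a.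
  by rewrite fg !rmorphB /= rmorph1; ring.
have ef := ext _ _ _ sf sg t01 fg; have eg := ext _ _ _ sg sf t01' gf.
by split; apply/funext; [exact: (xF _ _ _ ef eg t01 fg)|exact: (xF _ _ _ eg ef t01' gf)].
Qed.

End Witness.

(** The trace of [p = p^* p] is the sum of the squared moduli of its coefficients, and is at most
    the trace of 1. *)
Lemma proj_coef_le1 p g : star p = p -> p * p = p -> `|ga_coef ga p g| <= 1.
Proof.
move=> sp pp; have [s1 p1] := proj_compl sp pp.
have : trace ga (1 - p) >= 0 by apply: trace_pos; exact: proj_pos.
have tr1 : trace ga 1 = 1 by rewrite /trace -(ga_unit1 ga) ga_coef_unit eqxx.
rewrite (pfunB (@trace_scalar _ _ _ ga)) tr1 subr_ge0.
have -> : trace ga p = trace ga (star p * p) by rewrite sp pp.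
rewrite trace_gram (bigD1 g)//= => h.
have : `|ga_coef ga p g| ^+ 2 <= 1.
  by apply: le_trans h; rewrite lerDl sumr_ge0.
by rewrite expr_le1.
Qed.

Lemma AEP_commutant_trivial : AEP (group_cstar B) -> commutant_trivial B.
Proof.
move=> aep; apply: commutant_trivial_sa => b sb bC; apply: contrapT => bnC.
have [phi phiP phiJ] := commutant_state sb bC bnC.
(* Since the [#|G|] coefficients of [p] have modulus at most 1, [eps]-closeness on the unitaries
   gives [|phi p - phi' p| <= 1/2]. But [p] lies in J, so [phi p = 0], whereas [phi' p = 1]. *)
pose eps : R := (#|G|%:R)^-1 / 2.
have G0 : 0 < #|G|%:R :> R by rewrite ltr0n -cardsT cardG_gt0.
have eps0 : 0 < eps by rewrite divr_gt0// invr_gt0.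
pose U : set {ptws C -> (R[i]^o : topologicalType)} :=
  [set f | forall g, `|phi (ga_unit ga g) - f (ga_unit ga g)| < eps%:C].
have nU : nbhs (phi : {ptws C -> (R[i]^o : topologicalType)}) U.
  have nUg g : nbhs (phi : {ptws C -> (R[i]^o : topologicalType)})
      [set f | `|phi (ga_unit ga g) - f (ga_unit ga g)| < eps%:C].
    have e0 : 0 < eps%:C by rewrite ltcR.
    have /(_ phi) := @proj_continuous C (fun=> R[i]^o : topologicalType) (ga_unit ga g).
    move=> /(_ _ (nbhsx_ballx (phi (ga_unit ga g) : R[i]^o) _ e0)).
    by rewrite -ball_normE.
  exact: (@filter_forall _ G
    (fun g (f : {ptws C -> (R[i]^o : topologicalType)}) =>
       `|phi (ga_unit ga g) - f (ga_unit ga g)| < eps%:C) _ _ nUg).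
have [phi' [[phi'P ext] phi'U]] := aep phi phiP U nU.
have [p [sp pp p0 phi'p pE]] := pure_state_projection ga phi'P.
have [z zE] := unique_extension_corner ext sp pp p0 pE sb.
have pJ : phi p = 0.
  apply: phiJ; have -> : b * sv p = sv p * b * sv p.
    by rewrite -(bC _ (subalgP p)) -mulrA -(star_homM hom) pp.
  by rewrite zE -(star_homZ hom); exact: subalgP.
have [[pl _ _] _] := phiP; have [[pl' _ _] _] := phi'P.
have : `|phi p - phi' p| < 1.
  rewrite (ga_coefE ga p) (pfun_sum pl) (pfun_sum pl') -sumrB.
  apply: (le_lt_trans (ler_norm_sum _ _ _)).
  apply: (@le_lt_trans _ _ (\sum_(g : G) eps%:C)).
    apply: ler_sum => g _; rewrite (pfunZ pl) (pfunZ pl') -mulrBr normrM.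
    rewrite -[leRHS]mul1r ler_pM//; first exact: proj_coef_le1.
    exact/ltW/phi'U.
  rewrite sumr_const -rmorphMn /= -[1 : R[i]]/(1%:C) ltcR.
  rewrite -mulr_natl /eps mulrA divff ?gt_eqF// mul1r invf_lt1//.
  by rewrite ltr1n.
by rewrite pJ phi'p sub0r normrN normr1 ltxx.
Qed.

End CommutantState.

Lemma proj_cnorm1 (R : realType) (D : cstarAlgType R) (p : D) :
  star p = p -> p * p = p -> p != 0 -> cnorm p = 1.
Proof.
move=> sp pp p0; have n0 : cnorm p != 0 by apply: contra_neq p0 => /cnorm0_eq0.
by apply: (mulfI n0); rewrite mulr1 -expr2 -cnorm_sqr// pp.
Qed.

(** * Aperiodicity *)

Section CornerHereditary.
Variables (R : realType) (D : cstarAlgType R) (p : D).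
Hypothesis sp : star p = p.
Hypothesis pp : p * p = p.

Lemma corner_hereditary : hereditary [set x : D | p * x * p = x].
Proof.
have pl x : p * x * p = x -> p * x = x by move=> <-; rewrite !mulrA pp.
have pr x : p * x * p = x -> x * p = x by move=> <-; rewrite -!mulrA pp.
split; first split=> /=.
- by rewrite mulr0 mul0r.
- by move=> a x y Dx Dy; rewrite mulrDr mulrDl -scalerAr -scalerAl Dx Dy.
- by move=> x y /pl Dx /pr Dy; rewrite mulrA Dx -mulrA Dy.
- by move=> x Dx; rewrite -{2}Dx !starM sp mulrA.
- move=> x xD; apply: (@cnorm_dist_le _ _ 2) => e /xD[y /= Dy xye].
  have -> : p * x * p - x = p * (x - y) * p - (x - y).
    by rewrite mulrBr mulrBl Dy; linear_identity R[i].
  rewrite (le_trans (cnorm_sub _ _))//.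
  have p1 := proj_le1 sp pp; have n0 := cnorm_ge0 (x - y).
  have : cnorm (p * (x - y) * p) <= cnorm (x - y).
    rewrite (le_trans (ler_cnormM _ _))// -[leRHS]mulr1 ler_pM ?cnorm_ge0//.
    by rewrite (le_trans (ler_cnormM _ _))// -[leRHS]mul1r ler_wpM2r.
  lra.
(* Compressing [0 <= a <= b] by [1 - p] kills [b], hence [a]; writing [a = k^* k] then gives
   [k (1 - p) = 0]. *)
move=> a b aP bP /= Db; have [sq _] := proj_compl sp pp.
have [k ak] := aP.
have kq : k * (1 - p) = 0.
  apply: star_mul_eq0; rewrite starM -mulrA [star k * _]mulrA -ak mulrA.
  apply: pos_anti; first exact: pos_conj.
  have qbq : star (1 - p) * b * (1 - p) = 0.
    by rewrite sq mulrBl mul1r (pl b Db) subrr mul0r.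
  rewrite -[- _]add0r -qbq -mulrBl -mulrBr; exact: pos_conj.
have ap : a * p = a.
  apply/eqP; rewrite eq_sym -subr_eq0; apply/eqP.
  by rewrite -[X in X - _]mulr1 -mulrBr ak -mulrA kq mulr0.
have pa : p * a = a by rewrite -{1}(pos_sa aP) -{1}sp -starM ap pos_sa.
by rewrite pa ap.
Qed.
End CornerHereditary.

Section Aperiodic.
Variables (R : realType) (A : cstarAlgType R) (G : finGroupType).
Variables (alpha : cstar_action A G) (B : reduced_crossed_product alpha).
Local Notation C := (subalg (group_cstar B)).
Local Notation sv := (@subalg_val R B (group_cstar B)).
Variable ga : group_algebra G C.
Hypothesis ga_unitE : forall g, sv (ga_unit ga g) = rcp_unit B g.
Implicit Types (c p : C) (g h : G).

Let hom : star_hom sv := subalg_val_hom _.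

(** For a minimal projection [p] the hereditary subalgebra [p C p] is [C p], whose only positive
    element of norm 1 is [p]. So [p b p = b p] is a limit of elements of C, which puts [p] in J
    although [phi p = 1]. *)
Lemma aperiodic_commutant_trivial : aperiodic (group_cstar B) -> commutant_trivial B.
Proof.
move=> ap; apply: commutant_trivial_sa => b sb bC; apply: contrapT => bnC.
have [phi phiP phiJ] := commutant_state sb bC bnC.
have [p [sp pp p0 phip pE]] := pure_state_projection ga phiP.
have [[pl ppos p1] _] := phiP.
suff : phi p = 0 by rewrite phip => /eqP; rewrite oner_eq0.
apply: phiJ; have -> : b * sv p = sv p * b * sv p.
  by rewrite -(bC _ (subalgP p)) -mulrA -(star_homM hom) pp.
apply: cs_closed => e e0.
have [|d [c [/= Dd dP d1 dc]]] := ap b _ e (corner_hereditary sp pp) _ e0.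
  by exists p => //=; rewrite pp pp.
have dp : d = p.
  have := Dd; rewrite pE => dE; have r0 := ppos _ dP.
  have rE : phi d = (Re (phi d))%:C by apply: pfun_sa => //; exact: pos_sa.
  rewrite -dE rE; suff -> : Re (phi d) = 1 by rewrite scale1r.
  move: d1; rewrite -{1}dE rE cnormZr (proj_cnorm1 sp pp p0) mulr1 ger0_norm//.
  by rewrite -ler0c -rE.
exists (sv c); first exact: (subalgP c).
by rewrite -dp.
Qed.

(** Any nonzero hereditary [D] contains a minimal projection: take [h] positive of norm 1 in [D] and
    the projection [p] of a pure state with value 1 at [h]. Then [h p = p], so [p <= h^2] and [p] is
    in [D]; moreover [p b p] is exactly a multiple of [p]. *)
Lemma commutant_trivial_aperiodic : commutant_trivial B -> aperiodic (group_cstar B).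
Proof.
move=> triv b D e [[D0 D_lin D_mul D_star D_closed] D_hered] [d0 Dd0 d0N] e0.
have n0 : 0 < cnorm d0.
  by rewrite lt_def cnorm_ge0 andbT; apply: contra_neq d0N => /cnorm0_eq0.
pose h := (cnorm d0 ^- 2)%:C *: (star d0 * d0).
have Dh : D h by rewrite /h -(addr0 (_ *: _)); apply: D_lin => //; apply/D_mul/Dd0/D_star.
have hP : is_pos h by apply: posZ; [rewrite invr_ge0 sqr_ge0|exact: pos_star_mul].
have sh := pos_sa hP.
have h1 : cnorm h = 1.
  rewrite /h cnormZr cnorm_starM ger0_norm ?invr_ge0 ?sqr_ge0// mulVf//.
  by rewrite expf_eq0/= gt_eqF.
have [||||psi [psiP _ psih]] := @corner_state R C 1 h.
- exact: star1.
- exact: mulr1.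
- exact: oner_neq0.
- exact: sh.
have [spsi _] := psiP; have [pl ppos p1] := spsi.
have onehP : is_pos (1 - h).
  have -> : 1 - h = (cnorm h)%:C *: 1 - h by rewrite h1 scale1r.
  exact: pos_cnorm_sub.
have psih1 : psi h = 1.
  have hr : psi h = (Re (psi h))%:C by apply: pfun_sa.
  have := ppos _ onehP; rewrite pfunB// p1 hr -[1 : R[i]]/(1%:C) -rmorphB ler0c /= => le1.
  congr (_%:C); apply/le_anti/andP; split; first lra.
  apply/ler_addgt0Pr => eps eps0; rewrite -h1; apply: cnorm_pos_le => //.
    have := ppos _ hP; rewrite hr ler0c /=; lra.
  by have := psih eps eps0; rewrite mul1r mulr1.
have [p [sp pp p0 psip pE]] := pure_state_projection ga psiP.
have [k [sk kE _]] := pos_sqrt onehP.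
have kp : k * p = 0.
  apply: star_mul_eq0; rewrite starM sk sp mulrA -(mulrA p) -kE pE pfunB// p1 psih1.
  by rewrite subrr scale0r.
have hp : h * p = p.
  have : (1 - h) * p = 0 by rewrite kE -mulrA kp mulr0.
  by rewrite mulrBl mul1r => /eqP; rewrite subr_eq0 => /eqP.
have ph : p * h = p by rewrite -{1}sp -{1}sh -starM hp.
have Dp : D p.
  apply: (D_hered _ (h * h)); [exact: proj_pos| |exact: D_mul].
  have [sq qq] := proj_compl sp pp.
  have -> : h * h - p = star ((1 - p) * h) * ((1 - p) * h).
    rewrite starM sq sh mulrA -(mulrA h) qq.
    by rewrite mulrBr mulr1 mulrBl hp ph.
  exact: pos_star_mul.
have [z zE] := commutant_trivial_corner ga_unitE triv spsi sp pp pE b.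
exists p, (z *: p); split=> //; first exact: proj_pos.
  exact: proj_cnorm1.
by rewrite zE (star_homZ hom) subrr cnorm0.
Qed.

End Aperiodic.

(** * Conditional expectations *)

Section UcpModule.
Variables (R : realType) (D C : cstarAlgType R) (E : D -> C).
Hypothesis E_ucp : ucp E.

Lemma ucpP : [/\ E 1 = 1, forall (a : R[i]) x y, E (a *: x + y) = a *: E x + E y
  & forall n (X : 'M[D]_n), mx_pos X -> mx_pos (map_mx E X)].
Proof. by case: E_ucp => _ E1 El Ep; split=> // [a x y|n X]; [exact: El|exact: Ep]. Qed.

Lemma ucpD x y : E (x + y) = E x + E y.
Proof. by have [_ El _] := ucpP; rewrite -{1}(scale1r x) El scale1r. Qed.

Lemma ucp0 : E 0 = 0.
Proof. by apply: (@addrI _ (E 0)); rewrite -ucpD !addr0. Qed.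

Lemma ucp_sum I (r : seq I) (P : pred I) (F : I -> D) :
  E (\sum_(i <- r | P i) F i) = \sum_(i <- r | P i) E (F i).
Proof. exact: (big_morph _ ucpD ucp0). Qed.

Let gram3 (r : 'rV[D]_3) : mx_pos (map_mx E (adjmx r *m r)).
Proof. by have [_ _ Ep] := ucpP; apply/Ep/mx_posP/form_pos_gram. Qed.

Let gram3E (r : 'rV[D]_3) i j : map_mx E (adjmx r *m r) i j = E (star (r 0 i) * r 0 j).
Proof. by rewrite mxE mxE big_ord1 adjmxE. Qed.

Lemma ucp_star x : E (star x) = star (E x).
Proof.
have /mx_posP/form_pos_adj T := gram3 (\row_j nth 0 [:: 1; x; 0] j).
have := congr1 (fun M : 'M[C]_3 => M 1 0) T.
by rewrite adjmxE !gram3E !mxE /= star1 mul1r mulr1.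
Qed.

(* The Gram matrix of the row (1, star w, star x) has a null vector after applying E. *)
Lemma ucp_unitary_module w x : w * star w = 1 -> E w * star (E w) = 1 ->
  E (x * star w) = E x * star (E w).
Proof.
move=> ww EwEw; pose r : 'rV[D]_3 := \row_j nth 0 [:: 1; star w; star x] j.
have [Z TZ] := gram3 r.
pose v : 'cV[C]_3 := \col_j nth 0 [:: star (E w); -1; 0] j.
set T := map_mx E _ in TZ.
have Tv i : (T *m v) i 0 = E (star (r 0 i)) * star (E w) - E (star (r 0 i) * star w).
  rewrite mxE !big_ord_recl big_ord0 addr0 !gram3E !mxE /=.
  by rewrite !mulr0 addr0 mulr1 mulrN1.
have [E1 _ _] := ucpP.
have Tv0 : mx_form T v = 0.
  rewrite /mx_form -mulmxA mxE !big_ord_recl big_ord0 addr0 !Tv !adjmxE !mxE /=.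
  rewrite star1 starK E1 !mul1r ucp_star subrr mulr0 add0r.
  by rewrite !starK ww E1 EwEw subrr mulr0 star0 mul0r addr0.
have Zv i : (Z *m v) i 0 = 0.
  apply: star_mul_eq0; move: i; apply: pos_sum_eq0 => [i|]; first exact: pos_star_mul.
  by rewrite -mx_form_gram -Tv0 TZ.
have : (T *m v) (lift 0 (lift 0 0)) 0 = 0.
  rewrite TZ -mulmxA mxE big1// => i _; by rewrite Zv mulr0.
rewrite Tv !mxE /= starK => /eqP; rewrite subr_eq0 => /eqP ->.
by [].
Qed.

End UcpModule.

Lemma star_hom_ucp_comp (R : realType) (D C I : cstarAlgType R) (E : D -> C) (f : C -> I) :
  ucp E -> star_hom f -> ucp (f \o E).
Proof.
move=> E_ucp f_hom; have [E1 El Ep] := ucpP E_ucp; split=> //.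
- by rewrite /= E1 (star_hom1 f_hom).
- by move=> a x y _ _; rewrite /= El (star_hom_lin f_hom).
- move=> n X _ /Ep[Y YE]; exists (map_mx f Y); rewrite map_mx_comp YE.
  apply/matrixP => i j; rewrite !mxE (star_hom_sum f_hom); apply: eq_bigr => k _.
  by rewrite !mxE (star_homM f_hom) (star_homS f_hom).
Qed.

Section ConditionalExpectation.
Variables (R : realType) (A : cstarAlgType R) (G : finGroupType).
Variables (alpha : cstar_action A G) (B : reduced_crossed_product alpha).
Local Notation C := (subalg (group_cstar B)).
Local Notation sv := (@subalg_val R B (group_cstar B)).
Local Notation unt := (@rcp_unit _ _ _ _ B).
Variable ga : group_algebra G C.
Hypothesis ga_unitE : forall g, sv (ga_unit ga g) = unt g.
Local Notation u := (ga_unit ga).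
Implicit Types (b x y : B) (c p : C) (g h : G).

Let hom : star_hom sv := subalg_val_hom _.
Let actH g : star_hom (alpha g) := cact_hom alpha g.

Definition cond_exp (E : B -> C) := ucp E /\ forall c, E (sv c) = c.

Section Bimodule.
Variable E : B -> C.
Hypothesis E_ce : cond_exp E.
Let E_ucp : ucp E. Proof. by case: E_ce. Qed.
Let Eunit g : E (unt g) = u g.
Proof. by rewrite -ga_unitE; case: E_ce => _ ->. Qed.

Lemma cond_exp_unitr b g : E (b * unt g) = E b * u g.
Proof.
have st : star (unt g^-1%g) = unt g by rewrite unit_star invgK.
have st' : star (u g^-1%g) = u g by rewrite ga_unit_star invgK.
rewrite -st -st' -Eunit; apply: ucp_unitary_module => //.
  by rewrite st -unitM mulVg unit1.
by rewrite Eunit st' -ga_unitM mulVg ga_unit1.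
Qed.

Lemma cond_exp_unitl b g : E (unt g * b) = u g * E b.
Proof.
rewrite -(starK (unt g * b)) (ucp_star E_ucp) starM unit_star cond_exp_unitr.
by rewrite starM -(ucp_star E_ucp) starK ga_unit_star invgK.
Qed.

Lemma cond_exp_sub b : star (E b) = E (star b).
Proof. by rewrite (ucp_star E_ucp). Qed.

End Bimodule.

Lemma cond_exp_unique E1 E2 : commutant_trivial B ->
  cond_exp E1 -> cond_exp E2 -> E1 = E2.
Proof.
move=> triv ce1 ce2.
have G0 : #|G|%:R != 0 :> R[i] by rewrite pnatr_eq0 -lt0n -cardsT cardG_gt0.
have tr_avg E b : cond_exp E -> #|G|%:R * trace ga (E b) =
    trace ga (E (\sum_h unt h * b * unt h^-1%g)).
  move=> ce; have [E_ucp _] := ce; rewrite (ucp_sum E_ucp).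
  rewrite (pfun_sum (@trace_scalar _ _ _ ga)) (eq_bigr (fun=> trace ga (E b))).
    by rewrite sumr_const mulr_natl.
  move=> h _; rewrite cond_exp_unitr// cond_exp_unitl// traceC mulrA -ga_unitM.
  by rewrite mulVg ga_unit1 mul1r.
have tr_eq b : trace ga (E1 b) = trace ga (E2 b).
  apply: (mulfI G0); rewrite !tr_avg//.
  have ZC := triv _ (relative_commutant_avg ga_unitE b).
  have [[_ e1] [_ e2]] := (ce1, ce2).
  by have := e1 (subalg_of ZC); rewrite /= => ->; have := e2 (subalg_of ZC); rewrite /= => ->.
apply/funext => b; apply: (coef_ext (b := ga)) => g.
have tr_coef E : cond_exp E -> ga_coef ga (E b) g = trace ga (E (b * unt g^-1%g)).
  move=> ce; rewrite cond_exp_unitr// /trace coef_uMr invgK mul1g //.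
by rewrite !tr_coef.
Qed.

Section StateExpectation.
Variable phi : A -> R[i].
Hypothesis phi_inv : invariant_state alpha [set: G] phi.

Let phi_lin : scalar phi. Proof. by case: phi_inv => -[]. Qed.
Let phi_pos a : is_pos a -> 0 <= phi a. Proof. by case: phi_inv => -[_ + _] _; apply. Qed.
Let phi1 : phi 1 = 1. Proof. by case: phi_inv => -[]. Qed.
Let phi_act g a : phi (alpha g a) = phi a.
Proof. by case: phi_inv => _; apply; rewrite inE. Qed.

Definition state_exp b : C := \sum_g phi (cp_coef b g) *: u g.

Lemma state_exp_lin (z : R[i]) x y :
  state_exp (z *: x + y) = z *: state_exp x + state_exp y.
Proof.
rewrite /state_exp scaler_sumr -big_split; apply: eq_bigr => g _ /=.
by rewrite cp_coef_lin phi_lin scalerDl scalerA.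
Qed.

Let seD x y : state_exp (x + y) = state_exp x + state_exp y.
Proof. by rewrite -{1}(scale1r x) state_exp_lin scale1r. Qed.
Let se0 : state_exp 0 = 0.
Proof. by apply: (@addrI _ (state_exp 0)); rewrite -seD !addr0. Qed.
Let seZ (z : R[i]) x : state_exp (z *: x) = z *: state_exp x.
Proof. by rewrite -{1}(addr0 (z *: x)) state_exp_lin se0 addr0. Qed.
Let se_sum I (r : seq I) (P : pred I) (F : I -> B) :
  state_exp (\sum_(i <- r | P i) F i) = \sum_(i <- r | P i) state_exp (F i).
Proof. exact: (big_morph _ seD se0). Qed.

Lemma state_exp_coef b g : ga_coef ga (state_exp b) g = phi (cp_coef b g).
Proof. by rewrite coef_lincomb. Qed.

Lemma state_exp_modl c b : state_exp (sv c * b) = c * state_exp b.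
Proof.
rewrite (sv_sum_unit ga_unitE) mulr_suml se_sum {2}(ga_coefE ga c) mulr_suml.
apply: eq_bigr => h _; rewrite -!scalerAl seZ; congr (_ *: _).
apply: (coef_ext (b := ga)) => g.
by rewrite coef_uMl !state_exp_coef cp_coef_unitl phi_act.
Qed.

Lemma state_exp_modr c b : state_exp (b * sv c) = state_exp b * c.
Proof.
rewrite (sv_sum_unit ga_unitE) mulr_sumr se_sum {2}(ga_coefE ga c) mulr_sumr.
apply: eq_bigr => h _; rewrite -!scalerAr seZ; congr (_ *: _).
apply: (coef_ext (b := ga)) => g.
by rewrite coef_uMr !state_exp_coef cp_coef_unitr.
Qed.

Lemma state_exp1 : state_exp 1 = 1.
Proof.
apply: (coef_ext (b := ga)) => g; rewrite state_exp_coef -unit1 cp_coef_unit.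
rewrite -(ga_unit1 ga) ga_coef_unit.
by case: eqP => _; rewrite ?phi1 ?(pfun0 phi_lin).
Qed.

Lemma trace_state_exp_gram b : trace ga (state_exp (star b * b)) =
  \sum_g phi (star (cp_coef b g) * cp_coef b g).
Proof.
rewrite /trace state_exp_coef cp_coef_gram (pfun_sum phi_lin).
by apply: eq_bigr => g _; rewrite phi_act.
Qed.

(** As [w] commutes with C, the compression fixes C once [w^2] has expectation 1. For positivity,
    the trace form at a Gram matrix is the trace of the expectation of its form at the vector with
    entries [w c_i]. *)
Lemma compressed_state_exp w : star w = w -> relative_commutant (group_cstar B) w ->
  state_exp (w * w) = 1 -> cond_exp (fun b => state_exp (w * b * w)).
Proof.
move=> sw wC ww; split; last first.
  move=> c /=; rewrite wC; last exact: subalgP.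
  by rewrite -mulrA state_exp_modl ww mulr1.
apply: (ucp_of_trace (b := ga)) => [a x y||n Y c]; last 1 first.
- have -> : \sum_i \sum_j star (c i) * state_exp (w * (adjmx Y *m Y) i j * w) * c j =
      state_exp (mx_form (adjmx Y *m Y) (\col_i (w * sv (c i)))).
    have colE k : (\col_i (w * sv (c i)) : 'cV[B]_n) k 0 = w * sv (c k).
      by rewrite mxE.
    rewrite mx_formE se_sum; apply: eq_bigr => i _; rewrite se_sum.
    apply: eq_bigr => j _; rewrite !colE starM sw -(star_homS hom).
    rewrite -state_exp_modl -state_exp_modr; congr state_exp.
    by rewrite !mulrA.
  rewrite mx_form_gram se_sum (pfun_sum (@trace_scalar _ _ _ ga)).
  apply: sumr_ge0 => i _; rewrite trace_state_exp_gram; apply: sumr_ge0 => g _.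
  exact/phi_pos/pos_star_mul.
- by rewrite mulrDr mulrDl -scalerAr -scalerAl state_exp_lin.
- by rewrite mulr1.
Qed.

Lemma state_exp_cond_exp : cond_exp state_exp.
Proof.
have one_comm : relative_commutant (group_cstar B) 1.
  by move=> c _; rewrite mul1r mulr1.
have se11 : state_exp (1 * 1) = 1 by rewrite mulr1 state_exp1.
have := compressed_state_exp (star1 _) one_comm se11.
rewrite (_ : (fun b => _) = state_exp)//.
by apply/funext => b; rewrite mul1r mulr1.
Qed.

End StateExpectation.

Lemma cond_exp_unique_trivial :
  (forall E1 E2, cond_exp E1 -> cond_exp E2 -> E1 = E2) -> commutant_trivial B.
Proof.
move=> uniq.
have [om sOm] := exists_state A.
have phiI := invariant_state_avg alpha [set: G]%G sOm.
set phi := om \o _ in phiI.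
(* An invariant state can be recovered from its expectation, at the coefficient of the unit of G. *)
have erg : uniquely_ergodic alpha [set: G].
  exists phi; split=> // f fI; apply/funext => a.
  have e := uniq _ _ (state_exp_cond_exp phiI) (state_exp_cond_exp fI).
  have := congr1 (fun E : B -> C => ga_coef ga (E (rcp_emb B a)) 1%g) e.
  by rewrite !state_exp_coef cp_coef_emb eqxx.
have /(uniquely_ergodicP alpha [set: G]%G) fixE := erg.
have [[phi_lin phi_pos phi1] _] := phiI.
(* By ergodicity the average of [a^* a] is [phi (a^* a)] times 1; if it vanishes, so does each of
   its positive terms. *)
have faithful a : phi (star a * a) = 0 -> a = 0.
  move=> phia.
  have : scalars A (group_avg alpha [set: G]%G (star a * a)).
    by rewrite -fixE; exact: group_avg_fixed.
  move=> [z _ zE].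
  have z0 : z = 0.
    rewrite -phia -(invariant_state_avgE (star a * a) phiI) -zE.
    by rewrite (pfunZ phi_lin) phi1 mulr1.
  have sum0 : \sum_(h : G) alpha h (star a * a) = 0.
    apply/eqP; move/esym/eqP: zE; rewrite z0 scale0r scaler_eq0 invr_eq0.
    rewrite pnatr_eq0 -[_ == 0%N]negbK -lt0n cardG_gt0 /=.
    by rewrite big_mkcond; under eq_bigr do rewrite inE.
  apply: star_mul_eq0; rewrite -(cact1 alpha (star a * a)).
  apply: (pos_sum_eq0 _ sum0) => h; apply: (star_hom_pos (actH h)).
  exact: pos_star_mul.
apply: commutant_trivial_sa => b sb bC.
have ceE := state_exp_cond_exp phiI; set E0 := state_exp phi in ceE.
have [E_ucp E_id] := ceE.
have [y yE] : exists y, y = b - sv (E0 b) by exists (b - sv (E0 b)).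
have sy : star y = y by rewrite yE starB -(star_homS hom) cond_exp_sub// sb.
have E0C : relative_commutant (group_cstar B) (sv (E0 b)).
  apply/(relative_commutant_unit ga_unitE) => h.
  rewrite -ga_unitE -!(star_homM hom); congr sv.
  rewrite -cond_exp_unitr// -cond_exp_unitl//; congr E0.
  by apply: bC; exact: group_cstar_unit.
have yC : relative_commutant (group_cstar B) y.
  by rewrite yE addrC -scaleN1r; exact: relative_commutant_lin.
have E0y : E0 y = 0.
  by rewrite yE -scaleN1r addrC; case: (ucpP E_ucp) => _ -> _; rewrite E_id scaleN1r addNr.
(* Makes [|e y| <= 1], so that [1 + e y] has a square root. *)
pose e : R := (cnorm y + 1)^-1.
have y0 := cnorm_ge0 y.
have ep : 0 < cnorm y + 1 by lra.
have e0 : 0 < e by rewrite invr_gt0.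
have zP : is_pos (1%:C *: 1 + e%:C *: y).
  apply: pos_le_add; first by rewrite starZr sy.
  by rewrite cnormZr gtr0_norm// mulrC ler_pdivrMr// mul1r; lra.
rewrite scale1r in zP.
have [w [sw zE wcomm]] := pos_sqrt zP.
have wC : relative_commutant (group_cstar B) w.
  move=> c cC; symmetry; apply: (wcomm); rewrite mulrDl mulrDr mul1r mulr1.
  by rewrite -scalerAl -scalerAr yC.
have wy : y * w = w * y.
  by apply: (wcomm); rewrite mulrDl mulrDr mul1r mulr1 -scalerAl -scalerAr.
have E0w : E0 (w * w) = 1.
  by rewrite -zE addrC; case: (ucpP E_ucp) => E1 -> _; rewrite E0y scaler0 add0r.
have ceW := compressed_state_exp phiI sw wC E0w.
(* At [y] the two expectations differ by [e E0 (y^2)]; equality forces [y^* y] to have expectation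
   0, so [y = 0] by faithfulness. *)
have := congr1 (fun E : B -> C => E y) (uniq _ _ ceW ceE).
rewrite -/E0 -mulrA wy mulrA -zE mulrDl mul1r -scalerAl addrC E0y.
case: (ucpP E_ucp) => _ -> _; rewrite E0y addr0 => /eqP.
rewrite scaler_eq0 fmorph_eq0 gt_eqF//= => /eqP yy0.
have : trace ga (E0 (star y * y)) = 0 by rewrite sy yy0 /trace coef0.
rewrite (trace_state_exp_gram phiI) => /eqP.
rewrite psumr_eq0 => [/allP coef_y|g _]; last exact/phi_pos/pos_star_mul.
have y_eq0 : y = 0.
  apply: cp_coef_ext => g; rewrite cp_coef0; apply: faithful; apply/eqP.
  exact: (coef_y g (mem_index_enum _)).
have -> : b = sv (E0 b) by apply/eqP; rewrite -subr_eq0 -yE y_eq0.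
exact: (subalgP (E0 b)).
Qed.

Lemma unique_conditional_expectationP :
  unique_conditional_expectation (group_cstar B) <-> commutant_trivial B.
Proof.
split=> [[E0 [_ E0U]]|triv].
  by apply: cond_exp_unique_trivial => E1 E2 /E0U <- /E0U <-.
have [om sOm] := exists_state A.
have ce := state_exp_cond_exp (invariant_state_avg alpha [set: G]%G sOm).
eexists; split; first exact: ce.
move=> E ceE; exact: cond_exp_unique.
Qed.

(** Forward, the envelope is arbitrary: composing with the injective [kappa] sends conditional
    expectations to pseudo-expectations. Backward, C is its own envelope. *)
Lemma unique_pseudo_expectationP :
  unique_pseudo_expectation (group_cstar B) <-> commutant_trivial B.
Proof.
split=> [[I [kappa [[khom kinj _ _] [Psi [_ PsiU]]]]]|triv].
  apply: cond_exp_unique_trivial => E1 E2 [u1 i1] [u2 i2].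
  have e1 : kappa \o E1 = Psi.
    apply/esym/PsiU; split=> [|c]; last by rewrite /= i1.
    exact: star_hom_ucp_comp.
  have e2 : kappa \o E2 = Psi.
    apply/esym/PsiU; split=> [|c]; last by rewrite /= i2.
    exact: star_hom_ucp_comp.
  apply/funext => b; apply: kinj.
  by have := congr1 (fun f : B -> I => f b) (etrans e1 (esym e2)).
exists C, id; split; last exact/unique_conditional_expectationP.
split=> //; first exact: (group_algebra_injective ga).
move=> S Srange _; apply/seteqP; split=> // c _; apply: Srange; by exists c.
Qed.

End ConditionalExpectation.

(** * Ergodic actions of finite groups live on finite-dimensional algebras *)

Section ErgodicFiniteDimensional.
Variables (R : realType) (A : cstarAlgType R) (G : finGroupType).
Variable alpha : cstar_action A G.
Hypothesis fixE : fixed_points alpha [set: G] = scalars A.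
Implicit Types (a x y : A) (g h : G).

Let actH g : star_hom (alpha g) := cact_hom alpha g.
Let N : R := #|G|%:R.
Let N0 : 0 < N. Proof. by rewrite ltr0n -cardsT cardG_gt0. Qed.

Lemma ergodic_state : exists phi : A -> R[i],
  state phi /\ forall a, \sum_g alpha g a = (N%:C * phi a) *: 1.
Proof.
have [om sOm] := exists_state A.
have phiI := invariant_state_avg alpha [set: G]%G sOm.
set phi := om \o _ in phiI; have [sphi _] := phiI; have [pl _ p1] := sphi.
exists phi; split=> // a.
have : scalars A (group_avg alpha [set: G]%G a) by rewrite -fixE; exact: group_avg_fixed.
move=> [z _ zE].
have -> : phi a = z.
  by rewrite -(invariant_state_avgE a phiI) -zE (pfunZ pl) p1 mulr1.
rewrite -scalerA zE /group_avg cardsT scalerA rmorph_nat mulfV ?scale1r; last first.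
  by rewrite pnatr_eq0 -lt0n -cardsT cardG_gt0.
by rewrite [RHS]big_mkcond; apply: eq_bigr => g _; rewrite inE.
Qed.

Section Orthonormal.
Variable phi : A -> R[i].
Hypothesis sphi : state phi.
Hypothesis avgE : forall a, \sum_g alpha g a = (N%:C * phi a) *: 1.

Let pl : scalar phi. Proof. by case: sphi. Qed.
Let pp a : is_pos a -> 0 <= phi a. Proof. by case: sphi => _ + _; apply. Qed.
Let p1 : phi 1 = 1. Proof. by case: sphi. Qed.

(** [x^* x] is the term at the unit of G in [sum_g alpha g (x^* x) = N phi (x^* x)]. *)
Lemma pimsner_popa x : cnorm x ^+ 2 <= N * Re (phi (star x * x)).
Proof.
have re : phi (star x * x) = (Re (phi (star x * x)))%:C.
  by apply: pfun_sa => //; rewrite starM starK.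
rewrite -cnorm_starM; apply: cnorm_pos_le; last 1 first.
- have -> : (N * Re (phi (star x * x)))%:C *: 1 = \sum_g alpha g (star x * x).
    by rewrite avgE rmorphM /= -re.
  rewrite (bigD1 1%g)//= cact1 addrC addrK; apply: pos_sum => g _.
  by apply: (star_hom_pos (actH g)); exact: pos_star_mul.
- apply: mulr_ge0; first exact: ltW.
  by rewrite -ler0c -re; apply/pp/pos_star_mul.
- exact: pos_star_mul.
Qed.

(** A substitute for traciality, by [phi (x^* x) <= |x|^2 = |x^*|^2]. *)
Lemma ergodic_state_star x : Re (phi (star x * x)) <= N * Re (phi (x * star x)).
Proof.
have := pimsner_popa (star x); rewrite cnorm_star starK; apply: le_trans.
have sx : star (star x * x) = star x * x by rewrite starM starK.
by have /andP[_] := state_sub1 sphi sx (lexx _); rewrite cnorm_starM.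
Qed.

(* For [s = sum_i x_i x_i^*] the average of the products [x_i x_i^* x_j x_j^*]
   is [N s], and its term at the unit of G is [s^2]. *)
Lemma orthonormal_bound n (x : 'I_n -> A) :
  (forall i j, phi (star (x i) * x j) = (i == j)%:R) -> n%:R <= N ^+ 2.
Proof.
move=> ortho; case: n x ortho => [|n] x ortho; first exact: sqr_ge0.
pose s := \sum_i x i * star (x i).
pose w g := \sum_j alpha g (x j) * star (x j).
have ss : star s = s.
  by rewrite star_sum; apply: eq_bigr => i _; rewrite starM starK.
have sumw : \sum_g star (w g) * w g = N%:C *: s.
  have wE g : star (w g) * w g =
      \sum_i \sum_j x i * alpha g (star (x i) * x j) * star (x j).
    rewrite /w star_sum mulr_suml; apply: eq_bigr => i _.
    rewrite mulr_sumr; apply: eq_bigr => j _.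
    by rewrite starM starK -(star_homS (actH g)) (star_homM (actH g)) !mulrA.
  under eq_bigr do rewrite wE.
  rewrite exchange_big scaler_sumr /=; apply: eq_bigr => i _.
  have sumg j : \sum_g x i * alpha g (star (x i) * x j) * star (x j) =
      (N%:C * (i == j)%:R) *: (x i * star (x j)).
    rewrite -ortho; transitivity (x i * ((N%:C * phi (star (x i) * x j)) *: 1) * star (x j)).
      by rewrite -avgE mulr_sumr mulr_suml.
    by rewrite -scalerAr mulr1 -scalerAl.
  rewrite exchange_big /=; under eq_bigr do rewrite sumg.
  rewrite (bigD1 i)//= eqxx mulr1 big1 ?addr0// => j ji.
  by rewrite eq_sym (negPf ji) mulr0 scale0r.
have w1 : w 1%g = s by apply: eq_bigr => j _; rewrite cact1.
pose t := Re (phi s).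
have tE : phi s = t%:C by apply: pfun_sa.
have ssN : Re (phi (s * s)) <= N * t.
  have : is_pos (N%:C *: s - s * s).
    rewrite -sumw (bigD1 1%g)//= w1 ss addrC addrK; apply: pos_sum => g _.
    exact: pos_star_mul.
  move/pp; rewrite pfunB// pfunZ// tE (pfun_sa pl pp (_ : star (s * s) = s * s)).
    by rewrite -rmorphM -rmorphB ler0c subr_ge0.
  by rewrite starM ss.
have tt : t ^+ 2 <= Re (phi (s * s)).
  have sst : star (s - t%:C *: 1) = s - t%:C *: 1 by rewrite starB ss starZr star1.
  have /pp := pos_sqr sst.
  have -> : (s - t%:C *: 1) * (s - t%:C *: 1) = s * s - (2 * t)%:C *: s + (t ^+ 2)%:C *: 1.
    rewrite rmorphM rmorphXn rmorph_nat /=; move: (t%:C) => v.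
    by expand_products; linear_identity R[i].
  rewrite pfunD// pfunB// !pfunZ// tE p1 mulr1 lecE => /andP[_].
  by case: (phi (s * s)) => a a' /=; rewrite !mul0r; lra.
have nt : n.+1%:R <= N * t.
  have -> : t = \sum_i Re (phi (x i * star (x i))).
    by rewrite /t pfun_sum// (raddf_sum (@complex.Re R : Rcomplex R -> R)).
  rewrite mulr_sumr; have -> : n.+1%:R = \sum_(i < n.+1) (1 : R).
    by rewrite sumr_const card_ord.
  apply: ler_sum => i _; have := ergodic_state_star (x i).
  by rewrite ortho eqxx.
have t0 : 0 < t by rewrite -(pmulr_rgt0 _ N0) (lt_le_trans _ nt)// ltr0n.
(* From [t^2 <= phi (s^2) <= N t]; together with [n <= N t] this gives [N^2]. *)
have tN : t <= N by rewrite -(ler_pM2r t0) -expr2 (le_trans tt).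
by rewrite (le_trans nt)// expr2 ler_pM2l.
Qed.

(** Gram-Schmidt; the remainder [y] can be normalized since [pimsner_popa] makes [phi] faithful. *)
Lemma orthonormal_exists n : ~ finite_dimensional A ->
  exists x : 'I_n -> A, forall i j, phi (star (x i) * x j) = (i == j)%:R.
Proof.
move=> nfd; elim: n => [|n [x ortho]]; first by exists (fun=> 0) => -[].
have [a aspan] : exists a, forall c : 'I_n -> R[i], a <> \sum_i c i *: x i.
  apply: contrapT => H; apply: nfd; exists n, x => a.
  apply: contrapT => Ha; apply: H; exists a => c ac.
  by apply: Ha; exists c.
pose y := a - \sum_i phi (star (x i) * a) *: x i.
have y0 : y != 0.
  apply/eqP => y0; apply: (aspan (fun i => phi (star (x i) * a))).
  by apply/eqP; rewrite -subr_eq0 -/y y0.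
have xy i : phi (star (x i) * y) = 0.
  rewrite /y mulrBr pfunB// mulr_sumr pfun_sum// (bigD1 i)//= -scalerAr pfunZ//.
  rewrite ortho eqxx mulr1 big1 ?addr0 ?subrr// => j ji.
  by rewrite -scalerAr pfunZ// ortho eq_sym (negPf ji) mulr0.
pose r := Re (phi (star y * y)).
have rE : phi (star y * y) = r%:C by apply: pfun_sa => //; rewrite starM starK.
have r0 : 0 < r.
  have := pimsner_popa y; rewrite -/r => h.
  rewrite -(pmulr_rgt0 _ N0) (lt_le_trans _ h)// exprn_gt0// lt_def cnorm_ge0 andbT.
  by apply: contra_neq y0 => /cnorm0_eq0.
pose z := (Num.sqrt r)^-1%:C *: y.
have zz : phi (star z * z) = 1.
  rewrite /z starZr -scalerAl -scalerAr !pfunZ// rE -!rmorphM /=.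
  by rewrite mulrA -invfM -expr2 sqr_sqrtr ?ltW// mulVf ?gt_eqF.
have xz i : phi (star (x i) * z) = 0 by rewrite /z -scalerAr pfunZ// xy mulr0.
have zx i : phi (star z * x i) = 0.
  by rewrite -(starK (star z * x i)) pfun_star// starM starK xz conjC0.
exists (fun i => if unlift ord0 i is Some j then x j else z) => i j.
case: unliftP => [i' ->|->]; case: unliftP => [j' ->|->].
- by rewrite ortho (inj_eq lift_inj).
- by rewrite xz eq_sym (negPf (neq_lift _ _)).
- by rewrite zx (negPf (neq_lift _ _)).
- by rewrite zz eqxx.
Qed.

End Orthonormal.

Lemma ergodic_finite_dimensional : finite_dimensional A.
Proof.
apply: contrapT => nfd; have [phi [sphi avgE]] := ergodic_state.
have [x ortho] := orthonormal_exists sphi avgE (#|G| ^ 2).+1 nfd.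
have := orthonormal_bound sphi avgE ortho.
by rewrite /N -natrX ler_nat ltnn.
Qed.

End ErgodicFiniteDimensional.

Theorem theorem3p5 (R : realType) (A : cstarAlgType R) (G : finGroupType)
    (alpha : cstar_action A G) (B : reduced_crossed_product alpha) :
  [<-> PEP (group_cstar B);
       AEP (group_cstar B);
       aperiodic (group_cstar B);
       unique_pseudo_expectation (group_cstar B);
       unique_conditional_expectation (group_cstar B);
       (forall g : G, uniquely_ergodic alpha 'C[g]%g);
       relative_commutant (group_cstar B) = sub_center (group_cstar B);
       (forall g : G, fixed_points alpha 'C[g]%g = scalars A)] /\
  (~ finite_dimensional A ->
     ~ PEP (group_cstar B) /\
     ~ AEP (group_cstar B) /\
     ~ aperiodic (group_cstar B) /\
     ~ unique_pseudo_expectation (group_cstar B) /\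
     ~ unique_conditional_expectation (group_cstar B) /\
     ~ (forall g : G, uniquely_ergodic alpha 'C[g]%g) /\
     relative_commutant (group_cstar B) <> sub_center (group_cstar B) /\
     ~ (forall g : G, fixed_points alpha 'C[g]%g = scalars A)).
Proof.
have [ga ga_unitE] := group_cstar_algebra B.
have pep : PEP (group_cstar B) <-> commutant_trivial B.
  split=> [/PEP_AEP|]; first exact: (AEP_commutant_trivial ga).
  exact: commutant_trivial_PEP ga_unitE.
have aep : AEP (group_cstar B) <-> commutant_trivial B.
  split; first exact: (AEP_commutant_trivial ga).
  by move=> /pep /PEP_AEP.
have ape : aperiodic (group_cstar B) <-> commutant_trivial B.
  split; first exact: (aperiodic_commutant_trivial ga).
  exact: commutant_trivial_aperiodic ga_unitE.
have pse := unique_pseudo_expectationP ga_unitE.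
have ce := unique_conditional_expectationP ga_unitE.
have com := commutant_trivialP B.
have fix_ := commutant_trivial_fixed_points ga_unitE.
have erg : (forall g : G, uniquely_ergodic alpha 'C[g]%g) <-> commutant_trivial B.
  rewrite fix_; split=> H g; first exact/(uniquely_ergodicP alpha 'C[g]%G)/H.
  exact/(uniquely_ergodicP alpha 'C[g]%G)/H.
split.
  tfae; [by move=> /pep/aep|by move=> /aep/ape|by move=> /ape/pse|by move=> /pse/ce
    |by move=> /ce/erg|by move=> /erg/com|by move=> /com/fix_|by move=> /fix_/pep].
move=> nfd; have ntriv : ~ commutant_trivial B.
  (* The centralizer of the unit is all of G, so the action itself is ergodic. *)
  move=> /fix_/(_ 1%g); rewrite cent11T => fixE.
  exact/nfd/(ergodic_finite_dimensional fixE).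
by rewrite pep aep ape pse ce erg com -fix_; do !split.
Qed.
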